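(* Let $A\in\mathbf{M}_n(\mathbb{C})$ be a matrix whose numerical range $W(A)$ has nonempty interior, and for $\theta\in S^1=\mathbb{R}/(2\pi\mathbb{Z})$ let $\lambda_1(\theta),\dots,\lambda_n(\theta)$ be the eigenvalues (with multiplicity) of the Hermitian matrix $H(\theta)=\frac12(e^{-i\theta}A+e^{i\theta}A^* )$. Then the numerical density of $A$ is represented, for almost all $(x,y)\in\mathbb{R}^2$, by $$f_A(x+iy)=\frac{1}{4\pi}\int_{S^1}\mathcal{H}B'[\lambda_1(\theta),\dots,\lambda_n(\theta)](x\cos\theta+y\sin\theta)\,\mathrm{d}\theta ,$$ where both sides define integrable functions of $z=x+iy\in\mathbb{C}$.
   Context: The numerical range is $W(A)=\{\langle Ax,x\rangle:x\in\mathbb{C}^n,\|x\|=1\}$ with $\langle x,y\rangle=y^*x$. The numerical measure $\mu_A$ is the image, under $x\mapsto\langle Ax,x\rangle$, of the normalized (probability) Euclidean surface measure on the unit sphere of $\mathbb{C}^n$. When $W(A)$ has nonempty interior, $\mu_A$ is absolutely continuous with respect to two-dimensional Lebesgue measure on $\mathbb{C}$, with density $f_A=\mathrm{d}\mu_A/\mathrm{d}z$ (the numerical density), and $H(\theta)$ is nonscalar for every $\theta$. Normalized $B$-spline with knots $\lambda_1,\dots,\lambda_n\in\mathbb{R}$ not all equal: $B[\lambda_1,\dots,\lambda_n](s)=(n-1)\,\delta^{n-1}[\lambda_1,\dots,\lambda_n](\cdot-s)_+^{n-2}$, where $(\cdot-s)_+^{n-2}$ is $y\mapsto\max(0,y-s)^{n-2}$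 (equal to $1$ for $y>s$ and $0$ for $y<s$ if $n=2$) and $\delta^{n-1}[\lambda_1,\dots,\lambda_n]g=\sum_j g(\lambda_j)/\prod_{k\ne j}(\lambda_j-\lambda_k)$ is the divided difference when the knots are distinct, extended by continuity (Hermite interpolation) to repeated knots. It is defined for a.e. $s$ and is a compactly supported integrable function. $B'$ is the derivative of $B[\lambda_1(\theta),\dots,\lambda_n(\theta)](s)$ with respect to $s$ in the sense of distributions, and $\mathcal{H}$ is the Hilbert transform in $s$, i.e. convolution with the distribution $\mathrm{p.v.}\frac{1}{\pi s}$. The right-hand side is understood in the sense of distributions on $\mathbb{R}^2$: its action on a test function $\varphi\in C_c^\infty(\mathbb{R}^2)$ is $\frac1{4\pi}\int_{S^1}\langle \mathcal{H}B'[\lambda_1(\theta),\dots,\lambda_n(\theta)],\varphi_\theta\rangle\,\mathrm{d}\theta$ with $\varphi_\theta(s)=\int_{\mathbb{R}}\varphi(s\cos\theta-u\sin\theta,\,s\sin\theta+u\cos\theta)\,\mathrm{d}u$. *)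

(* Defs.v *)
From HB Require Import structures.
From mathcomp Require Import all_boot all_order all_algebra.
From mathcomp Require Import all_classical all_reals all_analysis.
From mathcomp Require Import measurable_realfun complex.

Set Implicit Arguments.
Unset Strict Implicit.
Unset Printing Implicit Defensive.

Import Order.TTheory GRing.Theory Num.Theory.
Import numFieldNormedType.Exports.

Local Open Scope classical_set_scope.
Local Open Scope ring_scope.
Local Open Scope complex_scope.
Local Open Scope charge_scope.
Local Open Scope sesquilinear_scope.

Section sigma_finite.
Context d1 d2 (T1 : measurableType d1) (T2 : measurableType d2) (R : realType).

(* The canonical sigma-finite instance of [\x] in the library is shadowed by
   the one for subprobabilities, hence this lemma. *)
Lemma sigma_finite_product (m1 : {sigma_finite_measure set T1 -> \bar R})
    (m2 : {sigma_finite_measure set T2 -> \bar R}) :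
  sigma_finite setT (m1 \x m2)%E.
Proof.
have /sigma_finiteP[F [TF ndF Foo]] := sigma_finiteT m1.
have /sigma_finiteP[G [TG ndG Goo]] := sigma_finiteT m2.
exists (fun n => F n `*` G n).
  rewrite -setXTT TF TG predeqE => -[x y]; split.
    move=> [/= [n _ Fnx] [k _ Gky]]; exists (maxn n k) => //; split.
    - by move: x Fnx; exact/subsetPset/ndF/leq_maxl.
    - by move: y Gky; exact/subsetPset/ndG/leq_maxr.
  by move=> [n _ []/= ? ?]; split; exists n.
move=> k; have [? ?] := Foo k; have [? ?] := Goo k.
split; first exact: measurableX.
by rewrite product_measure1E// lte_mul_pinfty// ge0_fin_numE.
Qed.

Lemma sigma_finite_pushforward (mu : {measure set T1 -> \bar R})
    (f : T1 -> T2) (g : T2 -> T1) :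
  sigma_finite setT mu -> measurable_fun setT g -> cancel f g ->
  sigma_finite setT (pushforward mu f).
Proof.
move=> [F TF Foo] mg fK; exists (fun k => g @^-1` F k).
  by rewrite -preimage_bigcup -TF preimage_setT.
move=> k; have [mF Fk] := Foo k; split.
  by rewrite -[X in measurable X]setTI; exact: mg.
rewrite /pushforward -comp_preimage (_ : g \o f = id) ?preimage_id//.
by apply/funext => x /=; rewrite fK.
Qed.

End sigma_finite.

(* C is identified with R * R, which carries the topology, the Borel
   sigma-algebra and the two-dimensional Lebesgue measure. *)
Notation plane R := (measurableTypeR R * measurableTypeR R)%type.

Definition to_plane (R : realType) (z : R[i]) : R * R :=
  (complex.Re z, complex.Im z).

Section lebesgueC.
Context (R : realType).

Definition lebesgue2 : set (plane R) -> \bar R :=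
  ((@lebesgue_measure R) \x (@lebesgue_measure R))%E.

HB.instance Definition _ := Measure.copy lebesgue2
  ((@lebesgue_measure R) \x (@lebesgue_measure R))%E.

HB.instance Definition _ := Measure_isSigmaFinite.Build _ _ _
  lebesgue2 (sigma_finite_product _ _).

Definition tcons n (z : plane R * n.-tuple (plane R)) : n.+1.-tuple (plane R) :=
  [tuple of z.1 :: z.2].

Let measurable_tcons n : measurable_fun setT (@tcons n).
Proof. exact: measurable_cons. Qed.

HB.instance Definition _ n := isMeasurableFun.Build _ _ _ _ (@tcons n)
  (@measurable_tcons n).

Definition lebesgueC_cons n
    (mu : {sigma_finite_measure set (n.-tuple (plane R)) -> \bar R}) :
    set (n.+1.-tuple (plane R)) -> \bar R :=
  pushforward (lebesgue2 \x mu)%E (@tcons n).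

Section instances.
Variables (n : nat)
  (mu : {sigma_finite_measure set (n.-tuple (plane R)) -> \bar R}).

Let lebesgueC_cons0 : lebesgueC_cons mu set0 = 0%E.
Proof. exact: measure0. Qed.

Let lebesgueC_cons_ge0 A : (0 <= lebesgueC_cons mu A)%E.
Proof. exact: measure_ge0. Qed.

Let lebesgueC_cons_sigma_additive : semi_sigma_additive (lebesgueC_cons mu).
Proof. exact: measure_semi_sigma_additive. Qed.

HB.instance Definition _ := isMeasure.Build _ _ _ (lebesgueC_cons mu)
  lebesgueC_cons0 lebesgueC_cons_ge0 lebesgueC_cons_sigma_additive.

Let lebesgueC_cons_sigma_finite : sigma_finite setT (lebesgueC_cons mu).
Proof.
pose g (t : n.+1.-tuple (plane R)) := (tnth t ord0, [tuple of behead t]).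
apply: (@sigma_finite_pushforward _ _ _ _ _ _ _ g).
- exact: sigma_finite_product.
- apply: measurable_fun_pair; first exact: measurable_tnth.
  exact: measurable_behead.
- by move=> [z t]; rewrite /g /tcons; congr pair; exact/val_inj.
Qed.

HB.instance Definition _ := Measure_isSigmaFinite.Build _ _ _
  (lebesgueC_cons mu) lebesgueC_cons_sigma_finite.
End instances.

(* C^n is encoded by tuples of points of the plane. *)
Fixpoint lebesgueC n :
    {sigma_finite_measure set (n.-tuple (plane R)) -> \bar R} :=
  match n with
  | 0 => \d_[tuple]
  | m.+1 => lebesgueC_cons (lebesgueC m)
  end.

End lebesgueC.

Section numerical_range.
Context (R : realType) (n : nat).
Implicit Types (x y : 'cV[R[i]]_n) (A : 'M[R[i]]_n).

(* <x, y> = y^* x *)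
Definition inner x y : R[i] := (y ^t* *m x) 0 0.

Definition norm2 x : R := Num.sqrt (complex.Re (inner x x)).

Definition numerical_range A : set R[i] :=
  [set inner (A *m x) x | x in [set x | norm2 x = 1]].

Definition hermitian_part A (theta : R) : 'M[R[i]]_n :=
  2^-1 *: ((cos theta -i* sin theta) *: A +
           (cos theta +i* sin theta) *: A ^t*).

End numerical_range.

Section numerical_measure.
Context (R : realType) (n : nat).
Implicit Types (t : n.-tuple (plane R)) (A : 'M[R[i]]_n).

Definition cvec t : 'cV[R[i]]_n := \col_i ((tnth t i).1 +i* (tnth t i).2).

Let cmeasurable d (T : measurableType d) (f : T -> R[i]) :=
  measurable_fun setT (@complex.Re R \o f) /\
  measurable_fun setT (@complex.Im R \o f).

Let cmeasurableM d (T : measurableType d) (f g : T -> R[i]) :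
  cmeasurable f -> cmeasurable g -> cmeasurable (fun x => f x * g x).
Proof.
move=> [f1 f2] [g1 g2]; split.
- rewrite (_ : _ \o _ = (@complex.Re R \o f) \* (@complex.Re R \o g) \-
    (@complex.Im R \o f) \* (@complex.Im R \o g)).
    by apply: measurable_funB; exact: measurable_funM.
  by apply/funext => x /=; case: (f x) (g x) => [? ?] [? ?].
- rewrite (_ : _ \o _ = (@complex.Re R \o f) \* (@complex.Im R \o g) \+
    (@complex.Im R \o f) \* (@complex.Re R \o g)).
    by apply: measurable_funD; exact: measurable_funM.
  by apply/funext => x /=; case: (f x) (g x) => [? ?] [? ?].
Qed.

Let cmeasurable_sum d (T : measurableType d) I (r : seq I)
    (f : I -> T -> R[i]) :
  (forall i, cmeasurable (f i)) -> cmeasurable (fun x => \sum_(i <- r) f i x).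
Proof.
move=> mf; split.
- rewrite (_ : _ \o _ = fun x => \sum_(i <- r) complex.Re (f i x)).
    by apply: measurable_sum => i; have [] := mf i.
  by apply/funext => x /=; rewrite raddf_sum.
- rewrite (_ : _ \o _ = fun x => \sum_(i <- r) complex.Im (f i x)).
    by apply: measurable_sum => i; have [] := mf i.
  by apply/funext => x /=; rewrite raddf_sum.
Qed.

Let cmeasurable_cvec i : cmeasurable (fun t => cvec t i 0).
Proof.
split.
- rewrite (_ : _ \o _ = fst \o (@tnth n _ ^~ i)).
    by apply: measurableT_comp => //; exact: measurable_tnth.
  by apply/funext => t /=; rewrite mxE.
- rewrite (_ : _ \o _ = snd \o (@tnth n _ ^~ i)).
    by apply: measurableT_comp => //; exact: measurable_tnth.
  by apply/funext => t /=; rewrite mxE.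
Qed.

Let cmeasurable_quad A :
  cmeasurable (fun t => inner (A *m cvec t) (cvec t)).
Proof.
rewrite (_ : (fun t => _) = fun t => \sum_i conjc (cvec t i 0) *
    \sum_j A i j * cvec t j 0); last first.
  apply/funext => t; rewrite /inner mxE; apply: eq_bigr => i _.
  by rewrite !mxE.
apply: cmeasurable_sum => i; apply: cmeasurableM; last first.
  apply: cmeasurable_sum => j; apply: cmeasurableM; last exact: cmeasurable_cvec.
  by split; exact: measurable_cst.
have [m1 m2] := cmeasurable_cvec i; split.
  rewrite (_ : _ \o _ = @complex.Re R \o (fun t => cvec t i 0))//.
  by apply/funext => t /=; case: (cvec t i 0).
rewrite (_ : _ \o _ = \- (@complex.Im R \o (fun t => cvec t i 0)))//.
  exact: measurable_funN.
by apply/funext => t /=; case: (cvec t i 0).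
Qed.

Let measurable_norm2 : measurable_fun setT (fun t => norm2 (cvec t)).
Proof.
apply: (@measurableT_comp _ _ _ _ _ _ (@Num.sqrt R)).
  exact: continuous_measurable_fun (@sqrt_continuous R).
by have [] := cmeasurable_quad 1%:M; under eq_fun do rewrite mul1mx.
Qed.

Definition unit_ball : set (n.-tuple (plane R)) :=
  [set t | norm2 (cvec t) <= 1].

Lemma measurable_unit_ball : measurable unit_ball.
Proof.
rewrite -[X in measurable X]setTI.
exact: (measurable_norm2 measurableT (measurable_itv `]-oo, 1])).
Qed.

Definition uniform_ball : set (n.-tuple (plane R)) -> \bar R :=
  mnormalize (mrestr (lebesgueC R n) measurable_unit_ball)
             (\d_(nseq_tuple n (0, 0) : n.-tuple (plane R))).

HB.instance Definition _ := Probability.copy uniform_ball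
  (mnormalize (mrestr (lebesgueC R n) measurable_unit_ball)
             (\d_(nseq_tuple n (0, 0) : n.-tuple (plane R)))).

Definition radial_proj t : n.-tuple (plane R) :=
  [tuple ((tnth t i).1 / norm2 (cvec t), (tnth t i).2 / norm2 (cvec t))
    | i < n].

Let measurable_radial_proj : measurable_fun setT radial_proj.
Proof.
have minv : measurable_fun setT (fun t => (norm2 (cvec t))^-1).
  rewrite (_ : (fun t => _) = (@powR R ^~ (-1)) \o (fun t => norm2 (cvec t))).
    by apply: measurableT_comp => //; exact: measurable_powR.
  by apply/funext => t /=; rewrite powR_inv1// sqrtr_ge0.
apply/measurable_fun_tnthP => i.
rewrite (_ : _ \o _ = fun t =>
  ((tnth t i).1 / norm2 (cvec t), (tnth t i).2 / norm2 (cvec t))); last first.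
  by apply/funext => t /=; rewrite tnth_mktuple.
by apply: measurable_fun_pair; apply: measurable_funM => //;
  apply: measurableT_comp => //; exact: measurable_tnth.
Qed.

HB.instance Definition _ := isMeasurableFun.Build _ _ _ _ radial_proj
  measurable_radial_proj.

(* Normalized surface measure on the unit sphere of C^n, via the cone formula:
   the surface measure of E is proportional to the Lebesgue measure of
   { r x | 0 < r <= 1, x in E }. *)
Definition sphere_measure : set (n.-tuple (plane R)) -> \bar R :=
  distribution uniform_ball radial_proj.

HB.instance Definition _ := Probability.copy sphere_measure
  (distribution uniform_ball radial_proj).

Definition quadratic_form A t : plane R :=
  to_plane (inner (A *m cvec t) (cvec t)).

Let measurable_quadratic_form A : measurable_fun setT (quadratic_form A).
Proof.
by have [? ?] := cmeasurable_quad A; exact: measurable_fun_pair.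
Qed.

HB.instance Definition _ A := isMeasurableFun.Build _ _ _ _ (quadratic_form A)
  (measurable_quadratic_form A).

Definition numerical_measure A : set (plane R) -> \bar R :=
  distribution sphere_measure (quadratic_form A).

HB.instance Definition _ A := Probability.copy (numerical_measure A)
  (distribution sphere_measure (quadratic_form A)).

(* The library sets a Radon-Nikodym derivative to the constant -oo when
   absolute continuity fails; asserting that this function is integrable
   therefore includes the absolute continuity of the numerical measure. *)
Definition numerical_density A : plane R -> \bar R :=
  'd (charge_of_finite_measure (numerical_measure A)) '/d (@lebesgue2 R).

End numerical_measure.

Section bspline.
Context (R : realType) (n : nat).
Implicit Types (l m : 'rV[R]_n) (g : R -> R).

Definition divdiff_distinct g m : R :=
  \sum_j g (m 0 j) / \prod_(k | k != j) (m 0 j - m 0 k).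

(* Extension by continuity from distinct knots to repeated knots; the limit
   exists whenever g is smooth near every knot. *)
Definition divdiff l g : R :=
  if injectiveb (l 0) then divdiff_distinct g l
  else lim (divdiff_distinct g @
              within [set m : 'rV[R]_n | injective (m 0)] (nbhs l)).

(* y |-> (y - s)_+^(n - 2); not [Num.max 0 (y - s) ^+ (n - 2)], which is
   constantly 1 when n = 2 *)
Definition trunc_power (s y : R) : R := if s < y then (y - s) ^+ (n - 2) else 0.

Definition bspline l (s : R) : R := (n.-1)%:R * divdiff l (trunc_power s).

End bspline.

(* A distribution on R is given by its values on test functions. The operations
   below may be applied to non-compactly supported smooth functions when the
   distribution has compact support. *)
Section distributions.
Context (R : realType).
Local Notation leb := (@lebesgue_measure R).

Definition distr := (R -> R) -> R.
Implicit Types (T S : distr) (psi : R -> R).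

Definition regular (f : R -> R) : distr :=
  fun psi => \int[leb]_(s in setT) (f s * psi s).

Definition distr_deriv T : distr := fun psi => - T (derive1 psi).

(* p.v. 1 / (pi s) *)
Definition pv_inv : distr := fun psi =>
  lim ((\int[leb]_(s in [set s | e < `|s|]) (psi s / (pi * s))) @[e --> 0^'+]).

Definition distr_conv T S : distr :=
  fun psi => T (fun s => S (fun u => psi (s + u))).

Definition hilbert T : distr := distr_conv T pv_inv.

Fixpoint continuously_differentiable (k : nat) (phi : R * R -> R) : Prop :=
  match k with
  | 0 => continuous phi
  | k'.+1 =>
    [/\ forall z, derivable phi z (1, 0),
        forall z, derivable phi z (0, 1),
        continuously_differentiable k' (fun z => 'D_(1, 0) phi z) &
        continuously_differentiable k' (fun z => 'D_(0, 1) phi z)]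
  end.

Definition test_function (phi : R * R -> R) : Prop :=
  (forall k, continuously_differentiable k phi) /\
  compact (closure [set z | phi z != 0]).

Definition line_integral (phi : R * R -> R) (theta s : R) : R :=
  \int[leb]_(u in setT) phi (s * cos theta - u * sin theta,
                             s * sin theta + u * cos theta).

(* < H B'[lambda_1(theta), ..., lambda_n(theta)], phi_theta > *)
Definition density_integrand n (lambda : R -> 'rV[R]_n) (phi : R * R -> R)
    (theta : R) : R :=
  hilbert (distr_deriv (regular (bspline (lambda theta))))
          (line_integral phi theta).

End distributions.

(* Main.v *)
(* By the definition of distributional derivatives and convolutions, the pairing
   at angle theta is - \int B(s) K(theta, s) ds, where K(theta, .) is the
   Hilbert transform of the derivative of phi_theta. Two facts identify it.

   First, the B-spline whose knots are the eigenvalues of a Hermitian matrix H is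
   the density of the law of <Hx, x> for x uniform on the unit sphere: for large
   real z, both laws integrate (z - s)^(-n) to \prod_j (z - lambda_j)^(-1) (a
   Gaussian integral in polar coordinates on one side, the recursion for divided
   differences on the other), and differentiating in z and the Weierstrass theorem
   show that this function determines a compactly supported law. As
   <H(theta) x, x> = Re (e^(-i theta) <Ax, x>), the pairing at theta is minus the
   integral of K(theta, a cos theta + b sin theta) against mu_A(da db).

   Second, \int K(theta, a cos theta + b sin theta) dtheta = - 4 pi phi(a, b). In
   coordinates (u, u t) around (a, b) rotated by theta, the angular derivative of
   phi integrates to 0 over the circle; hence the derivative of phi in the direction
   theta may be replaced by (1 + t^2)^(-1) times its derivative along the ray
   u |-> u (1, t), which integrates to - phi(a, b), and \int dt / (1 + t^2) = pi.

   That mu_A has a density is proved on complex lines x + z w. There <A., .>/<., .>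
   minus its value at w is a real affine function of z over a positive quadratic
   polynomial, and the preimage of a null set is null as soon as the linear part is
   invertible, which for almost every x holds for a suitable w unless A is normal
   with collinear eigenvalues, i.e. unless W(A) is contained in a line. *)

From HB Require Import structures.
Require Import Defs.
From mathcomp Require Import all_boot all_order all_algebra.
From mathcomp Require Import all_classical all_reals all_analysis.
From mathcomp Require Import measurable_realfun complex spectral ring lra zify.

Set Implicit Arguments.
Unset Strict Implicit.
Unset Printing Implicit Defensive.

Import Order.TTheory GRing.Theory Num.Theory.
Import numFieldNormedType.Exports.
Local Open Scope classical_set_scope.
Local Open Scope ring_scope.

(** * Integration and differentiation on the real line *)

(** Only resolvents of order at least [n] are compared: radial integration in C^n produces exactly
    the power [- n], and differentiation only raises the order. Hence the Weierstrass approximation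
    is applied to a function of [U = (K + 1 - X)^-1] from which a factor [U ^ n] has been split off.
    The weights in this comparison may be signed, which spares a proof that the spline is
    nonnegative.

    The knots are an arbitrary choice of eigenvalues at each angle, so no regularity in [theta] can
    be drawn from them. It is recovered once the pairing is rewritten as an average over the unit
    ball of a kernel that depends on [A] alone; that average is also what Fubini exchanges with the
    integral over the circle.

    In the inversion formula the direction derivative may be replaced by the ray derivative only
    after averaging over the circle. The circle integral is therefore made innermost while the
    kernel is still bounded on a box, and slopes are introduced afterwards.

    The function required by the theorem is the Radon-Nikodym derivative itself, so every claim
    about pairings reduces to integrals of test functions against the numerical measure. *)

Section affine_change.
Context (R : realType).
Local Notation leb := (@lebesgue_measure R).

Definition affine (a b : R) : measurableTypeR R -> measurableTypeR R :=
  fun x => a * x + b.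

Lemma measurable_affine (a b : R) : measurable_fun setT (affine a b).
Proof. by apply: measurable_funD => //; exact: measurable_funM. Qed.

HB.instance Definition _ a b := isMeasurableFun.Build _ _ _ _ (affine a b)
  (measurable_affine a b).

Definition affine_push a b := pushforward leb (affine a b).

HB.instance Definition _ a b := Measure.copy (affine_push a b)
  (measure_function_pushforward__canonical__measure_function_Measure leb
    (measurable_affine a b)).

(** The rescaled image measure gives half-open intervals their length, and this characterizes
    Lebesgue measure. *)
Lemma lebesgue_affine_pos (a b : R) (A : set (measurableTypeR R)) :
  0 < a -> measurable A ->
  (a%:E * affine_push a b A)%E = leb A.
Proof.
move=> a0 mA.
pose m' : {measure set (measurableTypeR R) -> \bar R} :=
  mscale (NngNum (ltW a0)) (affine_push a b).
have := @lebesgue_measure_unique R m' _ A mA => ->//.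
move=> _ [[x y] /= xy <-]; rewrite /m' /mscale /= /affine_push /pushforward.
have -> : affine a b @^-1` `]x, y] = `](x - b) / a, (y - b) / a]%classic.
  apply/seteqP; split => z /=; rewrite /= !in_itv /= ltr_pdivrMr// ler_pdivlMr//
     ltrBlDr lerBrDr (mulrC z) //.
rewrite !lebesgue_measure_itv /= !lte_fin ltr_pM2r ?invr_gt0// ltrBDr subrK.
case: ifPn => // _; last by rewrite mule0.
by rewrite -!EFinB -EFinM; congr EFin; field; rewrite gt_eqF.
Qed.

(** A negative slope is a positive one composed with [x |-> - x], which preserves Lebesgue
    measure. *)
Lemma lebesgue_affine (a b : R) (A : set (measurableTypeR R)) :
  a != 0 -> measurable A ->
  (`|a|%:E * affine_push a b A)%E = leb A.
Proof.
move=> a0 mA; have [ap|an|/eqP] := ltgtP 0 a; last by rewrite eq_sym (negPf a0).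
  by rewrite gtr0_norm// lebesgue_affine_pos.
have an0 : 0 < - a by rewrite oppr_gt0.
rewrite ltr0_norm// -[in RHS](lebesgue_affine_pos b an0 mA); congr (_ * _)%E.
rewrite /affine_push /pushforward -[LHS]lebesgue_measureN; last first.
  exact: (measurable_funPTI (affine a b)).
rewrite /pushforward; congr leb.
have E x : affine (- a) b x = affine a b (- x) by rewrite /affine mulNr mulrN.
by apply/seteqP; split => x /=; rewrite E.
Qed.

Lemma ge0_integral_affine (a b : R) (f : R -> \bar R) : a != 0 ->
  measurable_fun setT f -> (forall x, 0 <= f x)%E ->
  (\int[leb]_x f x = `|a|%:E * \int[leb]_x f (affine a b x))%E.
Proof.
move=> a0 mf f0.
transitivity (\int[mscale (NngNum (normr_ge0 a)) (affine_push a b)]_x f x)%E.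
  by apply: eq_measure_integral => A mA _; exact: esym (lebesgue_affine b a0 mA).
rewrite ge0_integral_mscale//=; congr (_ * _)%E.
exact: (ge0_integral_pushforward (measurable_affine a b) leb measurableT mf).
Qed.

Lemma integral_affine (a b : R) (f : R -> \bar R) : a != 0 ->
  measurable_fun setT f -> leb.-integrable setT (f \o affine a b) ->
  (\int[leb]_x f x = `|a|%:E * \int[leb]_x f (affine a b x))%E.
Proof.
move=> a0 mf intf.
have mfp : measurable_fun setT f^\+%E by exact: measurable_funepos.
have mfn : measurable_fun setT f^\-%E by exact: measurable_funeneg.
rewrite integralE (ge0_integral_affine b a0 mfp)//
  (ge0_integral_affine b a0 mfn)//.
have fp x : f^\+%E (affine a b x) = (f \o affine a b)^\+%E x by rewrite !unlock.
have fn x : f^\-%E (affine a b x) = (f \o affine a b)^\-%E x by rewrite !unlock.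
under eq_integral do rewrite fp; under [X in (_ - _ * X)%E]eq_integral do rewrite fn.
rewrite -muleBr//; first by rewrite -[RHS]/(_ * \int[leb]_x (f \o affine a b) x)%E [in RHS]integralE.
by apply: fin_num_adde_defl; rewrite fin_numN; exact: (integrable_neg_fin_num measurableT intf).
Qed.

Lemma Rintegral_affine (a b : R) (f : R -> R) : a != 0 ->
  measurable_fun setT f -> leb.-integrable setT (EFin \o (f \o affine a b)) ->
  \int[leb]_x f x = `|a| * \int[leb]_x f (affine a b x).
Proof.
move=> a0 mf intf; rewrite /Rintegral (@integral_affine a b (EFin \o f)) => //.
  by rewrite fineM//; exact: integrable_fin_num.
exact/measurable_EFinP.
Qed.

End affine_change.

(** * Fubini's theorem for real-valued integrals *)

Section fubini_bounded.
Context d1 d2 (T1 : measurableType d1) (T2 : measurableType d2) (R : realType).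

(** The real integral is [fine] of the difference of the integrals of the positive and negative
    parts; Tonelli makes each of these measurable in [x]. *)
Lemma measurable_Rintegral_snd (m2 : {sigma_finite_measure set T2 -> \bar R})
    (D : set T2) (f : T1 * T2 -> R) : measurable D ->
  measurable_fun setT f ->
  measurable_fun setT (fun x => \int[m2]_(y in D) f (x, y)).
Proof.
move=> mD mf.
pose g (z : T1 * T2) : \bar R := ((f z) * \1_D z.2)%:E.
have mg : measurable_fun setT g.
  apply/measurable_EFinP; apply: measurable_funM => //.
  by apply: measurableT_comp => //; exact: measurable_indic.
have mp : measurable_fun setT (fun x => \int[m2]_y (g^\+%E (x, y)))%E.
  by apply: measurable_fun_fubini_tonelli_F => //; exact: measurable_funepos.
have mn : measurable_fun setT (fun x => \int[m2]_y (g^\-%E (x, y)))%E.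
  by apply: measurable_fun_fubini_tonelli_F => //; exact: measurable_funeneg.
rewrite (_ : (fun x => _) = (fun x => fine (\int[m2]_y (g^\+%E (x, y)) -
     \int[m2]_y (g^\-%E (x, y)))%E)).
  apply: (@measurableT_comp _ _ _ _ _ _ fine) => //.
  exact: emeasurable_funB.
apply/funext => x; rewrite Rintegral_mkcond /Rintegral; congr fine.
have -> : (fun y => (((fun y => f (x, y)) \_ D) y)%:E) = g \o (fun y => (x, y)).
  apply/funext => y; rewrite /g /= patchE indicE.
  by case: ifPn => _; rewrite ?mulr1 ?mulr0.
rewrite integralE; congr (_ - _)%E; apply: eq_integral => y _;
  by rewrite (funepos_comp, funeneg_comp).
Qed.

Lemma bounded_integrable d (T : measurableType d)
    (m : {measure set T -> \bar R}) (D : set T) (f : T -> R) (M : R) :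
  measurable D -> (m D < +oo)%E -> measurable_fun D f ->
  (forall x, D x -> `|f x| <= M) -> m.-integrable D (EFin \o f).
Proof.
move=> mD mDoo mf fM; apply: measurable_bounded_integrable => //.
by exists M; split; [exact: num_real|move=> t Mt x Dx /=;
  rewrite (le_trans (fM _ Dx))// ltW].
Qed.

Lemma integrable_indic_lty d (T : measurableType d)
    (m : {measure set T -> \bar R}) (D : set T) :
  measurable D -> (m D < +oo)%E -> m.-integrable setT (fun x => (\1_D x)%:E).
Proof.
move=> mD Doo; apply/integrableP; split.
  by apply/measurable_EFinP; exact: measurable_indic.
under eq_integral do rewrite gee0_abs ?lee_fin//.
by rewrite integral_indic// setIT.
Qed.

Lemma bounded_Rintegral d (T : measurableType d)
    (m : {measure set T -> \bar R}) (D : set T) (f : T -> R) (M : R) :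
  measurable D -> (m D < +oo)%E -> measurable_fun D f ->
  (forall x, D x -> `|f x| <= M) -> `|\int[m]_(x in D) f x| <= M * fine (m D).
Proof.
move=> mD mDoo mf fM.
apply: (le_trans (le_normr_Rintegral mD (bounded_integrable mD mDoo mf fM))).
have -> : M * fine (m D) = \int[m]_(x in D) (fun=> M) x by rewrite Rintegral_cst.
apply: le_Rintegral => //.
- apply: (bounded_integrable (M := M)) => //.
    by apply: measurableT_comp.
  by move=> x Dx; rewrite normr_id fM.
- exact: (bounded_integrable (M := `|M|)).
Qed.

(** Integrability of every section, and not just of almost every one, lets [fine] pass through the
    inner integrals pointwise. *)
Lemma Rfubini (m1 : {sigma_finite_measure set T1 -> \bar R})
    (m2 : {sigma_finite_measure set T2 -> \bar R})
    (f : T1 * T2 -> R) : measurable_fun setT f ->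
  (forall x, m2.-integrable setT (fun y => (f (x, y))%:E)) ->
  (forall y, m1.-integrable setT (fun x => (f (x, y))%:E)) ->
  (m1 \x m2)%E.-integrable setT (EFin \o f) ->
  \int[m1]_x \int[m2]_y f (x, y) = \int[m2]_y \int[m1]_x f (x, y).
Proof.
move=> mf fx fy intf.
have := @Fubini _ _ _ _ _ m1 m2 (EFin \o f) intf.
move=> /(congr1 fine) => E.
transitivity (fine (\int[m1]_x \int[m2]_y (f (x, y))%:E)).
  congr fine; apply: eq_integral => x _; rewrite fineK//.
  exact: (integrable_fin_num measurableT (fx x)).
rewrite {}E; congr fine; apply: eq_integral => y _; rewrite fineK//.
exact: (integrable_fin_num measurableT (fy y)).
Qed.

Lemma Rfubini_bounded (m1 : {sigma_finite_measure set T1 -> \bar R})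
    (m2 : {sigma_finite_measure set T2 -> \bar R})
    (D1 : set T1) (D2 : set T2) (f : T1 * T2 -> R) (M : R) :
  measurable D1 -> measurable D2 -> (m1 D1 < +oo)%E -> (m2 D2 < +oo)%E ->
  measurable_fun setT f ->
  (forall x y, D1 x -> D2 y -> `|f (x, y)| <= M) ->
  \int[m1]_(x in D1) \int[m2]_(y in D2) f (x, y) =
  \int[m2]_(y in D2) \int[m1]_(x in D1) f (x, y).
Proof.
move=> mD1 mD2 D1oo D2oo mf fM.
(* Cutting [f] off outside [D1] and [D2] leaves a function dominated by a multiple of the indicator
   of a set of finite measure. *)
pose g (z : T1 * T2) : R := \1_D1 z.1 * \1_D2 z.2 * f z.
have mg : measurable_fun setT g.
  apply: measurable_funM => //; apply: measurable_funM => //;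
    apply: measurableT_comp => //; exact: measurable_indic.
have gM z : `|g z| <= `|M| * (\1_D1 z.1 * \1_D2 z.2).
  case: z => x y; rewrite /g /= !indicE.
  case: (boolP (x \in D1)) => [/set_mem Dx|_]; last by rewrite !mul0r mulr0 normr0.
  case: (boolP (y \in D2)) => [/set_mem Dy|_]; last by rewrite mulr0 mul0r mulr0 normr0.
  by rewrite !mul1r mulr1 (le_trans (fM _ _ Dx Dy))// ler_norm.
have gx x : m2.-integrable setT (fun y => (g (x, y))%:E).
  apply: (@le_integrable _ _ _ _ _ measurableT _ (fun y => (`|M| * \1_D2 y)%:E)).
  - by apply/measurable_EFinP; exact: measurableT_comp.
  - move=> y _ /=; rewrite lee_fin (le_trans (gM _))//= [leRHS]ger0_norm ?mulr_ge0//.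
    by rewrite ler_wpM2l// indicE; case: (x \in D1); rewrite ?mul1r ?mul0r.
  - under eq_fun do rewrite EFinM; apply: integrableZl => //.
    exact: integrable_indic_lty.
have gy y : m1.-integrable setT (fun x => (g (x, y))%:E).
  apply: (@le_integrable _ _ _ _ _ measurableT _ (fun x => (`|M| * \1_D1 x)%:E)).
  - by apply/measurable_EFinP; exact: measurableT_comp.
  - move=> x _ /=; rewrite lee_fin (le_trans (gM _))//= [leRHS]ger0_norm ?mulr_ge0//.
    by rewrite ler_wpM2l// !indicE; case: (y \in D2); rewrite ?mulr1 ?mulr0.
  - under eq_fun do rewrite EFinM; apply: integrableZl => //.
    exact: integrable_indic_lty.
have := Rfubini mg gx gy _.
have E1 : \int[m1]_(x in D1) \int[m2]_(y in D2) f (x, y) =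
   \int[m1]_x \int[m2]_y g (x, y).
  rewrite Rintegral_mkcond; apply: eq_Rintegral => x _ /=.
  rewrite patchE; case: ifPn => [xD|/negbTE xD].
    rewrite Rintegral_mkcond; apply: eq_Rintegral => y _.
    rewrite patchE /g /= !indicE xD mul1r.
    by case: (y \in D2); rewrite ?mul1r ?mul0r.
  under eq_Rintegral do rewrite /g /= indicE xD !mul0r.
  by rewrite Rintegral_cst// mul0r.
have E2 : \int[m2]_(y in D2) \int[m1]_(x in D1) f (x, y) =
   \int[m2]_y \int[m1]_x g (x, y).
  rewrite Rintegral_mkcond; apply: eq_Rintegral => y _ /=.
  rewrite patchE; case: ifPn => [yD|/negbTE yD].
    rewrite Rintegral_mkcond; apply: eq_Rintegral => x _.
    rewrite patchE /g /= !indicE yD mulr1.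
    by case: (x \in D1); rewrite ?mul1r ?mul0r.
  under eq_Rintegral do rewrite /g /= !indicE yD mulr0 mul0r.
  by rewrite Rintegral_cst// mul0r.
rewrite E1 E2; apply.
apply: (@le_integrable _ _ _ (m1 \x m2)%E _ measurableT _ (fun z => (`|M| * \1_(D1 `*` D2) z)%:E)).
- exact/measurable_EFinP.
- move=> [x y] _; rewrite lee_fin (le_trans (gM _))// [leRHS]ger0_norm ?mulr_ge0//.
  by rewrite ler_wpM2l// !indicE in_setX/=; case: (x \in D1); rewrite ?mul1r ?mul0r.
- under eq_fun do rewrite EFinM; apply: integrableZl => //.
  apply: integrable_indic_lty; first exact: measurableX.
  have E : (m1 \x m2)%E (D1 `*` D2) = (m1 D1 * m2 D2)%E by exact: product_measure1E.
  apply: (@le_lt_trans _ _ (m1 D1 * m2 D2)%E); last first.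
    by rewrite lte_mul_pinfty// ge0_fin_numE.
  by rewrite -E.
Qed.

End fubini_bounded.

(** Writing the inverse as [x / x ^+ 2] leaves only a nonnegative base to invert, where [powR] and
    the inverse coincide; the convention [0^-1 = 0] agrees on both sides. *)
Lemma measurable_inv (R : realType) : measurable_fun setT (fun x : R => x^-1).
Proof.
rewrite (_ : (fun x => _) = (fun x : R => x * powR (x ^+ 2) (-1))).
  apply: measurable_funM => //.
  by apply: (measurableT_comp (measurable_powR _)); exact: measurable_funX.
apply/funext => x; rewrite powR_inv1 ?sqr_ge0//.
have [->|x0] := eqVneq x 0; first by rewrite mul0r invr0.
by field.
Qed.

Lemma integrable_scale d (T : measurableType d) (R : realType)
    (mu : {measure set T -> \bar R}) (D : set T) (f : T -> R) (k : R) :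
  measurable D -> mu.-integrable D (EFin \o f) ->
  mu.-integrable D (EFin \o (fun x => k * f x)).
Proof. by move=> mD /(integrableZl mD k). Qed.

Lemma integrable_sub d (T : measurableType d) (R : realType)
    (mu : {measure set T -> \bar R}) (D : set T) (f g : T -> R) :
  measurable D -> mu.-integrable D (EFin \o f) -> mu.-integrable D (EFin \o g) ->
  mu.-integrable D (EFin \o (fun x => f x - g x)).
Proof. by move=> mD fi gi; exact: (integrableB mD fi gi). Qed.

Lemma integrable_add d (T : measurableType d) (R : realType)
    (mu : {measure set T -> \bar R}) (D : set T) (f g : T -> R) :
  measurable D -> mu.-integrable D (EFin \o f) -> mu.-integrable D (EFin \o g) ->
  mu.-integrable D (EFin \o (fun x => f x + g x)).
Proof. by move=> mD fi gi; exact: (integrableD mD fi gi). Qed.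

Lemma is_derive_pow (R : realType) (f : R -> R) (x df : R) n :
  is_derive x 1 f df ->
  is_derive x 1 (fun y => f y ^+ n) (n%:R * f x ^+ n.-1 * df).
Proof.
move=> D; have := @is_deriveX R _ f n x 1 df D.
by rewrite (_ : f ^+ n = fun y => f y ^+ n)//; apply/funext => y; rewrite exprfctE.
Qed.

Section real_derivatives.
Context (R : realType).
Implicit Types (f g : R -> R) (x df dg : R).

Lemma is_derive_mul f g x df dg : is_derive x 1 f df -> is_derive x 1 g dg ->
  is_derive x 1 (fun y => f y * g y) (f x * dg + g x * df).
Proof. by move=> Df Dg; exact: (is_deriveM Df Dg). Qed.

Lemma is_derive_add f g x df dg : is_derive x 1 f df -> is_derive x 1 g dg ->
  is_derive x 1 (fun y => f y + g y) (df + dg).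
Proof. by move=> Df Dg; exact: (is_deriveD Df Dg). Qed.

Lemma is_derive_scale f x df k : is_derive x 1 f df ->
  is_derive x 1 (fun y => k * f y) (k * df).
Proof. by move=> Df; exact: (is_deriveZ k Df). Qed.

Lemma is_derive_inv f x df : f x != 0 -> is_derive x 1 f df ->
  is_derive x 1 (fun y => (f y)^-1) (- (f x) ^- 2 * df).
Proof. by move=> f0 Df; exact: (is_deriveV f0 Df). Qed.

Lemma is_derive_idr x : is_derive x (1 : R) (fun y : R => y) (1 : R).
Proof. exact: is_derive_id. Qed.

Lemma is_derive_const x k : is_derive x (1 : R) (fun _ : R => k) (0 : R).
Proof. exact: is_derive_cst. Qed.

End real_derivatives.

(** * Lebesgue measure on C^n *)

Section lebesgueC_affine.
Context (R : realType).
Local Notation leb := (@lebesgue_measure R).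
Local Notation leb2 := (@lebesgue2 R).

Lemma integral_lebesgue2 (f : plane R -> \bar R) : measurable_fun setT f ->
  (forall z, 0 <= f z)%E -> (\int[leb2]_z f z = \int[leb]_x \int[leb]_y f (x, y))%E.
Proof. by move=> mf f0; rewrite fubini_tonelli1. Qed.

Lemma integral_lebesgue2_swap (f : plane R -> \bar R) : measurable_fun setT f ->
  (forall z, 0 <= f z)%E -> (\int[leb2]_z f z = \int[leb]_y \int[leb]_x f (x, y))%E.
Proof. by move=> mf f0; rewrite fubini_tonelli2. Qed.

Lemma integral_lebesgueC0 (f : 0.-tuple (plane R) -> \bar R) :
  measurable_fun setT f -> (forall z, 0 <= f z)%E ->
  (\int[lebesgueC R 0]_t f t = f [tuple])%E.
Proof. by move=> mf f0; rewrite /= integral_dirac//= diracT mul1e. Qed.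

Lemma integral_lebesgueCS n (f : n.+1.-tuple (plane R) -> \bar R) :
  measurable_fun setT f -> (forall z, 0 <= f z)%E ->
  (\int[lebesgueC R n.+1]_t f t =
   \int[leb2]_z \int[lebesgueC R n]_t f (tcons (z, t)))%E.
Proof.
move=> mf f0 /=.
rewrite (ge0_integral_pushforward (measurable_funPT (@tcons R n)))//.
rewrite preimage_setT fubini_tonelli1//; first exact: measurableT_comp.
by move=> z; exact: f0.
Qed.

Lemma ge0_integral_leb2_affine (r : R) (v : plane R) (f : plane R -> \bar R) :
  0 < r -> measurable_fun setT f -> (forall z, 0 <= f z)%E ->
  (\int[leb2]_z f z =
   (r ^+ 2)%:E * \int[leb2]_z f (r * z.1 + v.1, r * z.2 + v.2)%R)%E.
Proof.
move=> r0 mf f0.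
have rn : r != 0 by rewrite gt_eqF.
have maff : measurable_fun setT (fun z : plane R => (r * z.1 + v.1, r * z.2 + v.2) : plane R).
  by apply: measurable_fun_pair; apply: measurable_funD => //; apply: measurable_funM.
rewrite [RHS](_ : _ = (r ^+ 2)%:E * \int[leb]_x \int[leb]_y f (affine r v.1 x, affine r v.2 y))%E; last first.
  congr (_ * _)%E; apply: (integral_lebesgue2 (f := fun z => f (r * z.1 + v.1, r * z.2 + v.2))) => //.
  exact: (measurableT_comp mf maff).
rewrite integral_lebesgue2//.
rewrite (ge0_integral_affine v.1 rn); last 2 first.
- by apply: (measurable_fun_fubini_tonelli_F (m2 := leb) f).
- by move=> x; exact: integral_ge0.
rewrite expr2 EFinM (gtr0_norm r0) -muleA; congr (_ * _)%E.
rewrite -ge0_integralZl//; last 3 first.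
- apply: (measurableT_comp (f := fun x => (\int[leb]_y f (x, affine r v.2 y))%E)) => //.
  apply: (measurable_fun_fubini_tonelli_F (m2 := leb) (fun z => f (z.1, affine r v.2 z.2))) => //.
  apply: (measurableT_comp mf); apply: measurable_fun_pair => //.
  exact: measurableT_comp.
- by move=> x _; exact: integral_ge0.
- by rewrite lee_fin ltW.
apply: eq_integral => x _.
rewrite (ge0_integral_affine v.2 rn) ?gtr0_norm//.
exact: measurableT_comp.
Qed.

(** One map serves two purposes: [v = 0] gives the dilations of the polar coordinates, [r = 1] the
    translations used for null sets. *)
Definition affineC n (r : R) (v t : n.-tuple (plane R)) : n.-tuple (plane R) :=
  [tuple (r * (tnth t i).1 + (tnth v i).1, r * (tnth t i).2 + (tnth v i).2) | i < n].

Lemma measurable_affineC n r (v : n.-tuple (plane R)) :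
  measurable_fun setT (affineC r v).
Proof.
apply/measurable_fun_tnthP => i.
rewrite (_ : _ \o _ = fun t => (r * (tnth t i).1 + (tnth v i).1, r * (tnth t i).2 + (tnth v i).2)); last first.
  by apply/funext => t /=; rewrite tnth_mktuple.
apply: measurable_fun_pair; apply: measurable_funD => //; apply: measurable_funM => //;
  apply: measurableT_comp => //; exact: measurable_tnth.
Qed.

Lemma affineC_tcons n (r : R) (v : n.+1.-tuple (plane R)) z t :
  affineC r v (tcons (z, t)) =
  tcons ((r * z.1 + (thead v).1, r * z.2 + (thead v).2), affineC r [tuple of behead v] t).
Proof.
apply: eq_from_tnth => i; rewrite tnth_mktuple.
case: (unliftP ord0 i) => [j|] ->; rewrite /tcons /=.
- rewrite !tnthS tnth_mktuple; rewrite tnth_behead.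
  by rewrite (_ : inord j.+1 = lift ord0 j)//; apply/val_inj; rewrite /= inordK// ltnS.
- by rewrite !tnth0.
Qed.

Lemma ge0_integral_affineC n (r : R) (v : n.-tuple (plane R)) (f : n.-tuple (plane R) -> \bar R) :
  0 < r -> measurable_fun setT f -> (forall z, 0 <= f z)%E ->
  (\int[lebesgueC R n]_t f t =
   (r ^+ (2 * n)%N)%:E * \int[lebesgueC R n]_t f (affineC r v t))%E.
Proof.
move=> r0; elim: n v f => [|n IH] v f mf f0.
  rewrite muln0 expr0 mul1e !integral_lebesgueC0//.
    by congr f; apply: eq_from_tnth => -[].
  by apply: (measurableT_comp mf); exact: measurable_affineC.
have mfa : measurable_fun setT (fun t => f (affineC r v t)).
  by apply: (measurableT_comp mf); exact: measurable_affineC.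
have mft : measurable_fun setT (fun z : plane R * n.-tuple (plane R) => f (tcons z)).
  by apply: (measurableT_comp mf).
have mfn (g : n.+1.-tuple (plane R) -> \bar R) : measurable_fun setT g -> (forall z, 0 <= g z)%E ->
    measurable_fun setT (fun z => \int[lebesgueC R n]_t g (tcons (z, t)))%E.
  move=> mg g0; apply: (measurable_fun_fubini_tonelli_F (m2 := lebesgueC R n) (fun z => g (tcons z))) => //.
  exact: (measurableT_comp mg).
rewrite !integral_lebesgueCS//.
rewrite (ge0_integral_leb2_affine (thead v) r0); last 2 first.
- exact: mfn.
- by move=> z; exact: integral_ge0.
rewrite mulnS exprD (EFinM (r ^+ 2)) -muleA; congr (_ * _)%E.
rewrite -ge0_integralZl//; last 3 first.
- exact: (mfn (fun t => f (affineC r v t))).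
- by move=> z _; exact: integral_ge0.
- by rewrite lee_fin exprn_ge0// ltW.
apply: eq_integral => z _.
rewrite (IH [tuple of behead v])//; last first.
  apply: (measurableT_comp mf); apply: measurableT_comp => //.
by congr (_ * _)%E; apply: eq_integral => t _; rewrite affineC_tcons.
Qed.

End lebesgueC_affine.

(** * Gaussian integrals of Hermitian forms *)

Section hermitian_form.
Context (R : realType).
Local Notation C := R[i].
Local Open Scope sesquilinear_scope.

Lemma conjCE (z : C) : z^* = complex.Complex (complex.Re z) (- complex.Im z).
Proof. by case: z. Qed.

Lemma complex_ext (z w : C) :
  complex.Re z = complex.Re w -> complex.Im z = complex.Im w -> z = w.
Proof. by case: z w => [? ?] [? ?] /= -> ->. Qed.

Lemma inner_conj n (P : 'M[C]_n) (x y : 'cV[C]_n) :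
  (inner (P *m x) y)^* = inner (P ^t* *m y) x.
Proof.
have E (M : 'M[C]_1) : (M 0 0)^* = (M ^t*) 0 0 by rewrite !mxE.
by rewrite /inner E !trmx_mul !map_mxM /= trmxCK mulmxA.
Qed.

Lemma cvec_tcons n (z : plane R) (t : n.-tuple (plane R)) :
  cvec (tcons (z, t)) =
  col_mx (complex.Complex z.1 z.2)%:M (cvec t) :> 'cV[C]_(1 + n).
Proof.
apply/matrixP => i j; rewrite !mxE; case: splitP => k /= ik.
  by rewrite (_ : i = ord0) ?mxE ?ord1 ?eqxx ?tnth0 ?mulr1n//; apply/val_inj; rewrite /= ik ord1.
rewrite mxE (_ : i = lift ord0 k) ?tnthS//.
by apply/val_inj; rewrite /= ik.
Qed.

Lemma inner_block n (P : 'M[C]_(1 + n)) (u : C) (y : 'cV[C]_n) :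
  inner (P *m col_mx u%:M y) (col_mx u%:M y) =
  u^* * P 0 0 * u + u^* * (ursubmx P *m y) 0 0 +
  (y ^t* *m dlsubmx P) 0 0 * u + inner (drsubmx P *m y) y.
Proof.
rewrite /inner -{1}[P]submxK mul_block_col tr_col_mx map_row_mx mul_row_col.
rewrite !mulmxDr tr_scalar_mx map_scalar_mx !mul_scalar_mx !mul_mx_scalar -!scalemxAr !mxE.
rewrite (_ : lshift n 0 = 0); last exact/val_inj.
rewrite -!addrA; congr (_ + (_ + (_ + _))); first by rewrite (mulrC u) mulrA.
by rewrite mulrC.
Qed.

(** Completing the square in the first coordinate leaves this matrix as the form in the remaining
    ones, and [det_schur] shows that it also carries the rest of the determinant. *)
Definition schur n (P : 'M[C]_(1 + n)) : 'M[C]_n :=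
  drsubmx P - (P 0 0)^-1 *: (dlsubmx P *m ursubmx P).

Lemma det_schur n (P : 'M[C]_(1 + n)) : P 0 0 != 0 ->
  \det P = P 0 0 * \det (schur P).
Proof.
move=> P0.
(* Block Gaussian elimination with pivot [P 0 0]. *)
have E : P = block_mx 1%:M 0 ((P 0 0)^-1 *: dlsubmx P) 1%:M *m
    block_mx (ulsubmx P) (ursubmx P) 0 (schur P).
  rewrite mulmx_block !mul0mx !mulmx0 !mul1mx !addr0 -[LHS]submxK; congr block_mx.
    rewrite -scalemxAl; apply/matrixP => i j; rewrite !mxE big_ord1 !mxE !ord1.
    rewrite (_ : lshift n 0 = 0); last exact/val_inj.
    by rewrite mulrCA mulVf// mulr1.
  by rewrite /schur -scalemxAl addrC subrK.
rewrite [in LHS]E det_mulmx det_lblock det_ublock !det1 !mul1r.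
congr (_ * _); rewrite det_mx11 !mxE.
by rewrite (_ : lshift n 0 = 0)//; exact/val_inj.
Qed.

Definition posdef n (P : 'M[C]_n) :=
  P ^t* = P /\ forall x : 'cV[C]_n, x != 0 -> 0 < complex.Re (inner (P *m x) x).

Definition hform n (P : 'M[C]_n) (t : n.-tuple (plane R)) : R :=
  complex.Re (inner (P *m cvec t) (cvec t)).

Lemma posdef00 n (P : 'M[C]_(1 + n)) : posdef P ->
  exists2 a : R, 0 < a & P 0 0 = a%:C%C.
Proof.
move=> [Ph Pp].
have P00 : P 0 0 = complex.Complex (complex.Re (P 0 0)) 0.
  have : (P ^t*) 0 0 = P 0 0 by rewrite Ph.
  rewrite !mxE; case: (P 0 0) => a b /= [] E; congr complex.Complex; lra.
exists (complex.Re (P 0 0)) => //.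
have := Pp (col_mx 1%:M 0) _; rewrite inner_block !mulmx0 conjC1 mul1r mulr1 /=.
rewrite /inner !mulmx0 trmx0 map_mx0 mul0mx (_ : (0 : 'M[C]_1) 0 0 = 0) ?mxE//.
rewrite mulr0 mul0r !addr0; apply.
apply/eqP => /matrixP /(_ 0 0); rewrite !mxE; case: splitP => // k _.
rewrite !mxE ord1 eqxx => /eqP; by rewrite oner_eq0.
Qed.

Lemma posdef_ur n (P : 'M[C]_(1 + n)) (y : 'cV_n) : P ^t* = P ->
  (y ^t* *m dlsubmx P) 0 0 = ((ursubmx P *m y) 0 0)^*.
Proof.
move=> Ph.
have E (M : 'M[C]_1) : (M 0 0)^* = (M ^t*) 0 0 by rewrite !mxE.
rewrite E.
by rewrite trmx_mul map_mxM trmx_ursub map_dlsubmx Ph.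
Qed.

(** All terms containing [u] combine into [a |u + w / a|^2]; the leftover [- |w|^2 / a] is what
    distinguishes [schur P] from the lower right block. *)
Lemma inner_schur n (P : 'M[C]_(1 + n)) (a : R) (u : C) (y : 'cV[C]_n) :
  P ^t* = P -> P 0 0 = a%:C%C -> 0 < a ->
  let w := (ursubmx P *m y) 0 0 in
  complex.Re (inner (P *m col_mx u%:M y) (col_mx u%:M y)) =
  a * ((complex.Re u + a^-1 * complex.Re w) ^+ 2 +
       (complex.Im u + a^-1 * complex.Im w) ^+ 2) +
  complex.Re (inner (schur P *m y) y).
Proof.
move=> Ph Pa a0 w; rewrite inner_block posdef_ur// -/w Pa.
have -> : inner (schur P *m y) y = inner (drsubmx P *m y) y - (a^-1)%:C%C * (w^* * w).
  rewrite /inner /schur mulmxBl mulmxBr [LHS]mxE [X in _ + X]mxE; congr (_ - _).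
  rewrite -scalemxAl -scalemxAr mxE Pa.
  have -> : y ^t* *m (dlsubmx P *m ursubmx P *m y) =
    (y ^t* *m dlsubmx P) *m (ursubmx P *m y) by rewrite !mulmxA.
  rewrite [X in _ * X = _]mxE big_ord1 posdef_ur//.
  by rewrite -/w fmorphV.
rewrite !conjCE; case: u w (inner _ _) => [u1 u2] [w1 w2] [q1 q2] /=.
by field; rewrite gt_eqF.
Qed.

Lemma posdef_schur n (P : 'M[C]_(1 + n)) : posdef P -> posdef (schur P).
Proof.
move=> [Ph Pp]; have [a a0 Pa] := posdef00 (conj Ph Pp).
split.
  rewrite /schur Pa raddfB /= map_mxB linearZ /= map_mxZ trmx_mul map_mxM.
  rewrite trmx_drsub map_drsubmx Ph trmx_dlsub map_ursubmx Ph trmx_ursub map_dlsubmx Ph.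
  congr (_ - _ *: _); rewrite fmorphV; congr (_^-1).
  by apply: complex_ext; rewrite /= ?oppr0.
move=> y y0; set w := (ursubmx P *m y) 0 0.
(* This first coordinate annihilates the square in [inner_schur], so the form of [P] takes there the
   value of the form of [schur P] at [y]. *)
have := Pp (col_mx (- (a^-1)%:C%C * w)%:M y) _.
rewrite (inner_schur _ _ Ph Pa a0) -/w /=.
have -> : forall q : R, a * ((complex.Re (- (a^-1)%:C%C * w) + a^-1 * complex.Re w) ^+ 2 +
    (complex.Im (- (a^-1)%:C%C * w) + a^-1 * complex.Im w) ^+ 2) + q = q.
  by move=> q; case: w => w1 w2 /=; ring.
apply; apply: contra y0 => /eqP /(congr1 (@dsubmx _ _ _ _)).
by rewrite col_mxKd raddf0 => ->.
Qed.

(** The substitution [z |-> r z - w] with [r ^+ 2 = a^-1] turns the integrand into a product of two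
    standard Gaussians, each of integral [Num.sqrt pi]. *)
Lemma gauss_plane (a : R) (w : plane R) : 0 < a ->
  (\int[@lebesgue2 R]_z (expR (- (a * ((z.1 + w.1) ^+ 2 + (z.2 + w.2) ^+ 2))))%:E =
   (pi / a)%:E)%E.
Proof.
move=> a0; pose r := (Num.sqrt a)^-1.
have r0 : 0 < r by rewrite invr_gt0 sqrtr_gt0.
have r2 : r ^+ 2 = a^-1 by rewrite exprVn sqr_sqrtr// ltW.
have mg (b : R) (c : plane R) : measurable_fun setT (fun z : plane R =>
    expR (- (b * ((z.1 + c.1) ^+ 2 + (z.2 + c.2) ^+ 2)))).
  apply: measurableT_comp => //; apply: measurable_funN; apply: measurable_funM => //.
  by apply: measurable_funD; apply: measurable_funX; apply: measurable_funD.
rewrite (ge0_integral_leb2_affine (- w.1, - w.2) r0); last 2 first.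
- by apply/measurable_EFinP; exact: mg.
- by move=> z; rewrite lee_fin expR_ge0.
transitivity ((r ^+ 2)%:E * \int[@lebesgue2 R]_z (gauss_fun z.1 * gauss_fun z.2)%:E)%E.
  congr (_ * _)%E; apply: eq_integral => z _; congr EFin.
  rewrite /= !subrK /gauss_fun -expRD; congr expR.
  by rewrite !exprMn r2 -mulrDr mulrA divff ?gt_eqF// mul1r opprD.
rewrite integral_lebesgue2; last 2 first.
- apply/measurable_EFinP; apply: measurable_funM;
    apply: measurableT_comp => //; exact: measurable_gauss_fun.
- by move=> z; rewrite lee_fin mulr_ge0// gauss_fun_ge0.
under eq_integral => x _.
  under eq_integral do rewrite /= EFinM.
  rewrite ge0_integralZl//=; last 3 first.
  - by apply/measurable_EFinP; exact: measurable_gauss_fun.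
  - by move=> y _; rewrite lee_fin gauss_fun_ge0.
  - by rewrite lee_fin gauss_fun_ge0.
  rewrite integralT_gauss; over.
rewrite ge0_integralZr//=; last 2 first.
- by apply/measurable_EFinP; exact: measurable_gauss_fun.
- by move=> y _; rewrite lee_fin gauss_fun_ge0.
by rewrite integralT_gauss -!EFinM -expr2 sqr_sqrtr ?pi_ge0// r2 mulrC.
Qed.

Lemma measurable_hform n (P : 'M[C]_n) : measurable_fun setT (hform P).
Proof.
have := measurable_funPT (quadratic_form P).
by move=> /(measurableT_comp (@measurable_fst _ _ _ _)).
Qed.

(** Induction on [n]. With the other coordinates fixed, the integral over the first one is a shifted
    planar Gaussian, worth [pi / a] whatever the shift; the Schur complement takes over, and the
    pivots [a] multiply up to the determinant. *)
Lemma gauss_hform n (P : 'M[C]_n) : posdef P ->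
  exists2 d : R, 0 < d & \det P = d%:C%C /\
  (\int[lebesgueC R n]_t (expR (- hform P t))%:E = (pi ^+ n / d)%:E)%E.
Proof.
elim: n P => [|n IH] P Pp.
  exists 1 => //; split; first by rewrite det_mx00.
  rewrite integral_lebesgueC0//; last first.
    apply/measurable_EFinP; apply: measurableT_comp => //; apply: measurable_funN.
    exact: measurable_hform.
  by rewrite /hform /inner mxE big_ord0 /= oppr0 expR0 divr1 expr0.
have Ph := Pp.1; have [a a0 Pa] := posdef00 Pp.
have [d d0 [dE dI]] := IH _ (posdef_schur Pp).
exists (a * d); first exact: mulr_gt0.
split.
  by rewrite det_schur ?Pa ?dE ?rmorphM// (_ : 0 = 0%:C%C)// (inj_eq (@complexI _)) gt_eqF.
pose w (t : n.-tuple (plane R)) : plane R :=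
  (a^-1 * complex.Re ((ursubmx (P : 'M[C]_(1 + n)) *m cvec t) 0 0),
   a^-1 * complex.Im ((ursubmx (P : 'M[C]_(1 + n)) *m cvec t) 0 0)).
have hE z t : hform P (tcons (z, t)) =
    a * ((z.1 + (w t).1) ^+ 2 + (z.2 + (w t).2) ^+ 2) + hform (schur P) t.
  by rewrite /hform cvec_tcons (inner_schur _ _ Ph Pa a0).
have me : measurable_fun setT (fun t => (expR (- hform P t))%:E).
  apply/measurable_EFinP; apply: measurableT_comp => //; apply: measurable_funN.
  exact: measurable_hform.
have e0 z : (0 <= (expR (- hform P z))%:E)%E by rewrite lee_fin expR_ge0.
rewrite integral_lebesgueCS//.
have -> := @fubini_tonelli _ _ _ _ _ (@lebesgue2 R) (lebesgueC R n)
  (fun z => (expR (- hform P (tcons z)))%:E) (measurableT_comp me (measurable_funPT (@tcons R n)))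
  (fun z => e0 _).
transitivity (\int[lebesgueC R n]_t ((pi / a)%:E * (expR (- hform (schur P) t))%:E))%E.
  apply: eq_integral => t _; rewrite -(gauss_plane (w t) a0) -ge0_integralZr; first last.
  - by rewrite lee_fin expR_ge0.
  - by move=> z _; rewrite lee_fin expR_ge0.
  - apply/measurable_EFinP; apply: measurableT_comp => //; apply: measurable_funN.
    apply: measurable_funM => //.
    by apply: measurable_funD; apply: measurable_funX; apply: measurable_funD.
  - exact: measurableT.
  by apply: eq_integral => z _; rewrite hE opprD expRD EFinM.
rewrite ge0_integralZl; first last.
- by rewrite lee_fin divr_ge0 ?pi_ge0// ltW.
- by move=> z _; rewrite lee_fin expR_ge0.
- apply/measurable_EFinP; apply: measurableT_comp => //; apply: measurable_funN.
  exact: measurable_hform.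
- exact: measurableT.
rewrite dI -EFinM exprS; congr EFin; field.
by rewrite !gt_eqF.
Qed.

End hermitian_form.

(** * The law of a Hermitian form on the sphere *)

Section polar.
Context (R : realType) (n : nat).
Local Notation C := R[i].
Local Notation leb := (@lebesgue_measure R).
Local Notation vec := (n.-tuple (plane R)).
Local Open Scope sesquilinear_scope.

Definition sqnorm (t : vec) : R := hform (1%:M : 'M[C]_n) t.

Definition dilate (r : R) : vec -> vec := affineC r (nseq_tuple n (0, 0)).

Lemma cvec_dilate r t : cvec (dilate r t) = r%:C%C *: cvec t.
Proof.
apply/matrixP => i j; rewrite !mxE tnth_mktuple tnth_nseq /= !addr0.
by apply: complex_ext => /=; rewrite mul0r ?subr0 ?addr0.
Qed.

Lemma tnth_dilate r t i :
  tnth (dilate r t) i = (r * (tnth t i).1, r * (tnth t i).2).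
Proof. by rewrite tnth_mktuple tnth_nseq /= !addr0. Qed.

Lemma hform_dilate (P : 'M[C]_n) r t : hform P (dilate r t) = r ^+ 2 * hform P t.
Proof.
have E : (r%:C%C *: cvec t) ^t* = r%:C%C *: (cvec t) ^t*.
  apply/matrixP => i j; rewrite !mxE rmorphM; congr (_ * _).
  by apply: complex_ext; rewrite /= ?oppr0.
rewrite /hform /inner cvec_dilate E -scalemxAl -!scalemxAr [in LHS]mxE [X in _ * X]mxE.
by case: (((cvec t) ^t* *m _) 0 0) => a b /=; ring.
Qed.

Lemma sqnormE t : sqnorm t = \sum_i ((tnth t i).1 ^+ 2 + (tnth t i).2 ^+ 2).
Proof.
rewrite /sqnorm /hform mul1mx /inner mxE raddf_sum; apply: eq_bigr => i _.
by rewrite !mxE /=; ring.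
Qed.

Lemma sqnorm_ge0 t : 0 <= sqnorm t.
Proof. by rewrite sqnormE sumr_ge0// => i _; rewrite addr_ge0 ?sqr_ge0. Qed.

Lemma norm2_cvec t : norm2 (cvec t) = Num.sqrt (sqnorm t).
Proof. by rewrite /sqnorm /hform mul1mx. Qed.

Lemma unit_ballE t : unit_ball t <-> sqnorm t <= 1.
Proof.
rewrite /unit_ball /= norm2_cvec -[X in _ <= X]sqrtr1 ler_sqrt//.
Qed.

Lemma measurable_dilate r : measurable_fun setT (dilate r).
Proof. exact: measurable_affineC. Qed.

(** The dilation is parametrized by the square of its factor because [r] will be compared with
    [sqnorm]; the Jacobian in real dimension [2 n] is then [r ^+ n]. *)
Lemma ge0_integral_dilate (r : R) (f : vec -> \bar R) :
  0 < r -> measurable_fun setT f -> (forall z, 0 <= f z)%E ->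
  (\int[lebesgueC R n]_t f t =
   (r ^+ n)%:E * \int[lebesgueC R n]_t f (dilate (Num.sqrt r) t))%E.
Proof.
move=> r0 mf f0; rewrite (@ge0_integral_affineC _ _ (Num.sqrt r) (nseq_tuple n (0, 0)))//.
  by rewrite exprM sqr_sqrtr// ltW.
by rewrite sqrtr_gt0.
Qed.

(** Layer-cake form of the exponential: it trades the exponential for an integral over the levels
    [r >= N], to be exchanged with the integral over C^n. It is the total mass of an exponential law
    shifted by [N]. *)
Lemma exp_tail (c N : R) : 0 < c -> 0 <= N ->
  (\int[leb]_r (if (0 < r) && (N <= r) then c * expR (- (c * r)) else 0)%:E
   = (expR (- (N * c)))%:E)%E.
Proof.
move=> c0 N0.
pose h r := (if N <= r then c * expR (- (c * r)) else 0)%:E : \bar R.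
have mh : measurable_fun setT h.
  apply/measurable_EFinP; apply: measurable_fun_ifT => //.
    exact: measurable_fun_ler.
  apply: measurable_funM => //; apply: measurableT_comp => //.
  by apply: measurable_funN; exact: measurable_funM.
transitivity (\int[leb]_(r in `]0%R, +oo[) h r)%E.
  rewrite [RHS]integral_mkcond; apply: eq_integral => r _.
  by rewrite patchE mem_setE in_itv/= andbT /h; case: (0 < r).
rewrite integral_itv_obnd_cbnd; last exact: measurable_funTS.
have -> : (\int[leb]_(r in `[0%R, +oo[) h r = \int[leb]_r ((expR (- (N * c)))%:E * (exponential_pdf c (r - N))%:E))%E.
  rewrite [LHS]integral_mkcond; apply: eq_integral => r _.
  rewrite patchE mem_setE in_itv/= andbT /h /exponential_pdf patchE mem_setE in_itv/= andbT.
  rewrite subr_ge0; case: (leP N r) => Nr.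
    rewrite (le_trans N0 Nr) -EFinM mulrCA -expRD; congr (_ * expR _)%:E.
    ring.
  by rewrite (_ : (point : R) = 0)// mule0; case: (0 <= r).
have mp : measurable_fun setT (fun r => (exponential_pdf c r)%:E).
  by apply/measurable_EFinP; exact: measurable_exponential_pdf.
rewrite ge0_integralZl; first last.
- by rewrite lee_fin expR_ge0.
- by move=> z _; rewrite lee_fin exponential_pdf_ge0// ltW.
- apply/measurable_EFinP; apply: (measurableT_comp (measurable_exponential_pdf c)).
  exact: measurable_funB.
- exact: measurableT.
rewrite -[X in (_ * X)%E](_ : (\int[leb]_r (exponential_pdf c r)%:E = _)%E).
  by rewrite integral_exponential_pdf// mule1.
rewrite (@ge0_integral_affine _ 1 (- N)) ?oner_eq0// ?normr1 ?mul1e.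
  by apply: eq_integral => r _; rewrite /affine mul1r.
by move=> r; rewrite lee_fin exponential_pdf_ge0// ltW.
Qed.

(** A Gamma integral, equal to [n! / x ^+ n]. The constant is never computed this way: [ball_volume]
    expresses it through the volume of the ball. *)
Definition gamma_int (x : R) : \bar R :=
  (\int[leb]_r (if 0 < r then r ^+ n * (x * expR (- (x * r))) else 0)%:E)%E.

(** Polar coordinates without a surface measure. By [exp_tail] and Tonelli one integrates, for each
    [r], over the ball [sqnorm t <= r]; dilating it to the unit ball produces [r ^+ n] and does not
    affect [c], which is homogeneous of degree 0. *)
Lemma polar_integral (c : vec -> R) : measurable_fun setT c ->
  (forall t, 0 < c t) -> (forall r t, 0 < r -> c (dilate r t) = c t) ->
  (\int[lebesgueC R n]_t (expR (- (sqnorm t * c t)))%:E =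
   \int[lebesgueC R n]_(t in @unit_ball R n) gamma_int (c t))%E.
Proof.
move=> mc c0 cd.
pose k (z : vec * measurableTypeR R) : \bar R :=
  (if (0 < z.2) && (sqnorm z.1 <= z.2) then c z.1 * expR (- (c z.1 * z.2)) else 0)%:E.
pose k1 (z : vec * measurableTypeR R) : \bar R :=
  (if (0 < z.2) && (sqnorm z.1 <= 1) then
   z.2 ^+ n * (c z.1 * expR (- (c z.1 * z.2))) else 0)%:E.
have mc1 : measurable_fun setT (fun z : vec * measurableTypeR R => c z.1).
  exact: measurableT_comp.
have mN : measurable_fun setT (fun z : vec * measurableTypeR R => sqnorm z.1).
  by apply: measurableT_comp => //; exact: measurable_hform.
have me : measurable_fun setT (fun z : vec * measurableTypeR R =>
    c z.1 * expR (- (c z.1 * z.2))).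
  apply: measurable_funM => //; apply: measurableT_comp => //.
  by apply: measurable_funN; exact: measurable_funM.
have mk : measurable_fun setT k.
  apply/measurable_EFinP; apply: measurable_fun_ifT => //.
  by apply: measurable_and; [exact: measurable_fun_ltr|exact: measurable_fun_ler].
have mk1 : measurable_fun setT k1.
  apply/measurable_EFinP; apply: measurable_fun_ifT => //.
    by apply: measurable_and; [exact: measurable_fun_ltr|exact: measurable_fun_ler].
  by apply: measurable_funM => //; exact: measurable_funX.
have e0 t r : 0 <= c t * expR (- (c t * r)) by rewrite mulr_ge0 ?expR_ge0// ltW.
have k0 z : (0 <= k z)%E by rewrite lee_fin; case: ifP.
have k10 z : (0 <= k1 z)%E.
  by rewrite lee_fin; case: ifP => // /andP[z0 _]; rewrite mulr_ge0// exprn_ge0// ltW.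
transitivity (\int[lebesgueC R n]_t \int[leb]_r k (t, r))%E.
  by apply: eq_integral => t _; rewrite -(exp_tail (c0 t) (sqnorm_ge0 t)).
rewrite (@fubini_tonelli _ _ _ _ _ (lebesgueC R n) leb k mk k0).
transitivity (\int[leb]_r \int[lebesgueC R n]_t k1 (t, r))%E.
  apply: eq_integral => r _; rewrite /k /k1 /=; have [r0|r0] := ltP 0 r; last by [].
  rewrite [LHS](ge0_integral_dilate r0); first last.
  - by move=> t; have := k0 (t, r); rewrite /k /= r0.
  - have := measurableT_comp mk (measurable_fun_pair (@measurable_id _ _ setT) (measurable_cst (r : measurableTypeR R))).
    by rewrite /k /comp/= r0.
  rewrite -ge0_integralZl; first last.
  - by rewrite lee_fin exprn_ge0// ltW.
  - by move=> t _; have := k0 (dilate (Num.sqrt r) t, r); rewrite /k /= r0.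
  - have := measurableT_comp mk (measurable_fun_pair (measurable_dilate (Num.sqrt r)) (measurable_cst (r : measurableTypeR R))).
    by rewrite /k /comp/= r0.
  - exact: measurableT.
  apply: eq_integral => t _ /=.
  rewrite cd ?sqrtr_gt0// /sqnorm hform_dilate sqr_sqrtr ?(ltW r0)//.
  have -> : (r * hform (1%:M : 'M[C]_n) t <= r) = (hform (1%:M : 'M[C]_n) t <= 1).
    by rewrite -[X in _ <= X]mulr1 ler_pM2l.
  by case: ifP => _; rewrite -EFinM ?mulr0.
rewrite -(@fubini_tonelli _ _ _ _ _ (lebesgueC R n) leb k1 mk1 k10) [RHS]integral_mkcond.
apply: eq_integral => t _; rewrite patchE; case: ifPn => [/set_mem/unit_ballE tb|].
  by apply: eq_integral => r _; rewrite /k1/= tb andbT.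
move=> /negP tb; rewrite /k1/= (_ : sqnorm t <= 1 = false); last first.
  by apply/negP => /unit_ballE tb'; apply: tb; exact/mem_set.
under eq_integral do rewrite andbF.
by rewrite integral0.
Qed.

Lemma hform_le (P : 'M[C]_n) : exists2 K : R, 0 <= K &
  forall t : vec, `|hform P t| <= K * sqnorm t.
Proof.
exists (\sum_i \sum_j (`|complex.Re (P i j)| + `|complex.Im (P i j)|)).
  by apply: sumr_ge0 => i _; apply: sumr_ge0 => j _; rewrite addr_ge0.
move=> t.
have -> : hform P t = \sum_i \sum_j
   (complex.Re (P i j) * ((tnth t i).1 * (tnth t j).1 + (tnth t i).2 * (tnth t j).2) -
    complex.Im (P i j) * ((tnth t i).1 * (tnth t j).2 - (tnth t i).2 * (tnth t j).1)).
  rewrite /hform /inner mxE raddf_sum; apply: eq_bigr => i _.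
  rewrite !mxE mulr_sumr raddf_sum; apply: eq_bigr => j _.
  by rewrite !mxE; case: (P i j) => p q /=; ring.
rewrite mulr_suml (le_trans (ler_norm_sum _ _ _))//; apply: ler_sum => i _.
rewrite mulr_suml (le_trans (ler_norm_sum _ _ _))//; apply: ler_sum => j _.
have N k : (tnth t k).1 ^+ 2 + (tnth t k).2 ^+ 2 <= sqnorm t.
  rewrite sqnormE (bigD1 k)//= lerDl sumr_ge0// => l _.
  by rewrite addr_ge0 ?sqr_ge0.
have := N i; have := N j; move: (sqnorm t) (tnth t i) (tnth t j) => S [a1 a2] [b1 b2] /= Hb Ha.
(* This and the next bound expand sums of two squares such as
   [(a1 + b1) ^+ 2 + (a2 + b2) ^+ 2 >= 0], the squared moduli of both points being at most [S]. *)
have H1 : `|a1 * b1 + a2 * b2| <= S.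
  rewrite ler_norml; apply/andP; split.
    by have := sqr_ge0 (a1 + b1); have := sqr_ge0 (a2 + b2); nra.
  by have := sqr_ge0 (a1 - b1); have := sqr_ge0 (a2 - b2); nra.
have H2 : `|a1 * b2 - a2 * b1| <= S.
  rewrite ler_norml; apply/andP; split.
    by have := sqr_ge0 (a1 + b2); have := sqr_ge0 (a2 - b1); nra.
  by have := sqr_ge0 (a1 - b2); have := sqr_ge0 (a2 + b1); nra.
rewrite (le_trans (ler_normB _ _))// !normrM mulrDl lerD//; exact: ler_wpM2l.
Qed.

Lemma tnth_radial (t : vec) i : tnth (radial_proj t) i =
  ((tnth t i).1 / norm2 (cvec t), (tnth t i).2 / norm2 (cvec t)).
Proof. by rewrite tnth_mktuple. Qed.

(** The identity includes [t = 0], where both sides vanish because [0^-1 = 0]. *)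
Lemma hform_radial (P : 'M[C]_n) t : hform P (radial_proj t) = hform P t / sqnorm t.
Proof.
have -> : radial_proj t = dilate (norm2 (cvec t))^-1 t.
  apply: eq_from_tnth => i; rewrite !tnth_mktuple tnth_nseq /= !addr0.
  by rewrite ![_^-1 * _]mulrC.
by rewrite hform_dilate norm2_cvec exprVn sqr_sqrtr ?sqnorm_ge0// mulrC.
Qed.

Lemma radial_dilate r t : 0 < r -> radial_proj (dilate r t) = radial_proj t.
Proof.
move=> r0.
have E : norm2 (cvec (dilate r t)) = r * norm2 (cvec t).
  by rewrite !norm2_cvec /sqnorm hform_dilate sqrtrM ?sqr_ge0// sqrtr_sqr gtr0_norm.
have rn : r \is a GRing.unit by rewrite unitfE gt_eqF.
apply: eq_from_tnth => i; apply: (etrans (tnth_radial _ _)); apply/esym/(etrans (tnth_radial _ _)).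
by rewrite E tnth_dilate -!mulf_div !divrr// !mul1r.
Qed.

Lemma hform_radial_le (P : 'M[C]_n) : exists2 K : R, 0 <= K &
  forall t : vec, `|hform P (radial_proj t)| <= K.
Proof.
have [K K0 H] := hform_le P; exists K => // t.
rewrite hform_radial normrM normfV (ger0_norm (sqnorm_ge0 t)).
have := sqnorm_ge0 t; rewrite le_eqVlt => /predU1P[<-|s0].
  by rewrite invr0 mulr0.
by rewrite ler_pdivrMr.
Qed.

Lemma cvec_surj (x : 'cV[C]_n) : exists t : vec, cvec t = x.
Proof.
exists [tuple (complex.Re (x i 0), complex.Im (x i 0)) | i < n].
by apply/matrixP => i j; rewrite !mxE tnth_mktuple ord1; case: (x i 0).
Qed.

Lemma sqnorm_gt0 (t : vec) : cvec t != 0 -> 0 < sqnorm t.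
Proof.
move=> /eqP x0; rewrite lt_neqAle sqnorm_ge0 andbT eq_sym; apply/eqP => N0.
apply: x0; apply/matrixP => i j; rewrite !mxE.
have : (tnth t i).1 ^+ 2 + (tnth t i).2 ^+ 2 <= 0.
  rewrite -N0 sqnormE (bigD1 i)//= lerDl sumr_ge0// => l _.
  by rewrite addr_ge0 ?sqr_ge0.
case: (tnth t i) => a b /= ab.
by apply/eqP; rewrite eq_complex /= -[a == 0]sqrf_eq0 -[b == 0]sqrf_eq0 !eq_le !sqr_ge0 !andbT;
  apply/andP; split; have := sqr_ge0 a; have := sqr_ge0 b; lra.
Qed.

Lemma hform_sub (z : R) (H : 'M[C]_n) t :
  hform (z%:C%C%:M - H) t = z * sqnorm t - hform H t.
Proof.
rewrite /sqnorm /hform mulmxBl mul1mx mul_scalar_mx /inner mulmxBr -scalemxAr.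
rewrite [in LHS]mxE [X in complex.Re (X + _)]mxE [X in complex.Re (_ + X)]mxE raddfB.
by congr (_ - _); case: ((_ *m cvec t) 0 0) => a b /=; rewrite mul0r subr0.
Qed.

Lemma posdef_shift (H : 'M[C]_n) (K z : R) : H ^t* = H ->
  (forall t : vec, `|hform H t| <= K * sqnorm t) -> K < z ->
  posdef (z%:C%C%:M - H).
Proof.
move=> HH HK Kz; split.
  rewrite raddfB map_mxB HH /= tr_scalar_mx map_scalar_mx; congr (_%:M - _).
  by apply: complex_ext; rewrite /= ?oppr0.
move=> x; have [t <-] := cvec_surj x => x0; rewrite -/(hform _ t) hform_sub subr_gt0.
rewrite (le_lt_trans (ler_norm _))// (le_lt_trans (HK t))// ltr_pM2r//.
exact: sqnorm_gt0.
Qed.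

(** For the scalar matrix [x] the Gaussian integral is [pi ^+ n / x ^+ n] on one side and, by
    [polar_integral] with [c] constant, [gamma_int x] times the volume on the other. At [x = 1] the
    same identity forces the volume to be finite and positive. *)
Lemma ball_volume : exists2 v : R, 0 < v &
  lebesgueC R n (@unit_ball R n) = v%:E /\
  (forall x, 0 < x -> gamma_int x = (pi ^+ n / v / x ^+ n)%:E).
Proof.
set V := lebesgueC R n (@unit_ball R n).
have key x : 0 < x -> (gamma_int x * V = (pi ^+ n / x ^+ n)%:E)%E.
  move=> x0; rewrite -integral_cst; last exact: measurable_unit_ball.
  rewrite -(@polar_integral (fun=> x))//.
  have := @posdef_shift 0 0 x; rewrite subr0 => P.
  have /gauss_hform[d d0 [dE dI]] : posdef (x%:C%C%:M : 'M[C]_n).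
    apply: P => //; first by rewrite trmx0 map_mx0.
    by move=> t; rewrite /hform mul0mx /inner mulmx0 mxE normr0 mul0r.
  have -> : x ^+ n = d.
    apply: (@complexI R); rewrite -dE det_scalar.
    by rewrite rmorphXn.
  rewrite -dI; apply: eq_integral => t _; congr (expR _)%:E; congr (- _).
  have := hform_sub x 0 t; rewrite subr0 => ->.
  by rewrite /hform mul0mx /inner mulmx0 mxE subr0 mulrC.
have G0 x : 0 < x -> (0 <= gamma_int x)%E.
  move=> x0; apply: integral_ge0 => r _; rewrite lee_fin; case: ifP => // r0.
  by rewrite !mulr_ge0 ?expR_ge0// ?exprn_ge0// ltW.
have pin : 0 < pi ^+ n / 1 ^+ n :> R by rewrite divr_gt0 ?exprn_gt0// ?pi_gt0.
have V0 : (0 <= V)%E by exact: measure_ge0.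
have [v VE] : exists v : R, V = v%:E.
  have := key 1 ltr01; clear key; case: V V0 => [v _ _|_|//]; first by exists v.
  have := G0 1 ltr01; case: (gamma_int 1) => [r|_|//]; last by rewrite mulyy.
  rewrite lee_fin le_eqVlt => /predU1P[<-|r0]; last by rewrite gt0_muley ?lte_fin.
  by rewrite mul0e => -[] E; rewrite -E ltxx in pin.
have v0 : 0 < v.
  move: V0; rewrite VE lee_fin le_eqVlt => /predU1P[v0|//].
  have := key 1 ltr01; rewrite VE -v0 mule0 => -[] E.
  by rewrite -E ltxx in pin.
exists v => //; split=> // x x0; have := key x x0; rewrite VE.
have := G0 x x0; case: (gamma_int x) => [r _|_|//]; last first.
  by rewrite gt0_mulye ?lte_fin.
rewrite -EFinM => -[] E; congr EFin.
by rewrite mulrAC -E mulfK// gt_eqF.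
Qed.

(** The clause on [gamma_int] is carried along so that both formulas share the same [v], the volume
    of the ball. *)
Lemma ge0_integral_uniform_ball (f : vec -> R) : measurable_fun setT f ->
  (forall t, 0 <= f t) ->
  exists2 v : R, 0 < v &
  (\int[uniform_ball (n := n)]_t (f t)%:E =
   (v^-1)%:E * \int[lebesgueC R n]_(t in @unit_ball R n) (f t)%:E)%E /\
  (forall x, 0 < x -> gamma_int x = (pi ^+ n / v / x ^+ n)%:E).
Proof.
move=> mf f0; have [v v0 [VE G]] := ball_volume; exists v => //; split => //.
have vi : 0 <= v^-1 by rewrite invr_ge0 ltW.
have mb := measurable_unit_ball (R := R) (n := n).
(* Since the volume is neither 0 nor infinite, the normalization is a true division and the Dirac
   mass given as default does not appear. *)
have UE U : uniform_ball U = ((v^-1)%:E * lebesgueC R n (U `&` @unit_ball R n))%E.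
  rewrite /uniform_ball /mnormalize /= /mrestr setTI VE.
  have -> : (v%:E == 0%E) = false by rewrite eqe gt_eqF.
  by rewrite /= muleC.
have mf' : measurable_fun setT (EFin \o f) by exact/measurable_EFinP.
rewrite (@ge0_negligible_integral _ _ _ _ setT (~` @unit_ball R n))//; first last.
- by rewrite -[LHS]/(uniform_ball _) UE setICl measure0 mule0.
- by move=> t _; rewrite lee_fin.
- exact: measurableC.
rewrite setTD setCK -[RHS](ge0_integral_mscale (lebesgueC R n) mb (NngNum vi)); first last.
- by move=> t _; rewrite lee_fin.
- exact: measurable_funTS.
apply: eq_measure_integral => U mU Ub.
by rewrite -[LHS]/(uniform_ball U) UE (setIidl Ub).
Qed.

(** Let [c] be [z] minus the form of [H] at the normalized vector. The Gaussian integral of [z - H]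
    is [pi ^+ n / \det (z - H)], while in polar coordinates it is [pi ^+ n] times the mean of
    [c ^- n], the power coming from [gamma_int]. The volume of the ball cancels. *)
Lemma uniform_ball_transform (H : 'M[C]_n) (l : 'rV[R]_n) :
  H ^t* = H -> char_poly H = \prod_(j < n) ('X - ((l 0 j)%:C)%C%:P) ->
  exists2 K : R, 0 <= K &
  [/\ forall j, `|l 0 j| <= K,
     forall t : vec, `|hform H (radial_proj t)| <= K &
     forall z, K < z -> \int[uniform_ball (n := n)]_t ((z - hform H (radial_proj t)) ^- n) =
       \prod_(j < n) (z - l 0 j)^-1].
Proof.
move=> HH Hl; have [K1 K10 HK1] := hform_le H; have [K2 K20 HK2] := hform_radial_le H.
(* [K1] makes [z - H] positive definite, [K2] bounds the form on normalized vectors, and the sum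
   bounds the eigenvalues. *)
exists (K1 + K2 + \sum_j `|l 0 j|); first by rewrite !addr_ge0// sumr_ge0.
have s0 : 0 <= \sum_j `|l 0 j| by apply: sumr_ge0.
split.
- move=> j; rewrite (bigD1 j)//= addrCA lerDl addr_ge0// ?addr_ge0// sumr_ge0//.
- by move=> t; rewrite (le_trans (HK2 t))//; lra.
move=> z Kz.
have zK1 : K1 < z by lra.
have zK2 : K2 < z by lra.
pose c t := z - hform H (radial_proj t).
have mr : measurable_fun setT (fun t : vec => hform H (radial_proj t)).
  exact: (measurableT_comp (measurable_hform H) (measurable_funPT (@radial_proj R n))).
have mc : measurable_fun setT c by apply: measurable_funB.
have c0 t : 0 < c t.
  by rewrite /c subr_gt0 (le_lt_trans (ler_norm _))// (le_lt_trans (HK2 t)).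
have [d d0 [dE dI]] := gauss_hform (posdef_shift HH HK1 zK1).
have dP : d = \prod_(j < n) (z - l 0 j).
  apply: (@complexI R); rewrite -dE rmorph_prod /=.
  transitivity ((char_poly H).[z%:C%C]).
    rewrite /char_poly -horner_evalE -det_map_mx; congr determinant.
    apply/matrixP => i j; rewrite [RHS]mxE -[RHS]/((char_poly_mx H i j).[_]) !mxE hornerD hornerN hornerC; congr (_ - _).
    by case: eqP => _; rewrite ?mulr1n ?mulr0n ?hornerX ?hornerC.
  rewrite Hl horner_prod; apply: eq_bigr => j _.
  by rewrite hornerD hornerN hornerX hornerC rmorphB.
have mcn : measurable_fun setT (fun t => (c t)^-1 ^+ n).
  apply: measurable_funX.
  rewrite (_ : (fun t => _) = (@powR R ^~ (-1)) \o c).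
    by apply: measurableT_comp => //; exact: measurable_powR.
  by apply/funext => t /=; rewrite powR_inv1// ltW.
have cn0 t : 0 <= (c t)^-1 ^+ n by rewrite exprn_ge0// invr_ge0 ltW.
have [v v0 [E G]] := ge0_integral_uniform_ball mcn cn0.
have Hc t : sqnorm t * c t = hform (z%:C%C%:M - H) t.
  rewrite hform_sub /c mulrBr mulrC hform_radial; congr (_ - _).
  have := sqnorm_ge0 t; rewrite le_eqVlt => /predU1P[N0|s1].
    rewrite -N0 mul0r; apply/esym/eqP; rewrite -normr_le0.
    by rewrite (le_trans (HK1 t))// -N0 mulr0.
  by rewrite mulrC divfK// gt_eqF.
set I := (\int[lebesgueC R n]_(t in _) _)%E in E.
have : ((pi ^+ n / d)%:E = (pi ^+ n / v)%:E * I)%E.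
  rewrite -dI -ge0_integralZl; first last.
  - by rewrite lee_fin divr_ge0 ?exprn_ge0 ?pi_ge0// ltW.
  - by move=> t _; rewrite lee_fin.
  - by apply/measurable_EFinP; exact: measurable_funTS.
  - exact: measurable_unit_ball.
  transitivity (\int[lebesgueC R n]_t (expR (- (sqnorm t * c t)))%:E)%E.
    by apply: eq_integral => t _; rewrite Hc.
  rewrite (polar_integral mc c0); last by move=> r t r0; rewrite /c radial_dilate.
  by apply: eq_integral => t _; rewrite G// -EFinM exprVn.
have I0 : (0 <= I)%E by apply: integral_ge0 => t _; rewrite lee_fin.
have pn : 0 < pi ^+ n :> R by rewrite exprn_gt0// pi_gt0.
move: E; rewrite /Rintegral.
under [in X in _ -> _ -> X = _]eq_integral do rewrite -/(c _) -exprVn.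
(* [I] is finite because a positive multiple of it is the finite Gaussian integral. *)
move=> ->; case: I I0 => [I _|_|//]; last by rewrite gt0_muley ?lte_fin ?divr_gt0.
rewrite -!EFinM => -[] EI /=.
have -> : I = v / d.
  apply: (@mulfI _ (pi ^+ n / v)); first by rewrite gt_eqF// divr_gt0.
  by rewrite -EI; field; rewrite !gt_eqF.
rewrite prodfV -dP; field.
by rewrite !gt_eqF.
Qed.

End polar.

(** * Laws determined by their resolvent *)

Section bernstein.
Context (R : realType).

(* The Bernstein polynomial of degree [N], through the one-step recursion of
   the binomial random walk. *)
Fixpoint bernstein N (f : nat -> R) : {poly R} :=
  if N is N'.+1 then
    (1 - 'X) * bernstein N' f + 'X * bernstein N' (f \o S)
  else (f 0%N)%:P.

Lemma bernsteinS N f x : (bernstein N.+1 f).[x] =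
  (1 - x) * (bernstein N f).[x] + x * (bernstein N (f \o S)).[x].
Proof. by rewrite /= !hornerE. Qed.

Lemma bernstein_le N (f g : nat -> R) x : 0 <= x <= 1 ->
  (forall k, (k <= N)%N -> f k <= g k) ->
  (bernstein N f).[x] <= (bernstein N g).[x].
Proof.
move=> /andP[x0 x1]; elim: N f g => [|N IH] f g fg; first by rewrite !hornerC fg.
rewrite !bernsteinS lerD// ler_wpM2l ?subr_ge0//.
  by apply: IH => k kN; rewrite fg// ltnW.
by apply: IH => k kN; rewrite fg.
Qed.

Lemma bernsteinD N f g x : (bernstein N (fun k => f k + g k)).[x] =
  (bernstein N f).[x] + (bernstein N g).[x].
Proof.
elim: N f g => [|N IH] f g; first by rewrite !hornerC.
by rewrite !bernsteinS !IH; ring.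
Qed.

Lemma bernsteinZ N a f x : (bernstein N (fun k => a * f k)).[x] =
  a * (bernstein N f).[x].
Proof.
elim: N f => [|N IH] f; first by rewrite !hornerC.
by rewrite !bernsteinS !IH; ring.
Qed.

Lemma bernstein_cst N a x : (bernstein N (fun=> a)).[x] = a.
Proof.
elim: N => [|N IH]; first by rewrite !hornerC.
by rewrite bernsteinS (_ : (fun=> a) \o S = fun=> a)// IH; ring.
Qed.

(** The variance of a binomial variable. The offset [a] is what makes the induction close: one step
    of the walk replaces it by [a - x] or [a + 1 - x]. *)
Lemma bernstein_var N a x :
  (bernstein N (fun k => (k%:R + a - N%:R * x) ^+ 2)).[x] =
  N%:R * (x * (1 - x)) + a ^+ 2.
Proof.
elim: N a => [|N IH] a; first by rewrite hornerC; ring.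
rewrite bernsteinS.
rewrite (_ : (fun k => _) = fun k : nat => (k%:R + (a - x) - N%:R * x) ^+ 2); last first.
  by apply/funext => k; congr (_ ^+ 2); rewrite -natr1; ring.
rewrite (_ : _ \o S = fun k : nat => (k%:R + (a + 1 - x) - N%:R * x) ^+ 2); last first.
  by apply/funext => k /=; congr (_ ^+ 2); rewrite -natr1; ring.
by rewrite !IH -natr1; ring.
Qed.

(** Heine's theorem through the near-covering form of compactness; only [x] is confined to the
    segment. *)
Lemma segment_unif_continuous (g : R -> R) (a b e : R) : continuous g -> 0 < e ->
  exists2 d : R, 0 < d & forall x y, a <= x <= b -> `|y - x| < d -> `|g y - g x| < e.
Proof.
move=> cg e0.
have : compact `[a, b]%classic by exact: segment_compact.
move=> /compact_near_coveringP /(_ R 0^'+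
  (fun d x => forall y, `|y - x| < d -> `|g y - g x| < e) _) H.
have : \forall d \near 0^'+, `[a, b]%classic `<=`
    (fun x => forall y, `|y - x| < d -> `|g y - g x| < e).
  apply: H => x _.
  have e2 : 0 < e / 2 by rewrite divr_gt0.
  have /cvgrPdist_lt /(_ _ e2) [d /= d0 Hd] := cg x.
  have d2 : 0 < d / 2 by rewrite divr_gt0.
  exists (ball x (d / 2), [set d' | 0 < d' < d / 2]).
    split; first exact: nbhsx_ballx.
    by exists (d / 2) => //= d' /=; rewrite sub0r normrN => /ltr_normlW h1 h2; rewrite h2.
  move=> [x' d'] /= [xx' /andP[d'0 d'd]] y yx'.
  rewrite /ball /= in xx'.
  have h1 : `|g x - g y| < e / 2.
    apply: Hd; rewrite /ball /= (_ : x - y = (x - x') + (x' - y)); last by ring.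
    by rewrite (le_lt_trans (ler_normD _ _))// [`|x' - y|]distrC; lra.
  have h2 : `|g x - g x'| < e / 2 by apply: Hd; rewrite /ball /=; lra.
  rewrite (_ : g y - g x' = (g x - g x') - (g x - g y)); last by ring.
  by rewrite (le_lt_trans (ler_normB _ _))//; lra.
move=> [d /= d0 Hd]; have d2 : 0 < d / 2 by rewrite divr_gt0.
exists (d / 2) => // x y xab xy; apply: (Hd (d / 2)) => //=.
- by rewrite sub0r normrN gtr0_norm//; lra.
Qed.

(** Bernstein's proof. Chebyshev's inequality takes the form of a pointwise majorant [q] of the
    error, whose Bernstein polynomial is known from [bernstein_var]. *)
Lemma weierstrass (g : R -> R) (e : R) : continuous g -> 0 < e ->
  exists p : {poly R}, forall x, 0 <= x <= 1 -> `|g x - p.[x]| <= e.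
Proof.
move=> cg e0.
have e2 : 0 < e / 2 by rewrite divr_gt0.
have [d d0 Hd] := segment_unif_continuous 0 1 cg e2.
have [M M0 HM] : exists2 M, 0 <= M & forall x, 0 <= x <= 1 -> `|g x| <= M.
  have : {within `[0, 1], continuous (fun x => `|g x|)}.
    by apply: continuous_subspaceT => x; apply: continuous_comp; [exact: cg|exact: (@norm_continuous _ R^o)].
  move=> /(EVT_max ler01)[c _ Hc]; by exists `|g c|.
(* Large enough for the variance term [2 * M / d ^+ 2 / N%:R] to be at most [e / 2]. *)
pose N := (Num.truncn (2 * M / d ^+ 2 / (e / 2))).+1.
have N0 : 0 < N%:R :> R by rewrite ltr0n.
have NM : 2 * M / d ^+ 2 / N%:R <= e / 2.
  rewrite ler_pdivrMr// -ler_pdivrMl// mulrC.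
  by rewrite ltW// truncnS_gt// !divr_ge0 ?mulr_ge0 ?sqr_ge0// ltW.
exists (bernstein N (fun k => g (k%:R / N%:R))) => x x01.
have x1 : x * (1 - x) <= 1 by nra.
have kN (k : nat) : (k <= N)%N -> 0 <= (k%:R : R) / N%:R <= 1.
  by move=> kN; rewrite divr_ge0//= ler_pdivrMr// mul1r ler_nat.
(* The first term covers the nodes within [d] of [x]. At the others [(k / N - x) ^+ 2 / d ^+ 2] is
   at least 1, and the second term exceeds the trivial bound [2 * M]. *)
pose q (k : nat) := e / 2 + (2 * M / d ^+ 2 / N%:R ^+ 2) * (k%:R + 0 - N%:R * x) ^+ 2.
have qE : (bernstein N q).[x] <= e.
  rewrite /q bernsteinD bernstein_cst bernsteinZ bernstein_var expr0n /= addr0.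
  have -> : 2 * M / d ^+ 2 / N%:R ^+ 2 * (N%:R * (x * (1 - x))) =
     2 * M / d ^+ 2 / N%:R * (x * (1 - x)) by field; rewrite !gt_eqF.
  rewrite (le_trans (y := e / 2 + e / 2 * 1))//; last by lra.
  have x2 : 0 <= x * (1 - x) by nra.
  have M1 : 0 <= 2 * M / d ^+ 2 / N%:R by apply: divr_ge0 => //; apply: divr_ge0; rewrite ?sqr_ge0// mulr_ge0.
  by rewrite lerD2l; exact: ler_pM.
have key k : (k <= N)%N -> `|g (k%:R / N%:R) - g x| <= q k.
  move=> /kN k01; rewrite /q addr0.
  have E : 2 * M / d ^+ 2 / N%:R ^+ 2 * (k%:R - N%:R * x) ^+ 2 =
      2 * M * ((k%:R / N%:R - x) ^+ 2 / d ^+ 2) by field; rewrite !gt_eqF.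
  rewrite E; have [kx|kx] := ltP `|k%:R / N%:R - x| d.
    have := Hd x _ x01 kx; have := divr_ge0 (sqr_ge0 (k%:R / N%:R - x)) (sqr_ge0 d).
    by move=> h1 h2; have := mulr_ge0 (mulr_ge0 (ler0n R 2) M0) h1; lra.
  have h1 : 1 <= (k%:R / N%:R - x) ^+ 2 / d ^+ 2.
    by rewrite ler_pdivlMr ?exprn_gt0// mul1r -[leRHS]real_normK ?num_real// lerXn2r// nnegrE ltW.
  have := HM _ k01; have := HM _ x01.
  have := ler_normB (g (k%:R / N%:R)) (g x).
  by move=> ? ? ?; nra.
have L1 : g x <= (bernstein N q).[x] + (bernstein N (fun k => g (k%:R / N%:R))).[x].
  rewrite -bernsteinD -[leLHS](bernstein_cst N _ x); apply: bernstein_le => // k /key.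
  by rewrite ler_norml => /andP[]; lra.
have L2 : (bernstein N (fun k => g (k%:R / N%:R))).[x] <= (bernstein N q).[x] + g x.
  rewrite -[X in _ + X](bernstein_cst N _ x) -bernsteinD; apply: bernstein_le => // k /key.
  by rewrite ler_norml => /andP[]; lra.
by rewrite ler_norml; apply/andP; split; lra.
Qed.

End bernstein.

(** * Resolvents of weighted laws *)

Section resolvent.
Context (R : realType) d (T : measurableType d) (mu : {measure set T -> \bar R}).
Variables (w X : T -> R) (K : R).
Hypothesis iw : mu.-integrable setT (EFin \o w).
Hypothesis mX : measurable_fun setT X.
Hypothesis XK : forall y, w y != 0 -> `|X y| <= K.

(** The weight may be signed. On the spherical side it is 1 and [X] is the value of the form; on the
    spline side it is the spline and [X] is the identity of the line, bounded only where the spline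
    does not vanish. *)
Definition resolvent (m : nat) (z : R) := \int[mu]_y (w y * (z - X y) ^- m).

Lemma resolvent_bound z y m : K < z -> `|w y * (z - X y) ^- m| <= (z - K) ^- m * `|w y|.
Proof.
move=> Kz; have [->|wy] := eqVneq (w y) 0; first by rewrite mul0r normr0 mulr0.
have := XK wy; rewrite ler_norml => /andP[_ XyK].
have zX : 0 < z - X y by lra.
have zK : 0 < z - K by lra.
rewrite normrM mulrC ler_wpM2r// normfV normrX gtr0_norm// lef_pV2 ?posrE ?exprn_gt0//.
by apply: lerXn2r; rewrite ?nnegrE; lra.
Qed.

Lemma measurable_resolvent z m : measurable_fun setT (fun y => w y * (z - X y) ^- m).
Proof.
apply: measurable_funM; first by move/measurable_int : iw => /measurable_EFinP.
under eq_fun do rewrite -exprVn.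
apply: measurable_funX.
by apply: (measurableT_comp (@measurable_inv R)); exact: measurable_funB.
Qed.

Lemma integrable_resolvent z m : K < z ->
  mu.-integrable setT (EFin \o (fun y => w y * (z - X y) ^- m)).
Proof.
move=> Kz; apply: (@le_integrable _ _ _ _ _ measurableT _ (fun y => ((z - K) ^- m)%:E * (`|w y|)%:E)%E).
- by apply/measurable_EFinP; exact: measurable_resolvent.
- move=> y _ /=; rewrite lee_fin (le_trans (resolvent_bound y m Kz))//.
  by rewrite ler_norm.
- by apply: integrableZl => //; apply: integrable_norm.
Qed.

Lemma derive1_resolvent z m : K < z ->
  derive1 (resolvent m) z = - (m%:R * resolvent m.+1 z).
Proof.
move=> Kz.
(* A margin above [K]: for all parameters beyond [u] the derivative is dominated by the constant
   [m (u - K)^(-m-1)] times [|w|]. *)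
pose u := (K + z) / 2.
have Ku : K < u by rewrite /u; lra.
have uz : u < z by rewrite /u; lra.
pose f z y := w y * (z - X y) ^- m.
have nz x y : u < x -> w y != 0 -> x - X y != 0.
  by move=> ux /XK; rewrite ler_norml => /andP[_ ?]; rewrite gt_eqF//; lra.
have der x y : u < x -> is_derive x (1 : R) (f ^~ y) (- (m%:R * (w y * (x - X y) ^- m.+1))).
  move=> ux; have [wy|wy] := eqVneq (w y) 0.
    rewrite (_ : f ^~ y = cst 0); last by apply/funext => x'; rewrite /f wy mul0r.
    by rewrite wy mul0r mulr0 oppr0; exact: is_derive_cst.
  have nxy := nz _ _ ux wy.
  have h : x - X y != 0 -> is_derive x (1 : R) (fun x => ((x - X y) ^+ m)^-1)
     (- ((x - X y) ^+ m) ^- 2 *: (m%:R * (x - X y) ^+ m.-1)).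
    move=> nx; apply: is_deriveV; first by rewrite expf_neq0.
    have D : is_derive x (1 : R) (fun y0 : R => y0 - X y) 1.
      by apply: is_derive_eq; rewrite subr0.
    apply: is_derive_eq; first exact: (is_derive_pow m D).
    by rewrite mulr1.
  rewrite /f; apply: is_derive_eq; first by apply: is_deriveM; exact: h.
  rewrite scaler0 addr0 /GRing.scale /=; case: (m) => [|k] /=.
    by rewrite !mul0r !mulr0 oppr0.
  rewrite [_ ^+ k.+2]exprS [_ ^+ k.+1]exprS; have ak : (x - X y) ^+ k != 0 by rewrite expf_neq0.
  move: ((x - X y) ^+ k) ak => p p0; move: (x - X y) nxy => q q0.
  by move: (k.+1%:R) => c; field; rewrite ?p0 ?q0.
have -> : derive1 (resolvent m) z = \int[mu]_(y in setT) (partial1of2 f z y).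
  apply: (@differentiation_under_integral R _ T mu f setT measurableT z u (z + 1) _ _ _
    (fun y => (m%:R * (u - K) ^- m.+1) * `|w y|)).
  - by rewrite /= in_itv /= uz ltrDl ltr01.
  - move=> x /=; rewrite in_itv /= => /andP[ux _].
    by apply: integrable_resolvent; lra.
  - move=> x y /=; rewrite in_itv /= => /andP[ux _] _.
    by have [] := der x y ux.
  - move=> y; rewrite mulr_ge0// mulr_ge0// invr_ge0 exprn_ge0//; lra.
  - by apply: integrable_scale => //; exact: integrable_norm.
  - move=> x y /=; rewrite in_itv /= => /andP[ux _] _.
    have [_ D] := der x y ux.
    rewrite partial1of2E D normrN normrM normr_nat -mulrA ler_wpM2l//.
    rewrite (le_trans (resolvent_bound y m.+1 (lt_trans Ku ux)))// ler_wpM2r//.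
    rewrite lef_pV2 ?posrE ?exprn_gt0//; [|lra|lra].
    by apply: lerXn2r; rewrite ?nnegrE; lra.
transitivity (\int[mu]_(y in setT) (- m%:R * (w y * (z - X y) ^- m.+1))).
  apply: eq_Rintegral => y _; have [_ D] := der z y uz.
  by rewrite partial1of2E D mulNr.
by rewrite RintegralZl// ?mulNr//; exact: integrable_resolvent.
Qed.

(** With the pole at distance at least 1 from the values of [X], the coordinate [U] lies between
    [(2 * K + 1)^-1] and 1 wherever [w] does not vanish, hence inside the interval of
    [weierstrass]. *)
Let z0 := K + 1.
Let U y := (z0 - X y)^-1.

Lemma integrable_resolvent_poly m (p : {poly R}) :
  mu.-integrable setT (EFin \o (fun y => w y * U y ^+ m * p.[U y])).
Proof.
have z0K : K < z0 by rewrite /z0 ltrDl.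
elim/poly_ind: p m => [|p c IH] m.
  by rewrite (_ : _ \o _ = cst 0%E);
    [exact: integrable0|apply/funext => y; rewrite /= horner0 mulr0].
rewrite (_ : _ \o _ = (EFin \o (fun y => w y * U y ^+ m.+1 * p.[U y])) \+
  (fun y => c%:E * (w y * (z0 - X y) ^- m)%:E)%E); last first.
  apply/funext => y; rewrite /= -EFinM -EFinD; congr EFin.
  by rewrite hornerD hornerMX hornerC exprSr -exprVn -/(U y); ring.
apply: (integrableD measurableT (IH m.+1)).
by apply: integrableZl => //; exact: integrable_resolvent.
Qed.

Lemma resolvent_polyD m (p : {poly R}) c :
  \int[mu]_y (w y * U y ^+ m * (p * 'X + c%:P).[U y]) =
  \int[mu]_y (w y * U y ^+ m.+1 * p.[U y]) + c * resolvent m z0.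
Proof.
have z0K : K < z0 by rewrite /z0 ltrDl.
rewrite /resolvent -RintegralZl//; last exact: integrable_resolvent.
rewrite -RintegralD//; first last.
- rewrite (_ : _ \o _ = (fun y => c%:E * (w y * (z0 - X y) ^- m)%:E)%E)//.
  by apply: integrableZl => //; exact: integrable_resolvent.
- exact: integrable_resolvent_poly.
apply: eq_Rintegral => y _.
by rewrite hornerD hornerMX hornerC exprSr -exprVn -/(U y); ring.
Qed.

(* [h (X y)] as a continuous function of the coordinate [U y], truncated away
   from [U = 0]. *)
Definition resolvent_chart n (h : R -> R) (u : R) :=
  let v := Num.max u (2 * K + 1)^-1 in h (z0 - v^-1) * v^-1 ^+ n.

Lemma continuous_resolvent_chart n h : 0 <= K -> continuous h ->
  continuous (resolvent_chart n h).
Proof.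
move=> K0 ch u; rewrite /resolvent_chart.
have K21 : 0 < 2 * K + 1 by rewrite ltr_wpDl// mulr_ge0.
have a0 : 0 < (2 * K + 1)^-1 by rewrite invr_gt0.
have cv : {for u, continuous (fun u => (Num.max u (2 * K + 1)^-1)^-1)}.
  apply: (@continuous_comp _ _ _ (fun u => Num.max u (2 * K + 1)^-1) (fun x => x^-1)).
    by apply: continuous_max; [exact: cvg_id|exact: cvg_cst].
  by apply: inv_continuous; rewrite gt_eqF// lt_max a0 orbT.
rewrite /continuous_at; apply: cvgM.
  apply: (@continuous_comp _ _ _ (fun u => z0 - (Num.max u (2 * K + 1)^-1)^-1) h); last exact: ch.
  by apply: continuousB => //; exact: cst_continuous.
apply: (@continuous_comp _ _ _ (fun u => (Num.max u (2 * K + 1)^-1)^-1) (fun x : R => x ^+ n) u cv).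
exact: exprn_continuous.
Qed.

(** Only integrals of [w] times powers [U ^+ m] with [m >= n] are accessible, so the polynomial
    comes with a factor [U ^+ n]; the chart contains the inverse of that factor. *)
Lemma resolvent_approx n (h : R -> R) (p : {poly R}) (e : R) :
  continuous h -> (forall x, 0 <= x <= 1 -> `|resolvent_chart n h x - p.[x]| <= e) ->
  mu.-integrable setT (EFin \o (fun y => w y * h (X y))) ->
  `| \int[mu]_y (w y * h (X y)) - \int[mu]_y (w y * U y ^+ n * p.[U y])| <=
  e * \int[mu]_y `|w y|.
Proof.
move=> ch hp iwh.
have ip := integrable_resolvent_poly n p.
have iB : mu.-integrable setT
    (EFin \o (fun y => w y * h (X y) - w y * U y ^+ n * p.[U y])).
  exact: (integrableB measurableT iwh ip).
rewrite -RintegralB//.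
apply: (le_trans (le_normr_Rintegral measurableT iB)).
rewrite -RintegralZl//; last exact: integrable_norm.
apply: le_Rintegral => //.
- exact: (integrable_norm iB).
- by apply: integrable_scale => //; exact: integrable_norm.
move=> y _; have [->|wy] := eqVneq (w y) 0.
  by rewrite !mul0r subr0 normr0 mulr0.
have := XK wy; rewrite ler_norml => /andP[XyK1 XyK2].
have zX1 : 1 <= z0 - X y by rewrite /z0; lra.
have zX2 : z0 - X y <= 2 * K + 1 by rewrite /z0; lra.
have zX0 : 0 < z0 - X y by lra.
have Ua : (2 * K + 1)^-1 <= U y by rewrite lef_pV2 ?posrE//; lra.
have U1 : U y <= 1 by rewrite invf_le1.
have U0 : 0 < U y by rewrite invr_gt0.
(* On the range of [U] the truncation of the chart is inactive, and [z0 - (U y)^-1] is [X y]. *)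
have E : w y * h (X y) = w y * U y ^+ n * resolvent_chart n h (U y).
  rewrite /resolvent_chart max_l// mulrACA -exprMn divff ?gt_eqF// expr1n mulr1.
  by rewrite /U invrK; congr (_ * h _); ring.
rewrite E -mulrBr normrM normrM normrX (gtr0_norm U0) [leRHS]mulrC -mulrA.
rewrite ler_wpM2l// (le_trans (ler_wpM2l _ (hp (U y) _)))//.
- by rewrite exprn_ge0// ltW.
- by rewrite (ltW U0) U1.
rewrite ler_piMl//; last by rewrite exprn_ile1// ltW.
by rewrite (le_trans _ (hp 0 _))//= lexx ler01.
Qed.

End resolvent.

Section resolvent_unique.
Context (R : realType) d1 (T1 : measurableType d1) d2 (T2 : measurableType d2).
Variables (mu1 : {measure set T1 -> \bar R}) (mu2 : {measure set T2 -> \bar R}).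
Variables (w1 X1 : T1 -> R) (w2 X2 : T2 -> R) (K : R) (n : nat).
Hypotheses (K0 : 0 <= K) (n0 : (0 < n)%N).
Hypotheses (iw1 : mu1.-integrable setT (EFin \o w1))
  (iw2 : mu2.-integrable setT (EFin \o w2)).
Hypotheses (mX1 : measurable_fun setT X1) (mX2 : measurable_fun setT X2).
Hypotheses (XK1 : forall y, w1 y != 0 -> `|X1 y| <= K)
  (XK2 : forall y, w2 y != 0 -> `|X2 y| <= K).
Hypothesis RE : forall z, K < z ->
  resolvent mu1 w1 X1 n z = resolvent mu2 w2 X2 n z.

(** The resolvents agree on an open half-line, so their derivatives do; each derivative is the next
    resolvent times a factor that is nonzero because [n] is positive. *)
Lemma resolvent_eq_ge m z : (n <= m)%N -> K < z ->
  resolvent mu1 w1 X1 m z = resolvent mu2 w2 X2 m z.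
Proof.
move=> nm; rewrite -(subnK nm); elim: (m - n)%N z => [|k IH] z Kz; first exact: RE.
have : derive1 (resolvent mu1 w1 X1 (k + n)) z = derive1 (resolvent mu2 w2 X2 (k + n)) z.
  rewrite !derive1E; apply: near_eq_derive.
  near=> x; apply: IH; near: x; exact: lt_nbhsr.
rewrite (derive1_resolvent iw1 mX1 XK1)// (derive1_resolvent iw2 mX2 XK2)//.
move=> /oppr_inj/mulfI; rewrite addSn; apply.
by rewrite pnatr_eq0 addn_eq0 negb_and -!lt0n n0 orbT.
Unshelve. all: end_near. Qed.

Lemma resolvent_poly_eq m (p : {poly R}) : (n <= m)%N ->
  \int[mu1]_y (w1 y * (K + 1 - X1 y)^-1 ^+ m * p.[(K + 1 - X1 y)^-1]) =
  \int[mu2]_y (w2 y * (K + 1 - X2 y)^-1 ^+ m * p.[(K + 1 - X2 y)^-1]).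
Proof.
elim/poly_ind: p m => [|p c IH] m nm.
  by under eq_Rintegral do rewrite horner0 mulr0;
    under [RHS]eq_Rintegral do rewrite horner0 mulr0; rewrite /Rintegral !integral0.
rewrite (resolvent_polyD iw1 mX1 XK1) (resolvent_polyD iw2 mX2 XK2).
by rewrite IH ?(leq_trans nm)// resolvent_eq_ge// ltrDl.
Qed.

(** Both integrals are approximated by the same polynomial in [U], on which [resolvent_poly_eq]
    makes them agree; the errors add up to [e' * (W1 + W2)]. *)
Lemma law_unique (h : R -> R) : continuous h ->
  mu1.-integrable setT (EFin \o (fun y => w1 y * h (X1 y))) ->
  mu2.-integrable setT (EFin \o (fun y => w2 y * h (X2 y))) ->
  \int[mu1]_y (w1 y * h (X1 y)) = \int[mu2]_y (w2 y * h (X2 y)).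
Proof.
move=> ch i1 i2; apply/eqP; rewrite -subr_eq0 -normr_le0; apply/ler_addgt0Pl => e e0.
set W1 := \int[mu1]_y `|w1 y|; set W2 := \int[mu2]_y `|w2 y|.
have W10 : 0 <= W1 by apply: Rintegral_ge0.
have W20 : 0 <= W2 by apply: Rintegral_ge0.
have W0 : 0 < W1 + W2 + 1 by lra.
pose e' := e / (W1 + W2 + 1).
have e'0 : 0 < e' by rewrite divr_gt0.
have [p hp] := weierstrass (@continuous_resolvent_chart R K n h K0 ch) e'0.
have A1 := resolvent_approx iw1 mX1 XK1 ch hp i1.
have A2 := resolvent_approx iw2 mX2 XK2 ch hp i2.
have := resolvent_poly_eq p (leqnn n).
move: A1 A2; rewrite -/W1 -/W2 addr0.
set a := (X in `|_ - X|); set b := (X in _ -> `|_ - X| <= _ -> _).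
set c := \int[mu1]_y (w1 y * h (X1 y)); set d := \int[mu2]_y (w2 y * h (X2 y)).
move=> A1 A2 ab.
have -> : c - d = (c - a) - (d - b) by have -> : a = b := ab; ring.
rewrite (le_trans (ler_normB _ _))// (le_trans (lerD A1 A2))// -mulrDr.
by rewrite /e' mulrAC ler_pdivrMr// ler_wpM2l ?ltW//; lra.
Qed.

End resolvent_unique.

(** * Divided differences and B-splines *)

Section divided_differences.
Context (R : realType) (n : nat).
Implicit Types (l m : 'rV[R]_n) (g : R -> R) (I : {set 'I_n}).

(* The divided difference at the knots indexed by [I]. *)
Definition dd I g m : R :=
  \sum_(j in I) g (m 0 j) / \prod_(k in I | k != j) (m 0 j - m 0 k).

Lemma ddT g m : dd [set: 'I_n] g m = divdiff_distinct g m.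
Proof.
apply: eq_big => [j|j _]; first by rewrite inE.
by congr (_ / _); apply: eq_bigl => k; rewrite inE.
Qed.

Lemma ddD I g h m : dd I (fun y => g y + h y) m = dd I g m + dd I h m.
Proof. by rewrite /dd -big_split /=; apply: eq_bigr => j _; rewrite mulrDl. Qed.

Lemma ddZ I a g m : dd I (fun y => a * g y) m = a * dd I g m.
Proof. by rewrite /dd mulr_sumr; apply: eq_bigr => j _; rewrite mulrA. Qed.

Lemma eq_dd I g h m : (forall j, j \in I -> g (m 0 j) = h (m 0 j)) ->
  dd I g m = dd I h m.
Proof. by move=> gh; apply: eq_bigr => j /gh ->. Qed.

(** The factor [y - m 0 j] kills the term of the knot [j] and cancels one factor in each other
    denominator. The recursions below all rest on this identity. *)
Lemma dd_rem I j g m : injective (m 0) -> j \in I ->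
  dd (I :\ j) g m = dd I (fun y => (y - m 0 j) * g y) m.
Proof.
move=> mi jI; rewrite /dd [RHS](bigD1 j)//= subrr !mul0r add0r.
apply: eq_big => [k|k]; first by rewrite !inE andbC.
rewrite !inE => /andP[kj kI].
rewrite [X in _ = _ / X](bigD1 j)/=; last by rewrite jI eq_sym.
rewrite -mulf_div divff ?mul1r; last by rewrite subr_eq0 (inj_eq mi).
congr (_ / _); apply: eq_bigl => i; rewrite !inE.
by case: (i \in I); case: (i == j); case: (i == k).
Qed.

(** The two functions given by [dd_rem] differ by [(y - m 0 j) - (y - m 0 i)] times [g], and this
    factor is the constant [m 0 i - m 0 j]. *)
Lemma dd_rec I i j g m : injective (m 0) -> i \in I -> j \in I ->
  (m 0 i - m 0 j) * dd I g m = dd (I :\ j) g m - dd (I :\ i) g m.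
Proof.
move=> mi iI jI; rewrite !dd_rem// -ddZ.
apply/esym/eqP; rewrite subr_eq -ddD; apply/eqP/eq_dd => k _; ring.
Qed.

Lemma dd1 i g m : dd [set i] g m = g (m 0 i).
Proof.
rewrite /dd big_set1 big1 ?divr1// => k; rewrite inE => /andP[/eqP->].
by rewrite eqxx.
Qed.

Lemma dd_cst0 I m : injective (m 0) -> (1 < #|I|)%N -> dd I (fun=> 1) m = 0.
Proof.
move=> mi; have [N] := ubnP #|I|; elim: N I => // N IH I.
move=> IN I1; have /card_gt1P[i [j [iI jI ij]]] := I1.
have mij : m 0 i - m 0 j != 0 by rewrite subr_eq0 (inj_eq mi).
apply: (mulfI mij); rewrite mulr0 (dd_rec _ mi iI jI).
have cj : #|I| = #|I :\ j|.+1 by rewrite (cardsD1 j I) jI.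
have ci : #|I| = #|I :\ i|.+1 by rewrite (cardsD1 i I) iI.
have [I2|I2] := ltnP 2 #|I|.
  by rewrite !IH ?subrr//; rewrite ?cj ?ci in I2 IN *; lia.
have I2' : #|I| = 2 by lia.
have /eqP/cards1P[a ->] : #|I :\ j| = 1%N by lia.
have /eqP/cards1P[b ->] : #|I :\ i| = 1%N by lia.
by rewrite !dd1 subrr.
Qed.

Lemma dd_shift I i c k m : injective (m 0) -> i \in I ->
  dd I (fun y => (y - c) ^+ k.+1) m =
  dd (I :\ i) (fun y => (y - c) ^+ k) m + (m 0 i - c) * dd I (fun y => (y - c) ^+ k) m.
Proof.
move=> mi iI; rewrite dd_rem// -ddZ -ddD; apply: eq_dd => j _.
by rewrite exprS; ring.
Qed.

Lemma dd_pow0 I c k m : injective (m 0) -> (k.+1 < #|I|)%N ->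
  dd I (fun y => (y - c) ^+ k) m = 0.
Proof.
move=> mi; elim: k I => [|k IH] I kI; first exact: dd_cst0.
have /card_gt0P[i iI] : (0 < #|I|)%N by lia.
have ci : #|I| = #|I :\ i|.+1 by rewrite (cardsD1 i I) iI.
by rewrite (dd_shift _ _ mi iI) !IH ?mulr0 ?addr0//; lia.
Qed.

(** The filter along which [divdiff] takes its limit. *)
Definition distinct_nbhs l : set_system 'rV[R]_n :=
  within [set m : 'rV[R]_n | injective (m 0)] (nbhs l).

#[global] Instance distinct_nbhs_filter l : Filter (distinct_nbhs l).
Proof. exact: within_filter. Qed.

Lemma distinct_near l : \forall m \near (distinct_nbhs l), injective ((m : 'rV[R]_n) 0).
Proof. by apply: (@filterE 'rV[R]_n (nbhs l)) => m; exact. Qed.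

(** Moving [l] along the direction [(0, 1, ..., n - 1)] separates equal knots at once, while two
    different knots collide for at most one parameter; so all knots are distinct for small positive
    [e]. This makes limits along the filter unique. *)
#[global] Instance distinct_nbhs_proper l : ProperFilter (distinct_nbhs l).
Proof.
split; last exact: distinct_nbhs_filter.
rewrite /distinct_nbhs /within /= => H.
pose v : 'rV[R]_n := \row_j j%:R.
pose p (e : R) : 'rV[R]_n := l + e *: v.
have cp : p e @[e --> 0^'+] --> l.
  rewrite -[X in _ --> X]addr0 -(scale0r v); apply: cvgD; first exact: cvg_cst.
  apply: cvgZr_tmp; apply: cvg_at_right_filter; exact: cvg_id.
have {}H : \forall e \near 0^'+, ~ injective (p e 0) by exact: (cp _ H).
have di (ij : 'I_n * 'I_n) : \forall e \near 0^'+, p e 0 ij.1 = p e 0 ij.2 -> ij.1 = ij.2.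
  case: ij => i j /=; have [->|ij] := eqVneq i j; first by near=> e.
  have vij : (i%:R - j%:R : R) != 0.
    by rewrite subr_eq0 (inj_eq (@mulrIn R 1 _)) ?oner_neq0.
  have [lij|lij] := eqVneq (l 0 i) (l 0 j).
    near=> e; rewrite !mxE lij => /addrI/eqP; rewrite -subr_eq0 -mulrBr mulf_eq0.
    by rewrite (negPf vij) orbF gt_eqF.
  (* The only parameter at which the knots [i] and [j] meet. *)
  pose c := (l 0 j - l 0 i) / (i%:R - j%:R).
  have nc : \forall e \near 0^'+, e != c.
    have [c0|c0] := ltP 0 c.
      by near=> e; rewrite lt_eqF//; near: e; exact: nbhs_right_lt.
    by near=> e; rewrite gt_eqF// (le_lt_trans c0)//.
  near=> e; rewrite !mxE => E; exfalso.
  have {}E : e = c.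
    by apply/(canRL (mulfK vij)); rewrite mulrBr; move: E; lra.
  suff : e != c by rewrite E eqxx.
  by near: e.
have FP : ProperFilter (0 : R)^'+ by exact: at_right_proper_filter.
have FF : Filter (0 : R)^'+ by exact: FP.
have : \forall e \near 0^'+, injective (p e 0).
  have : \forall e \near 0^'+, forall ij : 'I_n * 'I_n, p e 0 ij.1 = p e 0 ij.2 -> ij.1 = ij.2.
    exact: filter_forall.
  by apply: (@filterS _ _ FF) => e E i j; exact: (E (i, j)).
move=> H2; have := @filterI _ _ FF _ _ H H2; rewrite (_ : _ `&` _ = set0).
  by case: FP.
by apply/seteqP; split => // e [].
Unshelve. all: end_near. Qed.

Lemma cvg_coord l i : (m : 'rV[R]_n) 0 i @[m --> distinct_nbhs l] --> l 0 i.
Proof. by apply: cvg_within_filter; exact: coord_continuous. Qed.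

Lemma cvg_near_eq (F : set_system 'rV[R]_n) {FF : Filter F} (f g : 'rV[R]_n -> R) (a : R) :
  (\forall m \near F, f m = g m) -> f m @[m --> F] --> a -> g m @[m --> F] --> a.
Proof. by move=> E; apply: cvg_trans; exact: near_eq_cvg. Qed.

(** By [dd_shift], lowering the power by one removes one knot, and the extra term carries a factor
    [m 0 i - c] that tends to 0. What remains in the limit is the power equal to the number of knots
    minus one, with value 1. *)
Lemma cvg_dd_pow l I c k : (0 < #|I|)%N -> (forall i, i \in I -> l 0 i = c) ->
  dd I (fun y => (y - c) ^+ k) m @[m --> distinct_nbhs l] --> ((k.+1 == #|I|)%:R : R).
Proof.
elim: k I => [|k IH] I I0 Ic.
  have [I1|I1] := eqVneq 1%N #|I|.
    have /eqP/cards1P[a aI] : #|I| = 1%N by [].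
    rewrite aI; under eq_fun do rewrite dd1 expr0; exact: cvg_cst.
  have I2 : (1 < #|I|)%N by lia.
  apply: (@cvg_near_eq _ _ (fun=> 0)); last exact: cvg_cst.
  near=> m; rewrite (@eq_dd _ _ (fun=> 1)) ?dd_cst0//; near: m; exact: distinct_near.
have /card_gt0P[i iI] := I0.
have ci : #|I| = #|I :\ i|.+1 by rewrite (cardsD1 i I) iI.
have E : \forall m \near distinct_nbhs l,
   dd (I :\ i) (fun y => (y - c) ^+ k) m + (m 0 i - c) * dd I (fun y => (y - c) ^+ k) m =
   dd I (fun y => (y - c) ^+ k.+1) m.
  by near=> m; rewrite -dd_shift//; near: m; exact: distinct_near.
apply: (cvg_near_eq E).
rewrite ci eqSS.
rewrite -[X in _ --> X]addr0 -[X in _ --> _ + X](mul0r ((k.+1 == #|I|)%:R : R)).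
apply: cvgD.
  have [I1|I1] := posnP #|I :\ i|.
    have -> : I :\ i = finset.set0 by apply/eqP; rewrite -cards_eq0 I1.
    rewrite cards0 /=; apply: (@cvg_near_eq _ _ (fun=> 0)); last exact: cvg_cst.
    by near=> m; rewrite /dd big_set0.
  by apply: IH => // j; rewrite !inE => /andP[_ /Ic].
apply: cvgM; last exact: IH.
rewrite -[X in _ --> X](subrr c); apply: cvgB; last exact: cvg_cst.
by rewrite -(Ic _ iI); exact: cvg_coord.
Unshelve. all: end_near. Qed.

Lemma dd_sum I N (a : 'I_N -> R) (g : 'I_N -> R -> R) m :
  dd I (fun y => \sum_(k < N) a k * g k y) m = \sum_(k < N) a k * dd I (g k) m.
Proof.
rewrite /dd; under eq_bigr do rewrite mulr_suml.
rewrite exchange_big /=; apply: eq_bigr => k _.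
by rewrite mulr_sumr; apply: eq_bigr => j _; rewrite mulrA.
Qed.

Lemma near_side l i s : s != l 0 i ->
  \forall m \near distinct_nbhs l, (s < (m : 'rV[R]_n) 0 i) = (s < l 0 i).
Proof.
move=> sl; have [sl'|] := ltP s (l 0 i).
  have H : \forall m \near distinct_nbhs l, s < (m : 'rV[R]_n) 0 i.
    exact: (cvg_coord (lt_nbhsr sl')).
  by near=> m; near: m.
rewrite le_eqVlt eq_sym (negPf sl) /= => sl'.
have H : \forall m \near distinct_nbhs l, (m : 'rV[R]_n) 0 i < s.
  exact: (cvg_coord (lt_nbhsl sl')).
near=> m; apply/negbTE; rewrite -leNgt ltW//; near: m; exact: H.
Unshelve. all: end_near.
Qed.

Lemma near_sides l s : (forall i, s != l 0 i) ->
  \forall m \near distinct_nbhs l, forall i, (s < (m : 'rV[R]_n) 0 i) = (s < l 0 i).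
Proof.
move=> sl; apply: (@filter_forall _ 'I_n (fun i m => (s < (m : 'rV[R]_n) 0 i) = (s < l 0 i))).
by move=> i; exact: near_side.
Qed.

(** Close to [l], all knots of [I] lie on the same side of [s] as [c]. There the truncated power is
    0 or a polynomial, and of its expansion in powers of [y - c] only the term of degree [#|I|.-1]
    survives, by [cvg_dd_pow]. *)
Lemma cvg_dd_trunc_const l I c s : (0 < #|I|)%N ->
  (forall i, i \in I -> l 0 i = c) -> (forall i, s != l 0 i) ->
  dd I (trunc_power n s) m @[m --> distinct_nbhs l] -->
  (if s < c then 'C(n - 2, #|I|.-1)%:R * (c - s) ^+ (n - 2 - #|I|.-1) else 0 : R).
Proof.
move=> I0 Ic sl; have [sc|sc] := ltP s c; last first.
  apply: (@cvg_near_eq _ _ (fun=> 0)); last exact: cvg_cst.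
  near=> m; rewrite /dd big1// => j jI; rewrite /trunc_power.
  suff -> : (s < m 0 j) = false by rewrite mul0r.
  rewrite (near (near_sides sl) m)// Ic//.
  by apply/negbTE; rewrite -leNgt.
pose a (k : 'I_(n - 2).+1) : R := (c - s) ^+ (n - 2 - k) *+ 'C(n - 2, k).
have E : \forall m \near distinct_nbhs l,
   \sum_(k < (n - 2).+1) a k * dd I (fun y => (y - c) ^+ k) m = dd I (trunc_power n s) m.
  near=> m; rewrite -dd_sum; apply: eq_dd => j jI; rewrite /trunc_power.
  have -> : s < m 0 j by rewrite (near (near_sides sl) m)// Ic.
  rewrite (_ : m 0 j - s = (c - s) + (m 0 j - c)); last by ring.
  by rewrite exprDn; apply: eq_bigr => k _; rewrite /a mulrnAl.
apply: (cvg_near_eq E).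
have -> : 'C(n - 2, #|I|.-1)%:R * (c - s) ^+ (n - 2 - #|I|.-1) =
    \sum_(k < (n - 2).+1) a k * ((k : nat).+1 == #|I|)%:R :> R.
  have [Ib|Ib] := ltnP #|I|.-1 (n - 2).+1.
    rewrite (bigD1 (Ordinal Ib))//= prednK// eqxx mulr1 big1 ?addr0 /a/=.
      by rewrite mulr_natl.
    move=> k kI; rewrite (_ : _ == _ = false) ?mulr0//; apply/negbTE.
    by apply: contra kI => /eqP kI; apply/eqP/val_inj => /=; rewrite -kI.
  rewrite bin_small// mul0r big1// => k _; rewrite (_ : _ == _ = false) ?mulr0//.
  by apply/negbTE/eqP => kI; have := ltn_ord k; lia.
apply: cvg_big => [|k _]; first exact: add_continuous.
by apply: cvgM; [exact: cvg_cst|exact: cvg_dd_pow].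
Unshelve. all: end_near. Qed.

End divided_differences.

(** * A Beta integral by explicit primitives *)

Section beta.
Context (R : realType).

Lemma cvg_inv_shift_y (d : R) : 0 < d -> (d + x)^-1 @[x --> +oo] --> (0 : R).
Proof.
move=> d0; apply/gtr0_cvgV0.
  by near=> x; rewrite addr_gt0.
apply/cvgryPge => A; near=> x.
rewrite -lerBlDl; near: x; apply: nbhs_pinfty_ge; exact: num_real.
Unshelve. all: end_near. Qed.

Lemma cvg_ratio_y (d : R) : 0 < d -> x / (d + x) @[x --> +oo] --> (1 : R).
Proof.
move=> d0.
have E : {near (+oo : set_system R), (fun x => 1 - d * (d + x)^-1) =1 (fun x => x / (d + x))}.
  near=> x; have dx : d + x != 0 by rewrite gt_eqF// addr_gt0.
  by field; rewrite dx.
have L : 1 - d * (d + x)^-1 @[x --> +oo] --> 1 - d * 0.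
  apply: cvgB; first exact: cvg_cst.
  by apply: cvgM; [exact: cvg_cst|exact: cvg_inv_shift_y].
by rewrite mulr0 subr0 in L; exact: cvg_trans (near_eq_cvg E) L.
Unshelve. all: end_near. Qed.

Lemma cvg_pow T (F : set_system T) {FF : Filter F} (f : T -> R) (a : R) k :
  f x @[x --> F] --> a -> f x ^+ k @[x --> F] --> a ^+ k.
Proof.
move=> fa; elim: k => [|k IH]; first exact: cvg_cst.
rewrite exprS; under eq_fun do rewrite exprS.
exact: cvgM.
Qed.

(** For [q = 0] the primitive is a multiple of a power of [x / (d + x)]; integration by parts then
    raises [q]. The limit is [d ^- q.+1] times the Beta value of [p - q + 1] and [q + 1], whose
    inverse is [p.+1 * 'C(p, q)]. *)
Lemma beta_primitive (p q : nat) (d : R) : 0 < d -> (q <= p)%N ->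
  exists (G : R -> R) (L : R), [/\ G 0 = 0,
    forall x : R, 0 <= x -> is_derive x (1 : R) G (x ^+ (p - q) * (d + x) ^- p.+2),
    G x @[x --> +oo] --> L &
    'C(p, q)%:R * L = d ^- q.+1 / p.+1%:R].
Proof.
move=> d0; elim: q => [|q IH] qp.
  exists (fun x => (p.+1%:R * d)^-1 * (x * (d + x)^-1) ^+ p.+1), (p.+1%:R * d)^-1; split.
  - by rewrite mul0r expr0n mulr0.
  - move=> x x0.
    have dx : d + x != 0 by rewrite gt_eqF//; lra.
    have D : is_derive x (1 : R) (fun x => x * (d + x)^-1) (d * (d + x) ^- 2).
      have D3 := is_derive_add (is_derive_const x d) (is_derive_idr x).
      apply: (is_derive_eq (is_derive_mul (is_derive_idr x) (is_derive_inv dx D3))).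
      by field; rewrite dx.
    apply: (is_derive_eq (is_derive_scale _ (is_derive_pow p.+1 D))).
    rewrite /= subn0 exprMn exprVn !exprS.
    have px : (d + x) ^+ p != 0 by rewrite expf_neq0.
    move: ((d + x) ^+ p) (x ^+ p) px => u v u0.
    by field; rewrite u0 dx gt_eqF// addrC natr1 pnatr_eq0.
  - rewrite -[X in _ --> X]mulr1 -(expr1n _ p.+1); apply: cvgM; first exact: cvg_cst.
    by apply: cvg_pow; exact: cvg_ratio_y.
  - by rewrite bin0 mul1r invfM mulrC expr1.
have [G [L [G0 GD GL LE]]] := IH (ltnW qp).
have pq : (p - q)%:R != 0 :> R by rewrite pnatr_eq0 subn_eq0 -ltnNge.
(* Obtained by solving for [x ^+ (p - q.+1) * (d + x) ^- p.+2] in the derivative of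
   [x ^+ (p - q) * (d + x) ^- p.+1]. *)
exists (fun x => ((p - q)%:R * d)^-1 * (x ^+ (p - q) * (d + x) ^- p.+1 + q.+1%:R * G x)).
exists (((p - q)%:R * d)^-1 * (0 + q.+1%:R * L)); split.
- by rewrite G0 mulr0 addr0 expr0n subn_eq0 leqNgt qp mul0r mulr0.
- move=> x x0.
  have dx : d + x != 0 by rewrite gt_eqF//; lra.
  have D1 := is_derive_pow (p - q) (is_derive_idr x).
  have D3 := is_derive_add (is_derive_const x d) (is_derive_idr x).
  have D2 := is_derive_pow p.+1 D3.
  have {}D2 := @is_derive_inv _ (fun y => (d + y) ^+ p.+1) x _ (expf_neq0 p.+1 dx) D2.
  have D4 := GD x x0.
  apply: (is_derive_eq (is_derive_scale _ (is_derive_add (is_derive_mul D1 D2) (is_derive_scale _ D4)))).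
  rewrite (_ : (p - q)%N = (p - q.+1).+1); last by lia.
  rewrite /= [_ ^+ p.+2]exprS [_ ^+ p.+1]exprS [_ ^+ (p - q.+1).+1]exprS.
  have px : (d + x) ^+ p != 0 by rewrite expf_neq0.
  have pq' : (p - q.+1).+1%:R != 0 :> R by rewrite pnatr_eq0.
  have qE : q.+1%:R = p.+1%:R - (p - q.+1).+1%:R :> R.
    by rewrite -natrB; [congr (_%:R); lia|lia].
  rewrite qE; move: ((d + x) ^+ p) (x ^+ (p - q.+1)) ((p - q.+1).+1%:R) (p.+1%:R) px pq' => u v a b u0 a0.
  by field; rewrite u0 a0 dx gt_eqF.
- apply: cvgM; first exact: cvg_cst.
  apply: cvgD; last by apply: cvgM => //; exact: cvg_cst.
  rewrite (_ : (fun _ => _) = fun x => (x * (d + x)^-1) ^+ (p - q) * ((d + x)^-1) ^+ q.+1); last first.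
    apply/funext => x; rewrite exprMn -mulrA -exprD -exprVn; congr (_ * _ ^+ _); lia.
  rewrite (_ : 0 = 1 ^+ (p - q) * 0 ^+ q.+1 :> R); last by rewrite expr0n mulr0.
  by apply: cvgM; apply: cvg_pow; [exact: cvg_ratio_y|exact: cvg_inv_shift_y].
- rewrite add0r; have := mul_bin_left p q => /(congr1 (fun k => k%:R : R)); rewrite !natrM => B.
  have -> : 'C(p, q.+1)%:R * (((p - q)%:R * d)^-1 * (q.+1%:R * L)) =
    ((p - q)%:R * d)^-1 * (q.+1%:R * 'C(p, q.+1)%:R) * L by ring.
  rewrite B (_ : _ * L = ((p - q)%:R * d)^-1 * (p - q)%:R * ('C(p, q)%:R * L)); last by ring.
  rewrite LE [d ^+ q.+2]exprS; field.
  by rewrite pq gt_eqF// expf_neq0 ?gt_eqF// addrC natr1 pnatr_eq0.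
Qed.

End beta.

Section integral_lemmas.
Context (R : realType).
Local Notation leb := (@lebesgue_measure R).

Lemma integrable_mul_bounded d (T : measurableType d) (mu : {measure set T -> \bar R})
    (f g : T -> R) (M : R) :
  mu.-integrable setT (EFin \o f) -> measurable_fun setT g ->
  (forall x, f x != 0 -> `|g x| <= M) ->
  mu.-integrable setT (EFin \o (fun x => f x * g x)).
Proof.
move=> fi mg gM; have := measurable_int _ fi => /measurable_EFinP mf.
apply: (@le_integrable _ _ _ mu _ measurableT _ (fun x => M%:E * (EFin \o f) x)%E).
- by apply/measurable_EFinP; exact: measurable_funM.
- move=> x _ /=; rewrite lee_fin !normrM.
  have [->|fx] := eqVneq (f x) 0; first by rewrite normr0 !(mul0r, mulr0).
  by rewrite mulrC ler_wpM2r// (le_trans (gM x fx))// ler_norm.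
- exact: integrableZl.
Qed.

Lemma segment_bounded (h : R -> R) (K : R) : 0 <= K -> continuous h ->
  exists M : R, forall s, `|s| <= K -> `|h s| <= M.
Proof.
move=> K0 ch.
have [||c _ hc] := @EVT_max R (fun s => `|h s|) (- K) K.
- by lra.
- by apply: continuous_subspaceT => x; apply: cvg_norm; exact: ch.
- by exists `|h c| => s sK; apply: hc; rewrite in_itv /= -ler_norml.
Qed.

Lemma finite_set_null (F : set R) : finite_set F -> measurable F /\ leb F = 0%E.
Proof.
move=> fF; split; last exact/countable_lebesgue_measure0/finite_set_countable.
apply: countable_measurable; last exact: finite_set_countable.
by move=> t; exact: measurable_set1.
Qed.

(** Measurable sets are Borel here, so agreement almost everywhere would not suffice; but every
    subset of a finite set is finite, hence Borel. *)
Lemma measurable_off_finite (F : set R) (f g : R -> R) : finite_set F ->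
  (forall s, ~ F s -> f s = g s) -> measurable_fun setT g -> measurable_fun setT f.
Proof.
move=> fF fg mg _ B mB; rewrite setTI.
have mF (G : set R) : G `<=` F -> measurable G.
  by move=> GF; apply: (finite_set_null _).1; exact: sub_finite_set GF fF.
rewrite (_ : f @^-1` B = (F `&` f @^-1` B) `|` (g @^-1` B `\` F)).
  apply: measurableU; first by apply: mF; exact: subIsetl.
  apply: measurableD; last exact: mF.
  by rewrite -[X in measurable X]setTI; exact: mg.
apply/seteqP; split => s /=.
  by have [Fs|Fs] := pselect (F s); [left|right; rewrite -fg].
by case=> [[]//|[gs Fs]]; rewrite fg.
Qed.

Lemma integral_off_finite (F : set R) (f g : R -> R) : finite_set F ->
  (forall s, ~ F s -> f s = g s) -> leb.-integrable setT (EFin \o g) ->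
  leb.-integrable setT (EFin \o f) /\ \int[leb]_s f s = \int[leb]_s g s.
Proof.
move=> fF fg ig; have := measurable_int _ ig => /measurable_EFinP mg.
have mf := measurable_off_finite fF fg mg.
have aefg (k : \bar R -> \bar R) : {ae leb, forall s, setT s -> k (f s)%:E = k (g s)%:E}.
  exists F; split.
  - exact: (finite_set_null fF).1.
  - exact: (finite_set_null fF).2.
  - by move=> s; apply: contra_notP => Fs _; rewrite fg.
split; last first.
  rewrite /Rintegral; congr fine; apply: ae_eq_integral => //; [exact/measurable_EFinP|exact/measurable_EFinP|].
  exact: (aefg idfun).
apply/integrableP; split; first exact/measurable_EFinP.
rewrite (@ae_eq_integral _ _ _ leb setT (fun s => `|(EFin \o g) s|)%E (fun s => `|(EFin \o f) s|)%E) //.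
- by case/integrableP: ig.
- by apply: measurableT_comp => //; exact/measurable_EFinP.
- by apply: measurableT_comp => //; exact/measurable_EFinP.
- exact: (aefg abse).
Qed.

End integral_lemmas.

(** * The transform of the B-spline *)

Section bspline_transform.
Local Open Scope sesquilinear_scope.
Context (R : realType) (n : nat).
Implicit Types (l m : 'rV[R]_n) (I : {set 'I_n}).
Local Notation leb := (@lebesgue_measure R).

Lemma beta_integral (p q : nat) (d : R) : 0 < d -> (q <= p)%N ->
  (\int[leb]_(x in `[0%R, +oo[) ('C(p, q)%:R * (x ^+ (p - q) * (d + x) ^- p.+2))%:E =
   (d ^- q.+1 / p.+1%:R)%:E)%E.
Proof.
move=> d0 qp; have [G [L [G0 GD GL LE]]] := beta_primitive d0 qp.
rewrite (@ge0_continuous_FTC2y _ _ (fun x => 'C(p, q)%:R * G x) 0 (d ^- q.+1 / p.+1%:R)).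
- by rewrite G0 mulr0 sube0.
- move=> x x0; rewrite mulr_ge0// mulr_ge0 ?exprn_ge0// invr_ge0 exprn_ge0//.
  by rewrite addr_ge0// ltW.
- apply: continuous_in_subspaceT => x; rewrite inE/= in_itv/= andbT => x0.
  apply: cvgM; first exact: cvg_cst.
  apply: cvgM; first by apply: cvg_pow; exact: cvg_id.
  have dx : (d + x) ^+ p.+2 != 0 by rewrite expf_neq0// gt_eqF// ltr_wpDr.
  apply: cvgV => //; apply: cvg_pow; apply: cvgD; [exact: cvg_cst|exact: cvg_id].
- by rewrite -LE; apply: cvgM => //; exact: cvg_cst.
- by move=> x /ltW x0; have [] := is_derive_scale ('C(p, q)%:R) (GD x x0).
- apply: cvgM; first exact: cvg_cst.
  apply: cvg_at_right_filter; apply: differentiable_continuous; apply/derivable1_diffP.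
  by have [] := GD 0 (lexx _).
- move=> x; rewrite in_itv/= andbT => /ltW x0.
  have [] := is_derive_scale ('C(p, q)%:R) (GD x x0).
  by rewrite derive1E.
Qed.

Lemma measurable_trunc (r : nat) (c a : R) :
  measurable_fun setT (fun s : R => if s < c then a * (c - s) ^+ r else 0).
Proof.
apply: measurable_fun_ifT.
- by apply: measurable_fun_ltr => //; exact: measurable_cst.
- apply: measurable_funM; first exact: measurable_cst.
  by apply: measurable_funX; apply: measurable_funB => //; exact: measurable_cst.
- exact: measurable_cst.
Qed.

Lemma measurable_pole (k : nat) (z : R) : measurable_fun setT (fun s : R => (z - s) ^- k).
Proof.
under eq_fun do rewrite -exprVn.
apply: measurable_funX; apply: (measurableT_comp (@measurable_inv R)).
by apply: measurable_funB => //; exact: measurable_cst.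
Qed.

(** The substitution [s = c - x] leads to [beta_integral] with [p = n - 2], [q = r - 1] and
    [d = z - c]. The condition [r < n] is [q <= p]; it excludes [n] equal knots, whose law is a
    point mass. *)
Lemma constant_knots_integral (r : nat) (c z : R) : (0 < r < n)%N -> c < z ->
  let D s := if s < c then 'C(n - 2, r.-1)%:R * (c - s) ^+ (n - 2 - r.-1) else 0 : R in
  (\int[leb]_s (D s * (z - s) ^- n)%:E = (n.-1%:R^-1 * (z - c) ^- r)%:E)%E.
Proof.
move=> /andP[r0 rn] cz D.
have mD : measurable_fun setT (fun s : R => D s * (z - s) ^- n).
  by apply: measurable_funM; [exact: measurable_trunc|exact: measurable_pole].
have D0 s : 0 <= D s * (z - s) ^- n.
  rewrite /D; case: ifPn => sc; last by rewrite mul0r.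
  by rewrite !mulr_ge0// ?invr_ge0 exprn_ge0//; lra.
rewrite (@ge0_integral_affine R (-1) c); first last.
- by move=> x; rewrite lee_fin.
- exact/measurable_EFinP.
- by rewrite oppr_eq0 oner_eq0.
rewrite normrN1 mul1e.
have -> : (n.-1%:R^-1 * (z - c) ^- r)%:E = ((z - c) ^- (r.-1).+1 / (n - 2).+1%:R)%:E :> \bar R.
  by rewrite prednK// mulrC (_ : n.-1 = (n - 2).+1)//; lia.
rewrite -beta_integral; [|lra|lia].
rewrite -[in RHS]integral_itv_obnd_cbnd; last first.
  apply: measurable_funTS; apply/measurable_EFinP.
  apply: measurable_funM; first exact: measurable_cst.
  apply: measurable_funM; first exact: measurable_funX.
  under eq_fun do rewrite -exprVn.
  apply: measurable_funX; apply: (measurableT_comp (@measurable_inv R)).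
  by apply: measurable_funD => //; exact: measurable_cst.
rewrite [RHS]integral_mkcond; apply: eq_integral => x _.
rewrite patchE; case: ifPn; rewrite /affine /D.
  rewrite inE /= in_itv /= andbT => x0.
  rewrite ifT; last by lra.
  congr (_%:E); rewrite (_ : c - (-1 * x + c) = x); last by ring.
  rewrite (_ : z - (-1 * x + c) = z - c + x); last by ring.
  by rewrite -mulrA [in X in _ ^- X](_ : n = (n - 2).+2)//; lia.
rewrite notin_setE /= in_itv /= andbT => /negP; rewrite -leNgt => x0.
by rewrite ifF ?mul0r//; apply/negbTE; rewrite -leNgt; lra.
Qed.

(* [D] is the limit of the divided differences off the knots. *)
Definition dd_limit l I (D : R -> R) := [/\ measurable_fun setT D,
  forall s, (forall i, s != l 0 i) -> dd I (trunc_power n s) m @[m --> distinct_nbhs l] --> D s,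
  forall s, (forall i, l 0 i <= s) -> D s = 0 &
  forall z, (forall i, l 0 i < z) ->
    leb.-integrable setT (EFin \o (fun s => D s * (z - s) ^- n)) /\
    \int[leb]_s (D s * (z - s) ^- n) = n.-1%:R^-1 * \prod_(i in I) (z - l 0 i)^-1].

Lemma dd_limit_constant l I (c : R) : (0 < #|I| < n)%N ->
  (forall i, i \in I -> l 0 i = c) ->
  dd_limit l I (fun s => if s < c then 'C(n - 2, #|I|.-1)%:R * (c - s) ^+ (n - 2 - #|I|.-1) else 0).
Proof.
move=> /andP[I0 In] Ic; split.
- exact: measurable_trunc.
- by move=> s ls; exact: cvg_dd_trunc_const.
- move=> s ls; case/card_gt0P : I0 => i /Ic ci; rewrite ifF//.
  by apply/negbTE; rewrite -leNgt -ci.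
- move=> z lz; have cz : c < z by case/card_gt0P : I0 => i /Ic <-.
  have H := @constant_knots_integral #|I| c z.
  rewrite I0 In in H; have {}H := H isT cz; split; last first.
    rewrite /Rintegral H /=; congr (_ * _).
    under eq_bigr => i /Ic -> do [].
    by rewrite prodr_const exprVn.
  apply/integrableP; split.
    by apply/measurable_EFinP; apply: measurable_funM; [exact: measurable_trunc|exact: measurable_pole].
  under eq_integral.
    move=> s _; rewrite /= ger0_norm; last first.
      case: ifPn => sc; last by rewrite mul0r.
      by rewrite !mulr_ge0// ?invr_ge0 exprn_ge0//; lra.
    over.
  by rewrite H ltry.
Qed.

Lemma cvg_dd_rec l I (i j : 'I_n) g (a b : R) : i \in I -> j \in I -> l 0 i != l 0 j ->
  dd (I :\ j) g m @[m --> distinct_nbhs l] --> a ->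
  dd (I :\ i) g m @[m --> distinct_nbhs l] --> b ->
  dd I g m @[m --> distinct_nbhs l] --> (l 0 i - l 0 j)^-1 * (a - b).
Proof.
move=> iI jI ij ca cb.
apply: (@cvg_near_eq _ _ _ _ (fun m => (m 0 i - m 0 j)^-1 * (dd (I :\ j) g m - dd (I :\ i) g m))).
  near=> m; have mi : injective ((m : 'rV[R]_n) 0) by near: m; exact: distinct_near.
  rewrite -(dd_rec _ mi iI jI) mulKf// subr_eq0 (inj_eq mi).
  by apply: contra ij => /eqP ->.
apply: cvgM; last exact: cvgB.
apply: cvgV; first by rewrite subr_eq0.
by apply: cvgB; exact: cvg_coord.
Unshelve. all: end_near. Qed.

(** Two different knots of [I] allow the divided difference to be split into two with one knot less.
    The splitting stops at groups of equal knots, treated by [dd_limit_constant]; the disjunction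
    ensures that such a group never consists of all [n] knots. *)
Lemma dd_limit_exists l I : (0 < #|I|)%N ->
  (#|I| < n)%N \/ (exists i j, [/\ i \in I, j \in I & l 0 i != l 0 j]) ->
  exists D, dd_limit l I D.
Proof.
have [N] := ubnP #|I|; elim: N I => // N IH I IN I0 H.
have [ex|nex] := pselect (exists i j, [/\ i \in I, j \in I & l 0 i != l 0 j]); last first.
  case: H => // In; have /card_gt0P[i iI] := I0.
  eexists; apply: (@dd_limit_constant _ _ (l 0 i)); first by rewrite I0.
  by move=> j jI; apply/eqP; apply: contra_notT nex => ij; exists j, i.
have [i [j [iI jI ij]]] := ex.
have ci : #|I| = #|I :\ i|.+1 by rewrite (cardsD1 i I) iI.
have cj : #|I| = #|I :\ j|.+1 by rewrite (cardsD1 j I) jI.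
have In : (#|I| <= n)%N by rewrite -[X in (_ <= X)%N]card_ord max_card.
have ji : j != i by apply: contraNN ij => /eqP ->.
have iIj : i \in I :\ j by rewrite !inE eq_sym ji.
have jIi : j \in I :\ i by rewrite !inE ji.
have [Di [mDi cDi Di0 iDi]] : exists D, dd_limit l (I :\ i) D.
  by apply: IH; [lia|apply/card_gt0P; exists j|left; lia].
have [Dj [mDj cDj Dj0 iDj]] : exists D, dd_limit l (I :\ j) D.
  by apply: IH; [lia|apply/card_gt0P; exists i|left; lia].
have lij : l 0 i - l 0 j != 0 by rewrite subr_eq0.
exists (fun s => (l 0 i - l 0 j)^-1 * (Dj s - Di s)); split.
- by apply: measurable_funM; [exact: measurable_cst|exact: measurable_funB].
- by move=> s ls; apply: cvg_dd_rec => //; [exact: cDj|exact: cDi].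
- by move=> s ls; rewrite Di0// Dj0// subrr mulr0.
- move=> z lz; have [ii iE] := iDi z lz; have [ji' jE] := iDj z lz.
  have E : (fun s => (l 0 i - l 0 j)^-1 * (Dj s - Di s) * (z - s) ^- n) =
    fun s => (l 0 i - l 0 j)^-1 * (Dj s * (z - s) ^- n - Di s * (z - s) ^- n).
    by apply/funext => s; ring.
  rewrite E; split.
    by apply: integrable_scale => //; exact: integrable_sub.
  rewrite RintegralZl//; last exact: integrable_sub.
  rewrite RintegralB// iE jE.
  have zi : z - l 0 i != 0 by rewrite subr_eq0 gt_eqF.
  have zj : z - l 0 j != 0 by rewrite subr_eq0 gt_eqF.
  (* Removing the knot [k] multiplies the product by [z - l 0 k]; the two such factors differ by
     [l 0 i - l 0 j], which cancels the denominator of the recursion. *)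
  have PI k : k \in I -> \prod_(i0 in I :\ k) (z - l 0 i0)^-1 =
      (z - l 0 k) * \prod_(i0 in I) (z - l 0 i0)^-1.
    move=> kI; rewrite (big_setD1 k kI)/= mulVKf// subr_eq0 gt_eqF//.
  rewrite (PI _ iI) (PI _ jI); move: (n.-1%:R^-1) (\prod_(i0 in I) _) => a b.
  by field.
Qed.

Lemma near_trunc l i s : s != l 0 i ->
  trunc_power n s ((m : 'rV[R]_n) 0 i) @[m --> distinct_nbhs l] --> trunc_power n s (l 0 i).
Proof.
move=> sl; have H := near_side sl; rewrite /trunc_power.
apply: (@cvg_near_eq _ _ _ _ (fun m => if s < l 0 i then (m 0 i - s) ^+ (n - 2) else 0)).
  by near=> m; rewrite (near H m).
case: ifP => _; last exact: cvg_cst.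
by apply: cvg_pow; apply: cvgB; [exact: cvg_coord|exact: cvg_cst].
Unshelve. all: end_near. Qed.

Lemma cvg_prod J (r : seq J) (P : pred J) (F : set_system 'rV[R]_n) {FF : Filter F}
    (f : J -> 'rV[R]_n -> R) (a : J -> R) :
  (forall j, P j -> f j m @[m --> F] --> a j) ->
  \prod_(j <- r | P j) f j m @[m --> F] --> \prod_(j <- r | P j) a j.
Proof.
move=> fa; elim: r => [|j r IH].
  by rewrite big_nil; under eq_fun do rewrite big_nil; exact: cvg_cst.
rewrite big_cons; under eq_fun do rewrite big_cons.
by case: ifPn => // /fa Pj; exact: cvgM.
Qed.

(** For distinct knots [divdiff] is a value and not a limit; off the knots the divided difference is
    continuous at [l], so that the value is still the limit [a]. *)
Lemma divdiff_limit l s (a : R) : (forall i, s != l 0 i) ->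
  dd [set: 'I_n] (trunc_power n s) m @[m --> distinct_nbhs l] --> a ->
  divdiff l (trunc_power n s) = a.
Proof.
move=> sl ca; rewrite /divdiff.
have E : dd [set: 'I_n] (trunc_power n s) = @divdiff_distinct R n (trunc_power n s).
  by apply/funext => m; rewrite ddT.
rewrite E in ca; case: ifPn => [/injectiveP li|_]; last exact: (cvg_lim _ ca).
apply: (cvg_unique _ _ ca) => //.
rewrite /divdiff_distinct; apply: cvg_big => [|j _]; first exact: add_continuous.
apply: cvgM; first exact: near_trunc.
apply: cvgV.
  by apply/prodf_neq0 => k kj; rewrite subr_eq0 (inj_eq li) eq_sym.
by apply: cvg_prod => k _; apply: cvgB; exact: cvg_coord.
Qed.

(* [b] corrects the B-spline at the knots, where the limit defining it may be a
   junk value. *)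
Lemma bspline_transform l (K : R) : (0 < n)%N -> (forall j, `|l 0 j| <= K) ->
  (exists i j, l 0 i != l 0 j) ->
  exists b : R -> R, [/\ measurable_fun setT b,
    forall s, (forall i, s != l 0 i) -> bspline l s = b s,
    forall s, K < `|s| -> b s = 0 &
    forall z, K < z -> leb.-integrable setT (EFin \o (fun s => b s * (z - s) ^- n)) /\
      \int[leb]_s (b s * (z - s) ^- n) = \prod_(j < n) (z - l 0 j)^-1].
Proof.
move=> n0 lK [i [j ij]].
have n1 : (n.-1 != 0)%N.
  have : i != j by apply: contraNneq ij => ->.
  by have := ltn_ord i; have := ltn_ord j; rewrite -val_eqE/=; lia.
have [D [mD cD D0 iD]] : exists D, dd_limit l [set: 'I_n] D.
  apply: dd_limit_exists; first by rewrite cardsT card_ord.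
  by right; exists i, j; rewrite !inE.
have lt_knots s : K < s -> forall i, l 0 i < s.
  by move=> Ks k; apply: le_lt_trans Ks; apply: le_trans (lK k); exact: ler_norm.
have knots_lt s : s < - K -> forall i, s < l 0 i.
  by move=> Ks k; have := lK k; rewrite ler_norml => /andP[Kk _]; exact: lt_le_trans Ks Kk.
(* To the left of all knots the truncated power is a polynomial of degree [n - 2], which a divided
   difference at [n] knots annihilates. *)
have DK s : s < - K -> D s = 0.
  move=> sK; have sl k : s != l 0 k by rewrite lt_eqF// knots_lt.
  apply: (cvg_unique (@Rhausdorff R) (cD s sl)).
  apply: (@cvg_near_eq _ _ _ _ (fun=> 0)); last exact: cvg_cst.
  have H := near_sides sl.
  near=> m; have mi : injective ((m : 'rV[R]_n) 0) by near: m; exact: distinct_near.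
  have sm k : s < m 0 k by rewrite (near H m)// knots_lt.
  rewrite (@eq_dd _ _ _ _ (fun y => (y - s) ^+ (n - 2))).
    by rewrite dd_pow0// cardsT card_ord; lia.
  by move=> k _; rewrite /trunc_power sm.
exists (fun s => n.-1%:R * D s); split.
- by apply: measurable_funM; first exact: measurable_cst.
- by move=> s sl; rewrite /bspline; congr (_ * _); exact: divdiff_limit (cD s sl).
- move=> s; rewrite ltr_normr => /orP[Ks|Ks].
    by rewrite D0 ?mulr0// => k; exact/ltW/lt_knots.
  by rewrite DK ?mulr0//; lra.
- move=> z Kz; have [iz zE] := iD z (lt_knots z Kz).
  have E : (fun s => n.-1%:R * D s * (z - s) ^- n) = fun s => n.-1%:R * (D s * (z - s) ^- n).
    by apply/funext => s; rewrite mulrA.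
  rewrite E; split; first exact: integrable_scale.
  rewrite RintegralZl// zE mulVKf ?pnatr_eq0//.
  by apply: eq_bigl => k; rewrite inE.
Unshelve. all: end_near. Qed.

(** By [uniform_ball_transform] and [bspline_transform] both laws have the same resolvent of order
    [n], so [law_unique] applies with the weights 1 and [b]; [b] and the spline differ at most at
    the finitely many knots. *)
Lemma bspline_law (H : 'M[R[i]]_n) l (h : R -> R) : (0 < n)%N ->
  H ^t* = H -> char_poly H = \prod_(j < n) ('X - ((l 0 j)%:C)%C%:P) ->
  (exists i j, l 0 i != l 0 j) -> continuous h ->
  leb.-integrable setT (EFin \o (fun s => bspline l s * h s)) /\
  \int[leb]_s (bspline l s * h s) =
    \int[uniform_ball (n := n)]_t h (hform H (radial_proj t)).
Proof.
move=> n0 HH Hl lij ch.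
have [K K0 [lK hK HE]] := uniform_ball_transform HH Hl.
have [b [mb bE bK bz]] := bspline_transform n0 lK lij.
have [M hM] := segment_bounded K0 ch.
have ib : leb.-integrable setT (EFin \o b).
  have KK : K < K + 1 by rewrite ltrDl.
  have zs s : b s != 0 -> `|s| <= K by move=> bs; rewrite leNgt; apply: contra bs => /bK ->.
  (* Integrability of [b] is recovered from that of [b s * (K + 1 - s) ^- n] by multiplying back
     with a factor that is bounded where [b] is not 0. *)
  apply: eq_integrable (@integrable_mul_bounded _ _ _ leb _ (fun s => (K + 1 - s) ^+ n) ((2 * K + 1) ^+ n) (bz _ KK).1 _ _) => //.
  - move=> s _ /=; have [->|/zs] := eqVneq (b s) 0; first by rewrite !mul0r.
    rewrite ler_norml => /andP[_ sK].
    by rewrite mulfVK// expf_neq0// gt_eqF//; lra.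
  - by apply: measurable_funX; apply: measurable_funB.
  - move=> s; rewrite mulf_eq0 negb_or => /andP[/zs sK _].
    move: sK; rewrite ler_norml => /andP[? ?].
    by rewrite normrX lerXn2r// ?nnegrE ?normr_ge0//; [lra|rewrite ler_norml; lra].
have hKM s : b s != 0 -> `|h s| <= M.
  by move=> bs; apply: hM; rewrite leNgt; apply: contra bs => /bK ->.
have mh : measurable_fun setT h by exact: continuous_measurable_fun.
have ibh : leb.-integrable setT (EFin \o (fun s => b s * h s)).
  exact: integrable_mul_bounded ib mh hKM.
have mX : measurable_fun setT (fun t : n.-tuple (plane R) => hform H (radial_proj t)).
  by apply: (measurableT_comp (measurable_hform H)).
have i1 : (uniform_ball (n := n)).-integrable setT (EFin \o (fun=> 1 : R)).
  apply: (@bounded_integrable _ _ _ _ _ _ 1) => //; last by move=> *; rewrite normr1.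
  by rewrite -[X in (X < _)%E]/(uniform_ball (n := n) setT) probability_setT ltry.
have L : \int[uniform_ball (n := n)]_t (1 * h (hform H (radial_proj t))) = \int[leb]_s (b s * h s).
  apply: (@law_unique _ _ _ _ _ (uniform_ball (n := n)) leb (fun=> 1) _ b id K n) => //.
  - by move=> s; apply: contra_neqT; rewrite -ltNge; exact: bK.
  - move=> z Kz; rewrite /resolvent (bz z Kz).2 -HE//.
    by apply: eq_Rintegral => t _; rewrite mul1r.
  - apply: (integrable_mul_bounded i1 (measurableT_comp mh mX)) => t _.
    exact: hM.
have fF : finite_set (range (l 0)) by exact: finite_image.
have [i2 E2] : leb.-integrable setT (EFin \o (fun s => bspline l s * h s)) /\
    \int[leb]_s (bspline l s * h s) = \int[leb]_s (b s * h s).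
  apply: (integral_off_finite fF) => // s Fs; rewrite bE// => k.
  by apply/eqP => sk; apply: Fs; exists k.
split => //; rewrite E2.
by rewrite -L; apply: eq_Rintegral => t _; rewrite mul1r.
Qed.

End bspline_transform.

(** * Null sets under fractional maps *)

Section bilipschitz_null.
Context (R : realType).
Local Notation leb := (@lebesgue_measure R).
Implicit Types (S N I : set R) (f : R -> R).

Lemma interval_measure_ge I (u v : R) : measurable I -> is_interval I -> I u -> I v ->
  (`|u - v|%:E <= leb I)%E.
Proof.
move=> mI iI; wlog uv : u v / u <= v.
  by move=> H Iu Iv; have [/H|/ltW/H] := leP u v; [exact|rewrite distrC; exact].
move=> Iu Iv; rewrite distrC ger0_norm ?subr_ge0//.
have -> : (v - u)%:E = leb `[u, v].
  rewrite lebesgue_measure_itv /= lte_fin; case: ltP => // vu.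
  by rewrite (@le_anti _ _ v u) ?subrr// vu uv.
apply: le_measure; rewrite ?inE//.
by move=> x /=; rewrite in_itv /= => uxv; exact: (iI u v Iu Iv).
Qed.

(** The points of [S] mapped into [I] are pairwise at distance at most [k] times the length of [I],
    so an interval of twice that length around any one of them contains them all. *)
Lemma inverse_lipschitz_interval S f (k : R) I :
  0 < k -> measurable S -> measurable_fun setT f ->
  (forall a b, S a -> S b -> `|a - b| <= k * `|f a - f b|) ->
  measurable I -> is_interval I ->
  (leb (S `&` f @^-1` I) <= (2 * k)%:E * leb I)%E.
Proof.
move=> k0 mS mf Sf mI iI.
have mfI : measurable (S `&` f @^-1` I).
  by apply: measurableI => //; rewrite -[X in measurable X]setTI; exact: mf.
have [->|/set0P[a [Sa Ia]]] := eqVneq (S `&` f @^-1` I) set0.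
  by rewrite measure0 mule_ge0// lee_fin mulr_ge0// ltW.
have [Ioo|Ioo] := eqVneq (leb I) +oo%E.
  by rewrite Ioo gt0_muley ?leey// lte_fin mulr_gt0.
have LE : leb I = (fine (leb I))%:E by rewrite fineK// ge0_fin_numE// ltey.
move: (fine (leb I)) LE => L LE.
have L0 : 0 <= L by rewrite -lee_fin -LE.
rewrite LE -EFinM.
apply: (@le_trans _ _ (leb `[a - k * L, a + k * L])).
  apply: le_measure; rewrite ?inE// => b [Sb Ib] /=.
  have := Sf _ _ Sb Sa; have := interval_measure_ge mI iI Ib Ia.
  rewrite LE lee_fin => fL ba.
  have : `|b - a| <= k * L by apply: (le_trans ba); rewrite ler_wpM2l// ltW.
  by rewrite in_itv /= ler_norml => /andP[? ?]; lra.
rewrite lebesgue_measure_itv /= lte_fin; case: ltP => _.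
  by rewrite -EFinD lee_fin; lra.
by rewrite lee_fin !mulr_ge0// ltW.
Qed.

(** [N] is enclosed in an open set of measure at most [e / (2 * k)], and the bound for intervals is
    summed over its components. *)
Lemma inverse_lipschitz_null S f (k : R) N :
  0 < k -> measurable S -> measurable_fun setT f ->
  (forall a b, S a -> S b -> `|a - b| <= k * `|f a - f b|) ->
  measurable N -> leb N = 0%E -> leb (S `&` f @^-1` N) = 0%E.
Proof.
move=> k0 mS mf Sf mN N0.
have mfI I : measurable I -> measurable (S `&` f @^-1` I).
  by move=> mI; apply: measurableI => //; rewrite -[X in measurable X]setTI; exact: mf.
apply/eqP; rewrite eq_le measure_ge0 andbT; apply/lee_addgt0Pr => e e0; rewrite add0e.
have e2 : 0 < e / (2 * k) by rewrite divr_gt0// mulr_gt0.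
have [||U [oU NU UN]] := @lebesgue_regularity_outer R N (e / (2 * k)) mN.
- by rewrite [ltLHS]N0 ltry.
- exact: e2.
have mU : measurable U by exact: open_measurable.
have Ue : (leb U <= (e / (2 * k))%:E)%E.
  have -> : U = (U `\` N) `|` N by rewrite setUC setDUK.
  have M := @measureU2 _ _ _ leb _ _ (measurableD mU mN) mN.
  apply: (le_trans M); by rewrite [X in (_ + X)%E]N0 adde0 ltW.
pose I := open_disjoint_itv oU.
have mI i : measurable (I i) by apply: open_measurable; exact: open_disjoint_itv_open.
have UE : leb U = (\sum_(i <oo) leb (I i))%E.
  rewrite [in LHS](open_disjoint_itv_bigcup oU) measure_bigcup//.
    by apply: eq_eseriesl => i; rewrite in_setT.
    by move=> i _; exact: mI.
  exact: open_disjoint_itv_trivIset.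
apply: (@le_trans _ _ (leb (S `&` f @^-1` U))).
  by apply: le_measure; rewrite ?inE; [exact: mfI|exact: mfI|move=> x [Sx /NU Ux]].
have -> : S `&` f @^-1` U = \bigcup_i (S `&` f @^-1` (I i)).
  by rewrite [in LHS](open_disjoint_itv_bigcup oU) preimage_bigcup setI_bigcupr.
apply: (@le_trans _ _ (\sum_(i <oo) leb (S `&` f @^-1` (I i)))%E).
  have mSI i : measurable (S `&` f @^-1` (I i)) by apply: mfI.
  by apply: measure_sigma_subadditive => //; exact: bigcupT_measurable.
apply: (@le_trans _ _ (\sum_(i <oo) (2 * k)%:E * leb (I i))%E).
  apply: lee_nneseries => // i _.
  by apply: inverse_lipschitz_interval => //; exact: open_disjoint_itv_is_interval.
rewrite nneseriesZl//.
rewrite -UE; apply: (le_trans (lee_wpmul2l _ Ue)).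
  by rewrite lee_fin mulr_ge0// ltW.
by rewrite -EFinM lee_fin mulrC divfK// gt_eqF// mulr_gt0.
Qed.

(** The radius and the constant may depend on the point: balls with rational centers, inverse
    integer radii and integer constants are countably many and cover everything outside [Z]. *)
Lemma locally_inverse_lipschitz_null (Z : set R) f N : finite_set Z ->
  measurable_fun setT f ->
  (forall p, ~ Z p -> exists k e : R, 0 < e /\
    forall a b, `|a - p| < e -> `|b - p| < e -> `|a - b| <= k * `|f a - f b|) ->
  measurable N -> leb N = 0%E -> leb (f @^-1` N) = 0%E.
Proof.
move=> fZ mf fl mN N0.
have mfN : measurable (f @^-1` N) by rewrite -[X in measurable X]setTI; exact: mf.
pose P (q : rat) (i k : nat) := forall a b : R, `|a - ratr q| < i.+1%:R^-1 ->
  `|b - ratr q| < i.+1%:R^-1 -> `|a - b| <= k.+1%:R * `|f a - f b|.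
pose B (t : rat * nat * nat) : set R :=
  [set x | P t.1.1 t.1.2 t.2 /\ ball (ratr t.1.1 : R) t.1.2.+1%:R^-1 x] `&` f @^-1` N.
have B0 t : leb.-negligible (B t).
  rewrite /B; have [Pq|nPq] := pselect (P t.1.1 t.1.2 t.2); last first.
    rewrite (_ : [set _ | _] = set0) ?set0I; first exact: negligible_set0.
    by apply/seteqP; split => // x [].
  rewrite (_ : [set _ | _] = ball (ratr t.1.1 : R) t.1.2.+1%:R^-1); last first.
    by apply/seteqP; split => // x [].
  apply/negligibleP; first by apply: measurableI => //; exact: measurable_ball.
  apply: (@inverse_lipschitz_null _ _ t.2.+1%:R) => //; first exact: measurable_ball.
  by move=> a b; rewrite /ball /= ![`|ratr _ - _|]distrC; exact: Pq.
have sub : f @^-1` N `<=` Z `|` \bigcup_(j : nat) (if unpickle j is Some t then B t else set0).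
  move=> p Np; have [Zp|Zp] := pselect (Z p); [by left|right].
  have [k [e [e0 H]]] := fl p Zp.
  (* Half of [e], so that a ball of this radius that contains [p] stays within distance [e] of
     [p]. *)
  have [i ie] : exists i : nat, i.+1%:R^-1 < e / 2.
    exists (Num.trunc (2 / e)).
    by rewrite -[e / 2]invrK invf_div ltf_pV2 ?posrE ?divr_gt0// truncnS_gt.
  have [k' kk] : exists k' : nat, `|k| < k'.+1%:R.
    by exists (Num.trunc `|k|); exact: truncnS_gt.
  have i0 : 0 < i.+1%:R^-1 :> R by rewrite invr_gt0.
  have /rat_in_itvoo[q] : p - i.+1%:R^-1 < p + i.+1%:R^-1 by rewrite ltrD2l gtrN.
  rewrite in_itv/= => /andP[q1 q2].
  have [j jE] : exists j : nat, unpickle j = Some (q, i, k').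
    by exists (pickle (q, i, k')); rewrite pickleK.
  have [r rE] : exists r : R, r = i.+1%:R^-1 by exists (i.+1%:R^-1).
  rewrite -rE in ie i0 q1 q2.
  exists j => //; rewrite jE; split => //; split; last first.
    by rewrite /ball /= -rE ltr_norml; apply/andP; split; lra.
  move=> a b /=; rewrite -rE => aq bq; apply: (le_trans (H a b _ _)).
  - by move: aq; rewrite !ltr_norml => /andP[? ?]; apply/andP; split; lra.
  - by move: bq; rewrite !ltr_norml => /andP[? ?]; apply/andP; split; lra.
  - by rewrite ler_wpM2r//; apply: (le_trans (ler_norm _)); exact: ltW.
suff : leb.-negligible (f @^-1` N) by move/negligibleP; exact.
apply: (@negligibleS _ _ _ leb _ _ sub); apply: negligibleU.
  apply/negligibleP; first by apply: countable_measurable => //; exact: finite_set_countable.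
  by apply: countable_lebesgue_measure0; exact: finite_set_countable.
by apply: negligible_bigcup => j; case: unpickle => [t|]; [exact: B0|exact: negligible_set0].
Qed.

(** The difference quotient between [a] and [b] is [(q0 - q2 * (a * b)) / (Q a * Q b)]. It is
    bounded away from 0 near a diagonal point unless [q0 = q2 * s ^+ 2], which happens for at most
    two [s]. *)
Lemma quotient_preimage_null (q0 q1 q2 : R) N : 0 < q0 ->
  (forall s, 0 < q0 + q1 * s + q2 * s ^+ 2) -> measurable N -> leb N = 0%E ->
  leb ((fun s => s / (q0 + q1 * s + q2 * s ^+ 2)) @^-1` N) = 0%E.
Proof.
move=> q00 Q0 mN N0; set Q := fun s => q0 + q1 * s + q2 * s ^+ 2.
have mQ : measurable_fun setT Q.
  apply: measurable_funD; first apply: measurable_funD => //.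
  exact: measurable_funM.
have cQ : continuous Q.
  move=> x; apply: cvgD; first apply: cvgD; try exact: cvg_cst.
    by apply: cvgM; [exact: cvg_cst|exact: cvg_id].
  by apply: cvgM; [exact: cvg_cst|exact: exprn_continuous].
pose Z : set R := [set s | q0 - q2 * s ^+ 2 = 0].
apply: (@locally_inverse_lipschitz_null Z) => //.
- apply: (@sub_finite_set _ _ [set Num.sqrt (q0 / q2); - Num.sqrt (q0 / q2)]); last exact: finite_set2.
  move=> s /eqP; rewrite subr_eq0 => /eqP E.
  have q20 : q2 != 0 by apply: contraTneq q00 => q20; rewrite E q20 mul0r ltxx.
  have -> : q0 / q2 = s ^+ 2 by rewrite E mulrAC divff// mul1r.
  rewrite sqrtr_sqr /=; have [s0|s0] := leP 0 s; first by left; rewrite ger0_norm.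
  by right; rewrite ltr0_norm// opprK.
- by apply: measurable_funM => //; exact: (measurableT_comp (@measurable_inv R)).
- move=> p Zp.
  have cp : (q0 - q2 * (ab.1 * ab.2)) / (Q ab.1 * Q ab.2) @[ab --> (p, p)] -->
      (q0 - q2 * (p * p)) / (Q p * Q p).
    apply: cvgM.
      apply: cvgB; first exact: cvg_cst.
      by apply: cvgM; [exact: cvg_cst|apply: cvgM; [exact: cvg_fst|exact: cvg_snd]].
    apply: cvgV; first by rewrite mulf_neq0// gt_eqF// Q0.
    by apply: cvgM; [exact: (cvg_comp fst Q cvg_fst (cQ p))|exact: (cvg_comp snd Q cvg_snd (cQ p))].
  set c := (q0 - q2 * (p * p)) / (Q p * Q p) in cp.
  have c0 : 0 < `|c|.
    have Qp : Q p != 0 by rewrite gt_eqF// Q0.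
    by rewrite normr_gt0 mulf_neq0 ?invr_eq0 ?mulf_neq0//; apply/eqP.
  clearbody c.
  have : \forall ab \near (p, p), `|c| / 2 <= `|(q0 - q2 * (ab.1 * ab.2)) / (Q ab.1 * Q ab.2)|.
    have {}cp := cvg_norm (FF := nbhs_filter (p, p)) cp.
    near=> ab; near: ab; by apply: (cvgr_ge _ cp); rewrite ltr_pdivrMr// ltr_pMr// ltr1n.
  move=> /nbhs_ballP[e /= e0 H].
  exists (`|c| / 2)^-1, e; split => // a b ap bp.
  have Qa := Q0 a; have Qb := Q0 b.
  have -> : a / Q a - b / Q b = (a - b) * ((q0 - q2 * (a * b)) / (Q a * Q b)).
    by rewrite /Q; field; rewrite !gt_eqF.
  rewrite ler_pdivlMl ?divr_gt0// normrM mulrC; apply: ler_wpM2l => //.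
  by apply: (H (a, b)); split; rewrite /ball /= distrC.
Unshelve. all: end_near. Qed.

End bilipschitz_null.

(** * Null sets in the plane and in C^n *)

Section planar_null.
Context (R : realType).
Local Notation leb := (@lebesgue_measure R).
Local Notation leb2 := (@lebesgue2 R).
Local Open Scope ereal_scope.

Let measurable_section (G : plane R -> \bar R) (x : R) : measurable_fun setT G ->
  measurable_fun setT (fun y : R => G (x, y)).
Proof. by move=> mG; exact: measurableT_comp. Qed.

Definition affine2 (a b c d e f : R) (z : plane R) : plane R :=
  (a * z.1 + b * z.2 + e, c * z.1 + d * z.2 + f)%R.

Lemma measurable_affine2 a b c d e f : measurable_fun setT (affine2 a b c d e f).
Proof.
have m1 : measurable_fun setT (fun z : plane R => z.1) by exact: measurable_fst.
have m2 : measurable_fun setT (fun z : plane R => z.2) by exact: measurable_snd.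
by apply: measurable_fun_pair; apply: measurable_funD => //;
  apply: measurable_funD; apply: measurable_funM.
Qed.

Let integral_affine2_d (a b c d e f : R) (G : plane R -> \bar R) :
  d != 0%R -> (a * d - b * c != 0)%R -> measurable_fun setT G -> (forall z, 0 <= G z) ->
  \int[leb2]_z G z = (`|a * d - b * c|)%:E * \int[leb2]_z G (affine2 a b c d e f z).
Proof.
move=> d0 D0 mG G0.
(* These express the first coordinate through [x] and the new second coordinate [c x + d y + f], so
   that [y] and then [x] are changed by one-dimensional maps. *)
pose a' := (a - b * c / d)%R; pose b' := (b / d)%R; pose e' := (e - b * f / d)%R.
have a'0 : a' != 0%R.
  apply: contra D0 => /eqP E.
  have -> : (a * d - b * c = d * a')%R by rewrite /a'; field.
  by rewrite E mulr0.
have mGa := measurableT_comp mG (measurable_affine2 a b c d e f).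
rewrite [in RHS]integral_lebesgue2//.
pose K (z : plane R) := G (a' * z.1 + (b' * z.2 + e'), z.2)%R.
have mK : measurable_fun setT K.
  rewrite (_ : K = G \o affine2 a' b' 0 1 e' 0).
    exact: (measurableT_comp mG (measurable_affine2 _ _ _ _ _ _)).
  by apply/funext => -[x y]; rewrite /K /affine2 /= mul0r mul1r add0r !addr0 addrA.
have K0 z : 0 <= K z by exact: G0.
have E1 x : \int[leb]_y G (affine2 a b c d e f (x, y)) = `|d^-1|%:E * \int[leb]_y K (x, y).
  rewrite (@ge0_integral_affine R d (c * x + f) (fun y => K (x, y))); [|by []|exact: measurable_section|by move=> y; exact: G0].
  rewrite muleA -EFinM -normrM mulVf// normr1 mul1e; apply: eq_integral => y _.
  by rewrite /K /affine2 /affine /=; congr (G (_, _)); rewrite /a' /b' /e'; [field|ring].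
under [in RHS]eq_integral do rewrite E1.
rewrite ge0_integralZl//; last 2 first.
- exact: (measurable_fun_fubini_tonelli_F (m2 := leb) K).
- by move=> x _; exact: integral_ge0.
rewrite -(integral_lebesgue2 mK K0) (integral_lebesgue2_swap mK K0).
have E2 y : \int[leb]_x K (x, y) = `|a'^-1|%:E * \int[leb]_x G (x, y).
  rewrite (@ge0_integral_affine R a' (b' * y + e') (fun x => G (x, y)))//; last first.
    exact: measurableT_comp.
  by rewrite muleA -EFinM -normrM mulVf// normr1 mul1e.
under [in RHS]eq_integral do rewrite E2.
rewrite ge0_integralZl//; last 2 first.
- exact: (measurable_fun_fubini_tonelli_G (m1 := leb) G).
- by move=> x _; exact: integral_ge0.
rewrite -(integral_lebesgue2_swap mG G0) !muleA -!EFinM -!normrM.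
rewrite (_ : _ * _ * _ = 1)%R ?normr1 ?mul1e//.
by rewrite /a'; field; rewrite d0 D0.
Qed.

(** When [d = 0], exchanging the two variables puts [c], then nonzero, in the place of [d]. *)
Lemma integral_affine2 (a b c d e f : R) (G : plane R -> \bar R) :
  (a * d - b * c != 0)%R -> measurable_fun setT G -> (forall z, 0 <= G z) ->
  \int[leb2]_z G z = (`|a * d - b * c|)%:E * \int[leb2]_z G (affine2 a b c d e f z).
Proof.
move=> D0 mG G0; have [d0|d0] := eqVneq d 0%R; last exact: integral_affine2_d.
have c0 : c != 0%R by apply: contra D0 => /eqP ->; rewrite d0 !mulr0 subrr.
rewrite (@integral_affine2_d b a d c e f)//; last by rewrite -oppr_eq0 opprB.
have mGa := measurableT_comp mG (measurable_affine2 a b c d e f).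
have mGb := measurableT_comp mG (measurable_affine2 b a d c e f).
rewrite distrC; congr (_ * _).
rewrite (integral_lebesgue2 mGb (fun z => G0 _)) (integral_lebesgue2_swap mGa (fun z => G0 _)).
by apply: eq_integral => x _; apply: eq_integral => y _; rewrite /affine2 /=; congr (G (_, _)); ring.
Qed.

(* [t = y / x] *)
Lemma integral_slope (G : plane R -> \bar R) :
  measurable_fun setT G -> (forall z, 0 <= G z) ->
  \int[leb2]_z G z = \int[leb]_t \int[leb]_s (`|s|%:E * G (s, s * t)%R).
Proof.
move=> mG G0.
pose K (z : plane R) := `|z.1|%:E * G (z.1, z.1 * z.2)%R.
have mK : measurable_fun setT K.
  apply: emeasurable_funM; first by apply/measurable_EFinP; apply: measurableT_comp.
  by apply: (measurableT_comp mG); apply: measurable_fun_pair => //; exact: measurable_funM.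
have K0 z : 0 <= K z by rewrite mule_ge0.
rewrite -(integral_lebesgue2_swap mK K0) (integral_lebesgue2 mK K0) (integral_lebesgue2 mG G0).
apply: ge0_ae_eq_integral => //.
- exact: (measurable_fun_fubini_tonelli_F (m2 := leb) G).
- exact: (measurable_fun_fubini_tonelli_F (m2 := leb) K).
- by move=> x _; exact: integral_ge0.
- by move=> x _; exact: integral_ge0.
exists [set 0%R]; split => //; first exact: lebesgue_measure_set1.
move=> x /=; apply: contra_notP => /eqP x0 _.
rewrite (@ge0_integral_affine R x 0%R (fun y => G (x, y)))//; last exact: measurableT_comp.
rewrite -ge0_integralZl//; last by apply: (measurableT_comp mG); exact: measurable_fun_pair.
by apply: eq_integral => t _; rewrite /K /affine /= addr0.
Qed.

(** The map preserves every line through the origin and acts on it as in [quotient_preimage_null].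
    By [integral_slope], a null set meets almost every such line in a null set, and conversely. *)
Lemma quotient_plane_null (N : set (plane R)) (q : plane R -> R) (q0 q1 q2 q11 q12 q22 : R) :
  (forall z, q z = q0 + q1 * z.1 + q2 * z.2 + q11 * z.1 ^+ 2 + q12 * (z.1 * z.2) + q22 * z.2 ^+ 2)%R ->
  (forall z, 0 < q z)%R -> measurable N -> leb2 N = 0 ->
  leb2 ((fun z : plane R => (z.1 / q z, z.2 / q z)%R : plane R) @^-1` N) = 0.
Proof.
move=> qE qp mN N0.
have m1 : measurable_fun setT (fun z : plane R => z.1) by exact: measurable_fst.
have m2 : measurable_fun setT (fun z : plane R => z.2) by exact: measurable_snd.
have mq : measurable_fun setT q.
  have -> : q = (fun z => q0 + q1 * z.1 + q2 * z.2 + q11 * z.1 ^+ 2 + q12 * (z.1 * z.2) + q22 * z.2 ^+ 2)%R.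
    by apply/funext.
  do ![apply: measurable_funD => //]; apply: measurable_funM => //; try exact: measurable_funX.
  exact: measurable_funM.
have mqi : measurable_fun setT (fun z => (q z)^-1%R).
  exact: (measurableT_comp (@measurable_inv R)).
have mF : measurable_fun setT (fun z : plane R => (z.1 / q z, z.2 / q z)%R : plane R).
  by apply: measurable_fun_pair; exact: measurable_funM.
have mP : measurable ((fun z : plane R => (z.1 / q z, z.2 / q z)%R) @^-1` N).
  by rewrite -[X in measurable X]setTI; exact: mF.
have iE (M : set (plane R)) : measurable M -> leb2 M = \int[leb2]_z (\1_M z)%:E.
  by move=> mM; rewrite integral_indic// setIT.
have mi (M : set (plane R)) : measurable M -> measurable_fun setT (fun z => (\1_M z)%:E : \bar R).
  by move=> mM; exact/measurable_EFinP.
have i0 (M : set (plane R)) z : 0 <= (\1_M z)%:E :> \bar R by rewrite lee_fin.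
have := N0; rewrite (iE _ mN) (integral_slope (mi _ mN) (i0 N)) => IN0.
rewrite (iE _ mP) (integral_slope (mi _ mP) (i0 _)).
have mS : measurable_fun setT (fun z : plane R => (z.1, z.1 * z.2)%R : plane R).
  by apply: measurable_fun_pair => //; exact: measurable_funM.
have mN1 : measurable_fun setT (fun z : plane R => `|z.1|%:E * (\1_N (z.1, z.1 * z.2)%R)%:E).
  apply: emeasurable_funM; first by apply/measurable_EFinP; exact: measurableT_comp.
  exact: (measurableT_comp (mi _ mN) mS).
have mIN : measurable_fun setT (fun t => \int[leb]_s (`|s|%:E * (\1_N (s, s * t)%R)%:E)).
  apply: (measurable_fun_fubini_tonelli_G (m1 := leb)
    (fun z : plane R => `|z.1|%:E * (\1_N (z.1, z.1 * z.2)%R)%:E)) => //.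
have p0 t : 0 <= \int[leb]_s (`|s|%:E * (\1_N (s, s * t)%R)%:E).
  by apply: integral_ge0 => s _; rewrite mule_ge0.
have /(ae_eq_integral_abs leb measurableT mIN) AE :
    \int[leb]_t `|\int[leb]_s (`|s|%:E * (\1_N (s, s * t)%R)%:E)| = 0.
  by rewrite -[RHS]IN0; apply: eq_integral => t _; rewrite gee0_abs.
set P := _ @^-1` N in mP *.
have mP1 : measurable_fun setT (fun z : plane R => `|z.1|%:E * (\1_P (z.1, z.1 * z.2)%R)%:E).
  apply: emeasurable_funM; first by apply/measurable_EFinP; exact: measurableT_comp.
  exact: (measurableT_comp (mi _ mP) mS).
have mIP : measurable_fun setT (fun t => \int[leb]_s (`|s|%:E * (\1_P (s, s * t)%R)%:E)).
  apply: (measurable_fun_fubini_tonelli_G (m1 := leb)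
    (fun z : plane R => `|z.1|%:E * (\1_P (z.1, z.1 * z.2)%R)%:E)) => //.
rewrite (ae_eq_integral (cst 0)) ?integral0//.
apply: filterS AE => t /(_ Logic.I) It _ /=.
pose Nt : set R := [set s | N (s, s * t)%R].
have ms : measurable_fun setT (fun s : R => (s, s * t)%R : plane R).
  by apply: measurable_fun_pair => //; exact: measurable_funM.
have mNt : measurable Nt by rewrite -[X in measurable X]setTI; exact: ms.
have ma : measurable_fun setT (fun s : R => `|s|%:E : \bar R).
  by apply/measurable_EFinP; exact: normr_measurable.
have mN2 : measurable_fun setT (fun s : R => `|s|%:E * (\1_N (s, s * t)%R)%:E).
  exact: (emeasurable_funM ma (measurableT_comp (mi _ mN) ms)).
have Nt0 : leb Nt = 0.
  have /(ae_eq_integral_abs leb measurableT mN2) [Z [mZ Z0 NZ]] :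
      \int[leb]_s `| `|s|%:E * (\1_N (s, s * t)%R)%:E| = 0.
    by rewrite -[RHS]It; apply: eq_integral => s _; rewrite gee0_abs// mule_ge0.
  suff : leb.-negligible Nt by move/negligibleP; exact.
  exists (Z `|` [set 0%R]); split; first exact: measurableU.
    by rewrite null_set_setU//; exact: lebesgue_measure_set1.
  (* The weight [|s|] gives no information at [s = 0], a single point added to the null set. *)
  move=> s Ns; have [->|s0] := eqVneq s 0%R; [by right|left].
  apply: NZ => /= /(_ Logic.I) /eqP; rewrite indicE mem_set// mule1 eqe normr_eq0.
  exact/negP.
have Q0 s : (0 < q0 + (q1 + q2 * t) * s + (q11 + q12 * t + q22 * t ^+ 2) * s ^+ 2)%R.
  by have := qp (s, s * t)%R; rewrite qE /=; congr (0 < _)%R; ring.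
have q00 : (0 < q0)%R by have := Q0 0%R; rewrite expr0n !mulr0 !addr0.
have Z0 := quotient_preimage_null q00 Q0 mNt Nt0.
set Z := _ @^-1` Nt in Z0.
have mZ : measurable Z.
  rewrite -[X in measurable X]setTI; apply: (measurable_funM _ _ measurableT mNt) => //.
  apply: (measurableT_comp (@measurable_inv R)).
  apply: measurable_funD; first apply: measurable_funD => //.
  by apply: measurable_funM.
rewrite (ae_eq_integral (cst 0)) ?integral0//.
- exact: (emeasurable_funM ma (measurableT_comp (mi _ mP) ms)).
- exists Z; split => // s /=; apply: contra_notP => Zs _.
  rewrite indicE memNset ?mule0// /P /= => NP; apply: Zs.
  rewrite /Z /Nt /=; move: NP; congr N; rewrite qE /=.
  by congr (_ / _, _)%R; [ring|rewrite mulrAC; congr (_ / _ * _)%R; ring].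
Qed.

(** Tonelli for the indicator of [E] at [t + v s]: integrated over [t] first it gives the measure of
    [E] for every [s], by translation invariance; integrated over [s] first it gives 0. *)
Lemma null_translate n d (S : measurableType d) (m : {sigma_finite_measure set S -> \bar R})
    (v : S -> n.-tuple (plane R)) (E : set (n.-tuple (plane R))) :
  measurable E -> measurable_fun setT v -> m setT != 0 ->
  {ae lebesgueC R n, forall t, m [set s | E (affineC 1 (v s) t)] = 0} ->
  lebesgueC R n E = 0.
Proof.
move=> mE mv m0 AE.
pose a (z : S * n.-tuple (plane R)) : n.-tuple (plane R) := affineC 1 (v z.1) z.2.
have ma : measurable_fun setT a.
  apply/measurable_fun_tnthP => i.
  rewrite (_ : _ \o _ = fun z => (1 * (tnth z.2 i).1 + (tnth (v z.1) i).1,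
    1 * (tnth z.2 i).2 + (tnth (v z.1) i).2)%R); last first.
    by apply/funext => z /=; rewrite tnth_mktuple.
  have m1 : measurable_fun setT (fun z : S * n.-tuple (plane R) => tnth z.2 i).
    exact: (measurableT_comp (measurable_tnth i) measurable_snd).
  have m2 : measurable_fun setT (fun z : S * n.-tuple (plane R) => tnth (v z.1) i).
    exact: (measurableT_comp (measurable_tnth i) (measurableT_comp mv measurable_fst)).
  have m1f := measurableT_comp measurable_fst m1; have m1s := measurableT_comp measurable_snd m1.
  have m2f := measurableT_comp measurable_fst m2; have m2s := measurableT_comp measurable_snd m2.
  by apply: measurable_fun_pair; apply: measurable_funD => //; apply: measurable_funM.
have mi : measurable_fun setT (fun t : n.-tuple (plane R) => (\1_E t)%:E : \bar R).
  exact/measurable_EFinP.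
pose f z : \bar R := (\1_E (a z))%:E.
have mf : measurable_fun setT f by exact: (measurableT_comp mi ma).
have f0 z : 0 <= f z by rewrite lee_fin.
have F := @fubini_tonelli _ _ _ _ _ m (lebesgueC R n) f mf f0.
have E1 s : \int[lebesgueC R n]_t f (s, t) = lebesgueC R n E.
  have -> : lebesgueC R n E = \int[lebesgueC R n]_t (\1_E t)%:E.
    by rewrite integral_indic// setIT.
  rewrite [RHS](@ge0_integral_affineC R n 1 (v s) (fun t => (\1_E t)%:E))//.
  by rewrite expr1n mul1e.
have E2 : \int[lebesgueC R n]_t (\int[m]_s f (s, t)) = 0.
  rewrite (ae_eq_integral (cst 0)) ?integral0//.
    exact: (measurable_fun_fubini_tonelli_G (m1 := m) f).
  apply: filterS AE => t Et _ /=; rewrite -[RHS]Et.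
  have -> : m [set s | E (affineC 1 (v s) t)] = \int[m]_s (\1_[set s | E (affineC 1 (v s) t)] s)%:E.
    rewrite integral_indic ?setIT//.
    have := measurableT_comp ma (pair2_measurable t) measurableT mE; by rewrite setTI.
  by apply: eq_integral => s _; rewrite /f !indicE.
move: F; rewrite E2; under eq_integral do rewrite E1.
by rewrite integral_cst// => /eqP; rewrite mule_eq0 (negPf m0) orbF => /eqP.
Qed.

End planar_null.

(** * Absolute continuity of the numerical measure *)

Section numerical_range_line.
Context (R : realType).
Local Notation C := R[i].
Local Open Scope sesquilinear_scope.
Variable n : nat.
Implicit Types (x y w : 'cV[C]_n) (A B M N : 'M[C]_n).

Lemma innerDl x x' y : inner (x + x') y = inner x y + inner x' y.
Proof. by rewrite /inner mulmxDr mxE. Qed.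

Lemma innerZl (a : C) x y : inner (a *: x) y = a * inner x y.
Proof. by rewrite /inner -scalemxAr mxE. Qed.

Lemma innerDr x y y' : inner x (y + y') = inner x y + inner x y'.
Proof. by rewrite /inner linearD /= map_mxD mulmxDl mxE. Qed.

Lemma innerZr (a : C) x y : inner x (a *: y) = a^* * inner x y.
Proof. by rewrite /inner linearZ /= map_mxZ -scalemxAl mxE. Qed.

Lemma inner_adj M x y : inner (M *m x) y = inner x (M ^t* *m y).
Proof. by rewrite /inner trmx_mul map_mxM /= trmxCK mulmxA. Qed.

Lemma inner_delta x k : inner x (delta_mx k 0) = x k 0.
Proof.
rewrite /inner mxE (bigD1 k)//= !mxE !eqxx rmorph1 mul1r big1 ?addr0// => j jk.
by rewrite !mxE (negPf jk) /= rmorph0 mul0r.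
Qed.

Lemma inner_self x : inner x x = \sum_k `|x k 0| ^+ 2.
Proof. by rewrite /inner mxE; apply: eq_bigr => k _; rewrite !mxE normCK mulrC. Qed.

(** Polarization: the pairs [(x, y)] and [('i x, y)] separate [inner (N *m x) y] from
    [inner (N *m y) x]. *)
Lemma inner_polar N : (forall x, inner (N *m x) x = 0) -> N = 0.
Proof.
move=> N0.
have P x y : inner (N *m x) y + inner (N *m y) x = 0.
  have := N0 (x + y); rewrite mulmxDr innerDl !innerDr !N0 add0r addr0.
  by rewrite addrC => <-.
have E x y : inner (N *m x) y = 0.
  have H1 := P x y; have := P ('i *: x) y.
  rewrite -scalemxAr innerZl innerZr conjCi => H2.
  have : 'i * (inner (N *m x) y + inner (N *m y) x) + ('i * inner (N *m x) y + - 'i * inner (N *m y) x) = 0.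
    by rewrite H1 H2 mulr0 addr0.
  rewrite (_ : _ + _ = 2 * 'i * inner (N *m x) y); last by ring.
  by move=> /eqP; rewrite mulf_eq0 mulf_eq0 pnatr_eq0 (negPf (neq0Ci _)) /= => /eqP.
apply/matrixP => i j; rewrite [RHS]mxE.
have := E (delta_mx j 0) (delta_mx i 0); rewrite inner_delta mxE (bigD1 j)//= mxE !eqxx mulr1.
by rewrite big1 ?addr0// => k kj; rewrite mxE (negPf kj) mulr0.
Qed.

(** Subtracting the Rayleigh quotient at [w] makes the form vanish at [w], so that along [y + z w]
    it has no term in [|z|^2]. *)
Definition centered A w : 'M[C]_n := A - (inner (A *m w) w / inner w w)%:M.

(** Failure of the argument on complex lines in every direction: for [B = centered A w] the real
    linear part of the form at [y + z w] has determinant [|inner (B *m w) y|^2 - |inner (B *m y)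
    w|^2]. *)
Definition degenerate A := forall w, w != 0 -> forall y,
  `|inner (centered A w *m y) w| = `|inner (centered A w *m w) y|.

(** Taking basis vectors for [y] shows that the centered matrix and its adjoint map [w] to vectors
    of equal norm. The commutator with the adjoint does not see the scalar shift, so its form
    vanishes at every [w], and [inner_polar] concludes. *)
Lemma degenerate_normal A : degenerate A -> A \is normalmx.
Proof.
move=> dA; apply/normalmxP.
suff : A ^t* *m A - A *m A ^t* = 0 by move=> /eqP; rewrite subr_eq0 => /eqP.
apply: inner_polar => w; have [->|w0] := eqVneq w 0.
  by rewrite mulmx0 /inner mulmx0 mxE.
pose a := inner (A *m w) w / inner w w; set B := centered A w.
have -> : A ^t* *m A - A *m A ^t* = B ^t* *m B - B *m B ^t*.
  have -> : B ^t* = A ^t* - (a^*)%:M.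
    by rewrite /B /centered linearB /= map_mxB tr_scalar_mx map_scalar_mx.
  rewrite /B /centered -/a !(mulmxBl, mulmxBr) !(mul_scalar_mx, mul_mx_scalar).
  rewrite !scale_scalar_mx [_ * a]mulrC.
  move: (A ^t* *m A) (A *m A ^t*) (a *: A ^t*) (a^* *: A) ((a * a^*)%:M) => X Y U V W.
  by apply/matrixP => i j; rewrite !mxE; ring.
have dB := dA w w0; rewrite -/B in dB; clearbody B.
have E1 : inner (B ^t* *m B *m w) w = inner (B *m w) (B *m w).
  by rewrite -mulmxA; apply: (etrans (inner_adj _ _ _)); rewrite trmxCK.
have E2 : inner (B *m B ^t* *m w) w = inner (B ^t* *m w) (B ^t* *m w).
  by rewrite -mulmxA; exact: inner_adj.
rewrite mulmxBl innerDl -scaleN1r innerZl mulN1r E1 E2.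
apply/eqP; rewrite subr_eq0 !inner_self; apply/eqP; apply: eq_bigr => k _.
have := dB (delta_mx k 0); rewrite inner_delta => <-.
by rewrite -[(B ^t* *m w) k 0]inner_delta -inner_conj norm_conjC.
Qed.

Lemma inner_centered A w x y : inner (centered A w *m x) y =
  inner (A *m x) y - inner (A *m w) w / inner w w * inner x y.
Proof.
by rewrite /centered mulmxBl mul_scalar_mx innerDl -scaleN1r innerZl innerZl mulN1r.
Qed.

Lemma inner_unitary (U : 'M[C]_n) x y : U \is unitarymx -> inner (U ^t* *m x) (U ^t* *m y) = inner x y.
Proof.
by move=> /unitarymxP UU; rewrite inner_adj trmxCK mulmxA UU mul1mx.
Qed.

Lemma degenerate_unitary A (D U : 'M[C]_n) : U \is unitarymx -> A = U ^t* *m D *m U ->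
  degenerate A -> degenerate D.
Proof.
move=> UU AE dA w w0 y; have /unitarymxP UV := UU.
have E x z : inner (A *m (U ^t* *m x)) (U ^t* *m z) = inner (D *m x) z.
  by rewrite AE -!mulmxA [U *m (_ *m _)]mulmxA UV mul1mx inner_unitary.
have w'0 : U ^t* *m w != 0.
  apply: contra w0 => /eqP w0; rewrite -[w]mul1mx -UV -mulmxA w0.
  by rewrite mulmx0.
have F x z : inner (centered A (U ^t* *m w) *m (U ^t* *m x)) (U ^t* *m z) = inner (centered D w *m x) z.
  rewrite (inner_centered A) (inner_centered D) !E.
  by rewrite (inner_unitary w w UU) (inner_unitary x z UU).
by rewrite -(F y w) -(F w y); exact: dA.
Qed.

Lemma inner_diag (D : 'rV[C]_n) x y :
  inner (diag_mx D *m x) y = \sum_k D 0 k * (x k 0 * (y k 0)^*).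
Proof.
rewrite /inner mxE; apply: eq_bigr => k _.
by rewrite mul_diag_mx !mxE mulrC mulrA.
Qed.

Lemma delta_sum3 (f : 'I_n -> C) i j k : uniq [:: i; j; k] ->
  (forall l, l \notin [:: i; j; k] -> f l = 0) -> \sum_l f l = f i + f j + f k.
Proof.
move=> u f0; rewrite (bigID (mem [:: i; j; k])) /= [X in _ + X]big1 ?addr0; last first.
  by move=> l /f0.
by rewrite -big_uniq//= !big_cons big_nil addr0 addrA.
Qed.

Let conjD (a b : C) : (a + b)^* = a^* + b^*. Proof. exact: rmorphD. Qed.
Let conjB (a b : C) : (a - b)^* = a^* - b^*. Proof. exact: rmorphB. Qed.
Let conjM (a b : C) : (a * b)^* = a^* * b^*. Proof. exact: rmorphM. Qed.

(** The conclusion says that [p] and [q] lie on one real line through 0. The squared moduli differ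
    by [2 * 'i] times the difference of its two sides. *)
Lemma norm_rotE (p q : C) : `|p + 'i * q| = `|p - 'i * q| -> p * q^* = p^* * q.
Proof.
move=> /(congr1 (fun r => r ^+ 2)); rewrite !normCK.
have -> : (p + 'i * q)^* = p^* - 'i * q^* by rewrite conjD conjM conjCi mulNr.
have -> : (p - 'i * q)^* = p^* + 'i * q^* by rewrite conjB conjM conjCi mulNr opprK.
move=> H.
have : (2 * 'i) * (p * q^* - p^* * q) = 0.
  transitivity ((p - 'i * q) * (p^* + 'i * q^*) - (p + 'i * q) * (p^* - 'i * q^*)); first by ring.
  by rewrite H subrr.
move=> /eqP; rewrite !mulf_eq0 pnatr_eq0 (negPf (neq0Ci _)) /= subr_eq0.
by move=> /eqP.
Qed.

(** Degeneracy is tested on [w = e_i + e_j + e_k] and [y = e_i + 'i e_j]; after centering at the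
    mean of the three eigenvalues it becomes the hypothesis of [norm_rotE]. *)
Lemma degenerate_collinear (D : 'rV[C]_n) i j k : degenerate (diag_mx D) ->
  (D 0 i - D 0 k) * (D 0 j - D 0 k)^* = (D 0 i - D 0 k)^* * (D 0 j - D 0 k).
Proof.
move=> dD; have [->|ij] := eqVneq i j; first by rewrite mulrC.
have [->|ik] := eqVneq i k; first by rewrite !subrr rmorph0 !mul0r.
have [->|jk] := eqVneq j k; first by rewrite !subrr rmorph0 !mulr0.
have u : uniq [:: i; j; k] by rewrite /= !inE negb_or ij ik jk.
pose w : 'cV[C]_n := \col_l (l \in [:: i; j; k])%:R.
pose y : 'cV[C]_n := \col_l ((l == i)%:R + 'i * (l == j)%:R).
have wi : w i 0 = 1 by rewrite mxE !inE eqxx.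
have wj : w j 0 = 1 by rewrite mxE !inE eqxx orbT.
have wk : w k 0 = 1 by rewrite mxE !inE eqxx !orbT.
have yi : y i 0 = 1 by rewrite mxE eqxx (negPf ij) mulr0 addr0.
have yj : y j 0 = 'i by rewrite mxE eqxx [j == i]eq_sym (negPf ij) mulr1 add0r.
have yk : y k 0 = 0.
  by rewrite mxE ![k == _]eq_sym (negPf ik) (negPf jk) mulr0 add0r.
have w0 l : l \notin [:: i; j; k] -> w l 0 = 0 by move=> /negPf lw; rewrite mxE lw.
have S (x z : 'cV[C]_n) (E : 'rV[C]_n) : (forall l, l \notin [:: i; j; k] -> x l 0 * (z l 0)^* = 0) ->
    inner (diag_mx E *m x) z = E 0 i * (x i 0 * (z i 0)^*) + E 0 j * (x j 0 * (z j 0)^*) + E 0 k * (x k 0 * (z k 0)^*).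
  by move=> xz; rewrite inner_diag (delta_sum3 u)// => l /xz ->; rewrite mulr0.
have w0l z l : l \notin [:: i; j; k] -> w l 0 * ((z : 'cV[C]_n) l 0)^* = 0 by move=> /w0 ->; rewrite mul0r.
have w0r z l : l \notin [:: i; j; k] -> (z : 'cV[C]_n) l 0 * (w l 0)^* = 0.
  by move=> /w0 ->; rewrite rmorph0 mulr0.
have I1 x : x = diag_mx (const_mx 1) *m x :> 'cV[C]_n.
  by rewrite diag_const_mx mul1mx.
have S1 (x z : 'cV[C]_n) : (forall l, l \notin [:: i; j; k] -> x l 0 * (z l 0)^* = 0) ->
    inner x z = x i 0 * (z i 0)^* + x j 0 * (z j 0)^* + x k 0 * (z k 0)^*.
  by move=> xz; rewrite {1}(I1 x) S// !mxE !mul1r.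
have wn0 : w != 0 by apply/eqP => /matrixP /(_ i 0); rewrite wi mxE => /eqP; rewrite oner_eq0.
have := dD w wn0 y; rewrite !inner_centered.
rewrite !(S w _ D (w0l _)) (S y w D (w0r y)) !(S1 w _ (w0l _)) (S1 y w (w0r y)) wi wj wk yi yj yk.
rewrite !(rmorph1, rmorph0, conjCi, mulr1, mulr0, mul1r, mul0r, addr0).
set a := _ / _ => H.
have {}H : `|(D 0 i - a) + 'i * (D 0 j - a)| = `|(D 0 i - a) - 'i * (D 0 j - a)|.
  rewrite (_ : _ + _ = D 0 i + D 0 j * 'i - a * (1 + 'i)); last by ring.
  by rewrite H; congr (`| _ |); ring.
have := norm_rotE H; set p := D 0 i - a; set q := D 0 j - a => pq.
(* [a] is the mean of the three eigenvalues, so the centered ones sum to 0 and the third lies on the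
   line of the other two. *)
have a3 : D 0 k - a = - (p + q).
  have t3 : 1 + 1 + 1 = 3%:R :> C by ring.
  by rewrite /p /q /a t3; field.
have -> : D 0 i - D 0 k = p - (D 0 k - a) by rewrite /p; ring.
have -> : D 0 j - D 0 k = q - (D 0 k - a) by rewrite /q; ring.
rewrite a3 !opprK; clearbody p q; rewrite !conjD.
move: pq; move: (p^*) (q^*) => p' q' pq.
apply/eqP; rewrite -subr_eq0; apply/eqP.
have : 3 * (p * q' - p' * q) = 0 by rewrite pq subrr mulr0.
by move=> <-; ring.
Qed.

Lemma normal_diagonalizable A : A \is normalmx ->
  exists (U : 'M[C]_n) (D : 'rV[C]_n), U \is unitarymx /\ A = U ^t* *m diag_mx D *m U.
Proof.
move=> /orthomx_spectralP AE; have UU := spectral_unitarymx A.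
by exists (spectralmx A), (spectral_diag A); rewrite -(invmx_unitary UU).
Qed.

Lemma unitary_adjK (U : 'M[C]_n) : U \is unitarymx -> U ^t* *m U = 1%:M.
Proof. by move=> UU; rewrite -invmx_unitary// mulVmx// unitarymx_unit. Qed.

(** A normal matrix with collinear eigenvalues has its numerical range on their line, written as
    [2 Re (u z) = c]. *)
Lemma degenerate_line A : degenerate A -> exists u c : C, u != 0 /\
  forall x, u * inner (A *m x) x + (u * inner (A *m x) x)^* = c * inner x x.
Proof.
move=> dA; have [U [D [UU AE]]] := normal_diagonalizable (degenerate_normal dA).
have dD := degenerate_unitary UU AE dA.
have [u [c [u0 uc]]] : exists u c : C, u != 0 /\ forall j, u * D 0 j + (u * D 0 j)^* = c.
  have [[i [k ik]]|nik] := pselect (exists i k, D 0 i != D 0 k).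
    (* Multiplication by this [u] turns the direction [D 0 i - D 0 k] of the line into an imaginary
       one, so [Re (u z)] is constant along the line. *)
    exists ('i * (D 0 i - D 0 k)^*), ('i * ((D 0 i - D 0 k)^* * D 0 k - (D 0 i - D 0 k) * (D 0 k)^*)).
    split; first by rewrite mulf_neq0 ?neq0Ci// conjC_eq0 subr_eq0.
    move=> j; have := degenerate_collinear i j k dD.
    move=> H; have : (D 0 i - D 0 k)^* * (D 0 j - D 0 k) - (D 0 i - D 0 k) * (D 0 j - D 0 k)^* = 0.
      by rewrite H subrr.
    rewrite !conjM conjCi conjCK !conjB => H2.
    apply/eqP; rewrite -subr_eq0; apply/eqP; rewrite -[RHS](mulr0 'i) -[in RHS]H2.
    by ring.
  have [i|n0] := pickP 'I_n.
    exists 1, (D 0 i + (D 0 i)^*); split; first exact: oner_neq0.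
    move=> j; rewrite !mul1r; suff -> : D 0 i = D 0 j by [].
    by apply/eqP; apply: contra_notT nik => ij; exists i, j.
  by exists 1, 0; split; [exact: oner_neq0|move=> j; have := n0 j].
exists u, c; split => // x.
have xE : x = U ^t* *m (U *m x).
  by rewrite mulmxA unitary_adjK// mul1mx.
have -> : inner (A *m x) x = inner (diag_mx D *m (U *m x)) (U *m x).
  have E1 := inner_unitary (diag_mx D *m (U *m x)) (U *m x) UU.
  have Ax : A *m x = U ^t* *m (diag_mx D *m (U *m x)) by rewrite AE !mulmxA.
  by rewrite Ax {2}xE; exact: E1.
have -> : inner x x = inner (U *m x) (U *m x).
  by have E1 := inner_unitary (U *m x) (U *m x) UU; rewrite -E1 -xE.
rewrite inner_diag inner_self.
rewrite mulr_sumr rmorph_sum -big_split mulr_sumr /=; apply: eq_bigr => k _.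
by rewrite -(uc k) normCK !rmorphM /= conjCK; ring.
Qed.

Lemma norm2_inner x : norm2 x = 1 -> inner x x = 1.
Proof.
rewrite /norm2 => x1.
have i0 : 0 <= inner x x by rewrite inner_self; apply: sumr_ge0 => k _; rewrite exprn_ge0.
have iE : inner x x = (complex.Re (inner x x))%:C%C.
  by apply: complex_ext => //=; have := i0; rewrite lecE /= => /andP[/eqP].
have r0 : 0 <= complex.Re (inner x x) by have := i0; rewrite lecE /= => /andP[].
by rewrite iE -(sqr_sqrtr r0) x1 expr1n.
Qed.

(** An interior point and its displacements by [e / 2] along the two axes already force [u = 0]. *)
Lemma line_no_interior A (u c : C) : u != 0 ->
  (forall x, u * inner (A *m x) x + (u * inner (A *m x) x)^* = c * inner x x) ->
  ~ ((@to_plane R @` numerical_range A)° !=set0).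
Proof.
move=> u0 uA [p]; rewrite /interior /= => /nbhs_ballP[e /= e0 pe].
have line z : ball p e z -> 2 * (complex.Re u * z.1 - complex.Im u * z.2) = complex.Re c.
  move=> /pe [v [x /= x1 <-] <-]; have := uA x; rewrite (norm2_inner x1) mulr1 => <-.
  by rewrite /to_plane /=; case: u {u0 uA} => a b; case: (inner _ _) => a' b' /=; ring.
have e2 : 0 < e / 2 by rewrite divr_gt0.
have H0 := line p (ballxx _ e0).
have b d1 d2 : `|d1| <= e / 2 -> `|d2| <= e / 2 -> ball p e (p.1 + d1, p.2 + d2).
  move=> h1 h2; split; rewrite /ball /= opprD addrA subrr sub0r normrN.
    by apply: (le_lt_trans h1); lra.
  by apply: (le_lt_trans h2); lra.
have n2 : `|e / 2| <= e / 2 by rewrite ger0_norm// ltW.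
have n0 : `|0 : R| <= e / 2 by rewrite normr0 ltW.
have H1 := line _ (b _ _ n2 n0); have H2 := line _ (b _ _ n0 n2).
rewrite /= addr0 in H1; rewrite /= addr0 in H2.
move: H0 H1 H2 => /=; rewrite !mulrDr => H0 H1 H2.
have ue1 : complex.Re u * (e / 2) = 0 by lra.
have ue2 : complex.Im u * (e / 2) = 0 by lra.
move: u0; rewrite (_ : u = 0) ?eqxx//; apply: complex_ext => /=.
  by move/eqP: ue1; rewrite mulf_eq0 (gt_eqF e2) orbF => /eqP.
by move/eqP: ue2; rewrite mulf_eq0 (gt_eqF e2) orbF => /eqP.
Qed.

Lemma hermitian_hermitian_part A theta : (hermitian_part A theta) ^t* = hermitian_part A theta.
Proof.
rewrite /hermitian_part linearZ /= map_mxZ linearD /= map_mxD !linearZ /= !map_mxZ trmxCK.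
rewrite rmorphV ?unitfE ?pnatr_eq0//= rmorph_nat [in LHS]addrC; congr (_ *: (_ *: _ + _ *: _)).
by rewrite conjCE /= opprK.
Qed.

(** If all eigenvalues were equal, diagonalization would make the Hermitian part scalar and confine
    [W(A)] to a line. The two different knots that the B-spline needs come from here. *)
Lemma hermitian_part_nonscalar A theta (l : 'rV[R]_n) :
  (@to_plane R @` numerical_range A)° !=set0 ->
  char_poly (hermitian_part A theta) = \prod_(j < n) ('X - ((l 0 j)%:C)%C%:P) ->
  exists i j, l 0 i != l 0 j.
Proof.
move=> hW lE; apply: contrapT => nl.
have HH := hermitian_hermitian_part A theta; set H := hermitian_part A theta in HH lE.
have [U [D [UU HE]]] : exists (U : 'M[C]_n) (D : 'rV[C]_n), U \is unitarymx /\ H = U ^t* *m diag_mx D *m U.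
  by apply: normal_diagonalizable; apply/normalmxP; rewrite HH.
have VU := unitary_adjK UU.
have [c cE] : exists c : R, forall j, l 0 j = c.
  have [i|n0] := pickP 'I_n; last by exists 0 => j; have := n0 j.
  by exists (l 0 i) => j; apply/eqP; apply: contra_notT nl => ij; exists j, i.
have cD : char_poly H = char_poly (diag_mx D).
  rewrite /char_poly.
  have -> : char_poly_mx H = map_mx polyC (U ^t*) *m char_poly_mx (diag_mx D) *m map_mx polyC U.
    rewrite /char_poly_mx mulmxBr mulmxBl -!map_mxM -HE mul_mx_scalar -scalemxAl -map_mxM VU.
    by rewrite map_mx1 scalemx1.
  rewrite !det_mulmx mulrAC -det_mulmx -map_mxM VU map_mx1 det1 mul1r//.
have DE k : D 0 k = c%:C%C.
  have : root (char_poly (diag_mx D)) (D 0 k).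
    rewrite char_poly_trig ?diag_mx_is_trig//; apply/rootP.
    by rewrite horner_prod (bigD1 k)//= !hornerE mxE eqxx mulr1n subrr mul0r.
  rewrite -cD lE => /rootP; rewrite horner_prod => /eqP.
  rewrite prodf_seq_eq0 => /hasP[j _ /=]; rewrite cE !hornerE subr_eq0 => /eqP //.
have Hx x : inner (H *m x) x = c%:C%C * inner x x.
  have -> : H = c%:C%C%:M; last by rewrite mul_scalar_mx innerZl.
  rewrite HE; have -> : diag_mx D = c%:C%C%:M.
    by rewrite -diag_const_mx; congr diag_mx; apply/rowP => k; rewrite DE mxE.
  by rewrite mul_mx_scalar -scalemxAl VU scalemx1.
pose u : C := complex.Complex (cos theta) (- sin theta).
apply: (@line_no_interior A u (2 * c%:C%C)) hW.
  apply/eqP => /(congr1 (fun z : C => complex.Re z ^+ 2 + complex.Im z ^+ 2)) /=.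
  by rewrite sqrrN cos2Dsin2 expr0n addr0 => /eqP; rewrite oner_eq0.
move=> x; rewrite -mulrA -Hx /H /hermitian_part -scalemxAl innerZl mulrA divff ?pnatr_eq0// mul1r.
rewrite mulmxDl innerDl -!scalemxAl !innerZl; congr (_ + _).
by rewrite conjM inner_conj; congr (_ * _); rewrite conjCE /= opprK.
Qed.

Lemma exists_nondegenerate A : (@to_plane R @` numerical_range A)° !=set0 ->
  exists w y, w != 0 /\ `|inner (centered A w *m y) w| != `|inner (centered A w *m w) y|.
Proof.
move=> hW; apply: contrapT => nd.
have [|u [c [u0 uc]]] := @degenerate_line A; last exact: line_no_interior u0 uc hW.
move=> w w0 y; apply/eqP; apply: contra_notT nd => wy; by exists w, y.
Qed.

End numerical_range_line.

(** * Rayleigh quotients along complex lines *)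

Section absolute_continuity.
Context (R : realType).
Local Notation C := R[i].
Local Notation leb := (@lebesgue_measure R).
Local Notation leb2 := (@lebesgue2 R).
Local Open Scope sesquilinear_scope.

Lemma affine2_null (a b c d e f : R) (N : set (plane R)) : a * d - b * c != 0 ->
  measurable N -> leb2 N = 0%E -> leb2 (affine2 a b c d e f @^-1` N) = 0%E.
Proof.
move=> D0 mN N0.
have mP : measurable (affine2 a b c d e f @^-1` N).
  by rewrite -[X in measurable X]setTI; exact: measurable_affine2.
have mi : measurable_fun setT (fun z => (\1_N z)%:E : \bar R) by exact/measurable_EFinP.
have i0 (M : set (plane R)) z : (0 <= (\1_M z)%:E :> \bar R)%E by rewrite lee_fin.
have iE (M : set (plane R)) : measurable M -> leb2 M = (\int[leb2]_z (\1_M z)%:E)%E.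
  by move=> mM; rewrite integral_indic// setIT.
have := integral_affine2 e f D0 mi (i0 N); rewrite -(iE _ mN) N0 => H.
rewrite (iE _ mP); move/eqP: H; rewrite eq_sym mule_eq0 => /orP[|/eqP//].
by rewrite eqe normr_eq0 (negPf D0).
Qed.

(** Translating the target and inverting the affine numerator reduces the map to [z / q(z)] with [q]
    quadratic, the case of [quotient_plane_null]. *)
Lemma fractional_null (N : set (plane R)) (m11 m12 e m21 m22 f a1 a2 k0 k1 k2 k3 : R)
    (Q := fun z : plane R => k0 + k1 * z.1 + k2 * z.2 + k3 * (z.1 ^+ 2 + z.2 ^+ 2)) :
  m11 * m22 - m12 * m21 != 0 -> (forall z, 0 < Q z) -> measurable N -> leb2 N = 0%E ->
  leb2 [set z | N (a1 + (m11 * z.1 + m12 * z.2 + e) / Q z, a2 + (m21 * z.1 + m22 * z.2 + f) / Q z)] = 0%E.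
Proof.
move=> D0 Q0 mN N0; set D := m11 * m22 - m12 * m21 in D0.
pose N' := affine2 1 0 0 1 a1 a2 @^-1` N.
have mN' : measurable N'.
  by rewrite -[X in measurable X]setTI; exact: measurable_affine2.
have N'0 : leb2 N' = 0%E.
  by apply: affine2_null => //; rewrite mul1r mul0r subr0 oner_neq0.
(* Coefficients of the inverse of the affine map in the numerator. *)
pose p1 := m22 / D; pose p2 := - (m12 / D); pose r1 := - (m21 / D); pose r2 := m11 / D.
pose p0 := - (p1 * e + p2 * f); pose r0 := - (r1 * e + r2 * f).
pose q (z : plane R) := Q (affine2 p1 p2 r1 r2 p0 r0 z).
have qE z : q z = (k0 + k1 * p0 + k2 * r0 + k3 * (p0 ^+ 2 + r0 ^+ 2)) +
   (k1 * p1 + k2 * r1 + k3 * (2 * p0 * p1 + 2 * r0 * r1)) * z.1 +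
   (k1 * p2 + k2 * r2 + k3 * (2 * p0 * p2 + 2 * r0 * r2)) * z.2 +
   k3 * (p1 ^+ 2 + r1 ^+ 2) * z.1 ^+ 2 + k3 * (2 * p1 * p2 + 2 * r1 * r2) * (z.1 * z.2) +
   k3 * (p2 ^+ 2 + r2 ^+ 2) * z.2 ^+ 2.
  by rewrite /q /Q /affine2 /=; ring.
have P0 := quotient_plane_null qE (fun z => Q0 _) mN' N'0.
set P := _ @^-1` N' in P0.
have mQ : measurable_fun setT Q.
  have m1 : measurable_fun setT (fun z : plane R => z.1) by exact: measurable_fst.
  have m2 : measurable_fun setT (fun z : plane R => z.2) by exact: measurable_snd.
  do ![apply: measurable_funD => //]; apply: measurable_funM => //.
  by apply: measurable_funD; exact: measurable_funX.
have mP : measurable P.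
  rewrite -[X in measurable X]setTI.
  have mqi : measurable_fun setT (fun z => (q z)^-1).
    apply: (measurableT_comp (@measurable_inv R)).
    exact: (measurableT_comp mQ (measurable_affine2 _ _ _ _ _ _)).
  have m1 : measurable_fun setT (fun z : plane R => z.1 / q z).
    by apply: measurable_funM => //; exact: measurable_fst.
  have m2 : measurable_fun setT (fun z : plane R => z.2 / q z).
    by apply: measurable_funM => //; exact: measurable_snd.
  exact: (measurable_fun_pair m1 m2).
have := affine2_null e f D0 mP P0.
have E z : affine2 p1 p2 r1 r2 p0 r0 (affine2 m11 m12 m21 m22 e f z) = z.
  case: z => x y; rewrite /affine2 /= /p0 /r0 /p1 /p2 /r1 /r2.
  by congr (_, _); rewrite /D; field.
have H z : (affine2 m11 m12 m21 m22 e f @^-1` P) z =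
   N (a1 + (m11 * z.1 + m12 * z.2 + e) / Q z, a2 + (m21 * z.1 + m22 * z.2 + f) / Q z).
  rewrite /P /preimage /= /q E /N' /= /affine2 /=; congr N.
  by congr (_, _); ring.
by congr (leb2 _ = _); apply/seteqP; split => z; rewrite H.
Qed.

Lemma finite_quadratic_roots (a b c : R) : a != 0 ->
  finite_set [set s : R | a * s ^+ 2 + b * s + c = 0].
Proof.
move=> a0; have [[s sE]|ns] := pselect (exists s : R, a * s ^+ 2 + b * s + c = 0); last first.
  by rewrite (_ : [set _ | _] = set0) //; apply/seteqP; split => // s sE; apply: ns; exists s.
apply: (@sub_finite_set _ _ [set s; - (b / a) - s]); last exact: finite_set2.
move=> s' /= s'E; have [->|ss'] := eqVneq s' s; [by left|right].
have : (s' - s) * (a * (s' + s) + b) = 0 by rewrite -[RHS](subrr 0) -{1}s'E -sE; ring.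
move=> /eqP; rewrite mulf_eq0 subr_eq0 (negPf ss') /= => /eqP H.
apply: (mulfI a0); rewrite mulrBr mulrN mulrCA divff// mulr1.
by rewrite -[b](addrK (a * (s' + s))) [b + _]addrC H; ring.
Qed.

Variable n : nat.
Local Notation vec := (n.-tuple (plane R)).
Implicit Types (w x y : 'cV[C]_n).

Definition ray w (z : C) : vec :=
  [tuple (complex.Re (z * w i 0), complex.Im (z * w i 0)) | i < n].

Lemma cvec_affine_ray w z (t : vec) : cvec (affineC 1 (ray w z) t) = cvec t + z *: w.
Proof.
apply/matrixP => i j; rewrite !mxE ord1 !tnth_mktuple /= !mul1r.
by apply: complex_ext; rewrite /=; case: (z * w i 0).
Qed.

Lemma measurable_ray_real w : measurable_fun setT (fun s : R => ray w s%:C%C).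
Proof.
apply/measurable_fun_tnthP => i.
rewrite (_ : _ \o _ = fun s => (s * complex.Re (w i 0), s * complex.Im (w i 0))).
  by apply: measurable_fun_pair; apply: measurable_funM.
apply/funext => s /=; rewrite tnth_mktuple; case: (w i 0) => a b /=.
by congr (_, _); ring.
Qed.

Lemma measurable_ray w : measurable_fun setT (fun z : plane R => ray w (complex.Complex z.1 z.2)).
Proof.
have m1 : measurable_fun setT (fun z : plane R => z.1) by exact: measurable_fst.
have m2 : measurable_fun setT (fun z : plane R => z.2) by exact: measurable_snd.
apply/measurable_fun_tnthP => i.
rewrite (_ : _ \o _ = fun z => (z.1 * complex.Re (w i 0) - z.2 * complex.Im (w i 0),
   z.1 * complex.Im (w i 0) + z.2 * complex.Re (w i 0))).
  apply: measurable_fun_pair; [apply: measurable_funB|apply: measurable_funD]; exact: measurable_funM.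
by apply/funext => z /=; rewrite tnth_mktuple; case: (w i 0) => a b.
Qed.

Lemma inner_conjC x y : (inner x y)^* = inner y x.
Proof. by have := inner_conj 1%:M x y; rewrite trmx1 map_mx1 !mul1mx. Qed.

(** For a centered matrix this is the negative of the determinant in [ray_null]; squares are used to
    keep it polynomial in the real coordinates of [y]. *)
Definition discr (A : 'M[C]_n) w y : R :=
  complex.Re (inner (A *m y) w) ^+ 2 + complex.Im (inner (A *m y) w) ^+ 2 -
  (complex.Re (inner (A *m w) y) ^+ 2 + complex.Im (inner (A *m w) y) ^+ 2).

Lemma discr_neq0 A w y : `|inner (A *m y) w| != `|inner (A *m w) y| -> discr A w y != 0.
Proof.
apply: contra => /eqP E; rewrite !normc_def; apply/eqP; congr (Num.sqrt _)%:C%C.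
by move: E; rewrite /discr => /eqP; rewrite subr_eq0 => /eqP.
Qed.

Lemma measurable_inner_cvec (u : 'cV[C]_n) :
  measurable_fun setT (fun t : vec => complex.Re (inner (cvec t) u)) /\
  measurable_fun setT (fun t : vec => complex.Im (inner (cvec t) u)).
Proof.
have m1 i : measurable_fun setT (fun t : vec => (tnth t i).1).
  exact: (measurableT_comp measurable_fst (measurable_tnth i)).
have m2 i : measurable_fun setT (fun t : vec => (tnth t i).2).
  exact: (measurableT_comp measurable_snd (measurable_tnth i)).
split.
- rewrite (_ : (fun t => _) = fun t : vec => \sum_i
      (complex.Re (u i 0) * (tnth t i).1 + complex.Im (u i 0) * (tnth t i).2)).
    apply: measurable_sum => i; apply: measurable_funD; apply: measurable_funM;
      by [exact: measurable_cst|exact: m1|exact: m2].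
  apply/funext => t; rewrite /inner mxE raddf_sum; apply: eq_bigr => i _.
  by rewrite !mxE /=; case: (u i 0) => a b /=; ring.
- rewrite (_ : (fun t => _) = fun t : vec => \sum_i
      (complex.Re (u i 0) * (tnth t i).2 - complex.Im (u i 0) * (tnth t i).1)).
    apply: measurable_sum => i; apply: measurable_funB; apply: measurable_funM;
      by [exact: measurable_cst|exact: m1|exact: m2].
  apply/funext => t; rewrite /inner mxE raddf_sum; apply: eq_bigr => i _.
  by rewrite !mxE /=; case: (u i 0) => a b /=; ring.
Qed.

Lemma lebesgue_measureT_neq0 : leb setT != 0%E.
Proof.
apply/negP => /eqP l0; have : (leb `[0%R, 1%R]%classic <= leb setT)%E.
  by apply: le_measure; rewrite ?inE.
by rewrite l0 lebesgue_measure_itv /= lte_fin ltr01 oppr0 adde0 lee_fin ler10.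
Qed.

Let measurable_diffsq (f1 f2 f3 f4 : vec -> R) :
  measurable_fun setT f1 -> measurable_fun setT f2 ->
  measurable_fun setT f3 -> measurable_fun setT f4 ->
  measurable_fun setT (fun t => f1 t ^+ 2 + f2 t ^+ 2 - (f3 t ^+ 2 + f4 t ^+ 2)).
Proof.
by move=> m1 m2 m3 m4; apply: measurable_funB; apply: measurable_funD; exact: measurable_funX.
Qed.

Lemma measurable_discr A w : measurable_fun setT (fun t : vec => discr A w (cvec t)) /\
  measurable [set t : vec | discr A w (cvec t) = 0].
Proof.
have md : measurable_fun setT (fun t : vec => discr A w (cvec t)).
  have [a1 a2] := measurable_inner_cvec (A ^t* *m w).
  have [b1 b2] := measurable_inner_cvec (A *m w).
  rewrite (_ : (fun t => _) = fun t : vec =>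
    complex.Re (inner (cvec t) (A ^t* *m w)) ^+ 2 + complex.Im (inner (cvec t) (A ^t* *m w)) ^+ 2 -
    (complex.Re (inner (cvec t) (A *m w)) ^+ 2 + complex.Im (inner (cvec t) (A *m w)) ^+ 2)).
    exact: (measurable_diffsq a1 a2 b1 b2).
  apply/funext => t; rewrite /discr inner_adj -(inner_conjC (cvec t) (A *m w)) conjCE /=.
  by rewrite sqrrN.
by split => //; have := md measurableT [set 0] (measurable_set1 0); rewrite setTI.
Qed.

(** Along every real line of direction [y0] the discriminant is a quadratic polynomial with leading
    coefficient [discr A w y0], so it has finitely many zeros there, and [null_translate]
    applies. *)
Lemma discr_null A w y0 : discr A w y0 != 0 ->
  lebesgueC R n [set t : vec | discr A w (cvec t) = 0] = 0%E.
Proof.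
move=> d0.
apply: (@null_translate R n _ _ leb (fun s : R => ray y0 s%:C%C)).
- by have [] := measurable_discr A w.
- exact: measurable_ray_real.
- exact: lebesgue_measureT_neq0.
- apply/aeW => t; apply: countable_lebesgue_measure0; apply: finite_set_countable.
  pose p := inner (A *m cvec t) w; pose p' := inner (A *m y0) w.
  pose q := inner (A *m w) (cvec t); pose q' := inner (A *m w) y0.
  pose b := 2 * (complex.Re p * complex.Re p' + complex.Im p * complex.Im p' -
     (complex.Re q * complex.Re q' + complex.Im q * complex.Im q')).
  apply: sub_finite_set (finite_quadratic_roots b (discr A w (cvec t)) d0).
  move=> s /=; rewrite cvec_affine_ray /discr mulmxDr innerDl innerDr -scalemxAr innerZl innerZr.
  rewrite -/p -/p' -/q -/q' => <-; rewrite /b {b}; move: p p' q q' => [? ?] [? ?] [? ?] [? ?] /=.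
  ring.
Qed.

Lemma inner_real x : inner x x = (complex.Re (inner x x))%:C%C.
Proof.
apply: complex_ext => //=; have := inner_conjC x x; rewrite conjCE.
by case: (inner x x) => a b /= [] /eqP; rewrite -subr_eq0 -opprD oppr_eq0 -mulr2n mulrn_eq0 /= => /eqP.
Qed.

Lemma inner_gt0 x : x != 0 -> 0 < complex.Re (inner x x).
Proof.
by have [t <-] := cvec_surj x => /sqnorm_gt0; rewrite /sqnorm /hform mul1mx.
Qed.

Lemma quadratic_form_radial (A : 'M[C]_n) (t : vec) (x := cvec t) :
  quadratic_form A (radial_proj t) =
  (complex.Re (inner (A *m x) x) / complex.Re (inner x x),
   complex.Im (inner (A *m x) x) / complex.Re (inner x x)).
Proof.
have -> : radial_proj t = dilate (norm2 x)^-1 t.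
  apply: eq_from_tnth => i; rewrite !tnth_mktuple tnth_nseq /= !addr0.
  by rewrite ![_^-1 * _]mulrC.
rewrite /quadratic_form cvec_dilate -scalemxAr innerZl innerZr -/x.
have -> : complex.Re (inner x x) = norm2 x ^+ 2.
  rewrite /norm2 sqr_sqrtr//; have [->|x0] := eqVneq x 0; last exact/ltW/inner_gt0.
  by rewrite /inner mulmx0 mxE.
rewrite -exprVn; move: (norm2 x)^-1 (inner _ _) => r [a b].
by rewrite /to_plane /=; congr (_, _); ring.
Qed.

(** On the line [y + z w] the Rayleigh quotient is [a] plus a real affine function of [z] divided by
    the squared norm [Q], thanks to the centering; this is the setting of [fractional_null]. *)
Lemma ray_null (A : 'M[C]_n) (N : set (plane R)) w (t : vec) : w != 0 ->
  discr (centered A w) w (cvec t) != 0 -> measurable N -> leb2 N = 0%E ->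
  leb2 [set z : plane R | N (quadratic_form A
    (radial_proj (affineC 1 (ray w (complex.Complex z.1 z.2)) t)))] = 0%E.
Proof.
move=> w0 d0 mN N0; set y := cvec t in d0 *.
set B := centered A w in d0.
have cw : inner (B *m w) w = 0.
  rewrite inner_centered divfK ?subrr// inner_real eq_complex /= eqxx andbT.
  by rewrite gt_eqF// inner_gt0.
(* If the line met 0, then [y] would be a multiple of [w] and the discriminant would vanish
   there. *)
have yw (z : C) : y + z *: w != 0.
  apply: contra d0 => /eqP /(canRL (addrK _)); rewrite sub0r -scaleNr => ->.
  rewrite /discr -scalemxAr innerZl innerZr cw !mulr0 /=.
  by rewrite subrr.
set a := inner (A *m w) w / inner w w.
have AE (x : 'cV[C]_n) : inner (A *m x) x = a * inner x x + inner (B *m x) x.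
  by rewrite inner_centered addrC subrK.
have BE z : inner (B *m (y + z *: w)) (y + z *: w) =
    inner (B *m y) y + z * inner (B *m w) y + z^* * inner (B *m y) w.
  rewrite mulmxDr -scalemxAr innerDl !innerDr !innerZl !innerZr cw; ring.
have QE z : inner (y + z *: w) (y + z *: w) =
    inner y y + z * (inner y w)^* + z^* * inner y w + z * z^* * inner w w.
  rewrite inner_conjC innerDl !innerDr !innerZl !innerZr; ring.
pose k0 := complex.Re (inner y y); pose k3 := complex.Re (inner w w); pose ka := inner y w.
pose al := inner (B *m y) w; pose be := inner (B *m w) y; pose ga := inner (B *m y) y.
pose Q (z : plane R) := k0 + 2 * complex.Re ka * z.1 + 2 * complex.Im ka * z.2 +
  k3 * (z.1 ^+ 2 + z.2 ^+ 2).
have Q1 (z : plane R) (x := y + complex.Complex z.1 z.2 *: w) : complex.Re (inner x x) = Q z.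
  rewrite QE (inner_real y) (inner_real w) /Q -/k0 -/k3 -/ka.
  by move: k0 k3 ka z {Q x} => ? ? [? ?] [? ?] /=; ring.
have Q0 z : 0 < Q z by rewrite -Q1 inner_gt0.
have B1 (z : plane R) (x := y + complex.Complex z.1 z.2 *: w) : complex.Re (inner (B *m x) x) =
   (complex.Re be + complex.Re al) * z.1 + (complex.Im al - complex.Im be) * z.2 + complex.Re ga.
  by rewrite BE -/al -/be -/ga; move: al be ga z {x} => [? ?] [? ?] [? ?] [? ?] /=; ring.
have B2 (z : plane R) (x := y + complex.Complex z.1 z.2 *: w) : complex.Im (inner (B *m x) x) =
   (complex.Im be + complex.Im al) * z.1 + (complex.Re be - complex.Re al) * z.2 + complex.Im ga.
  by rewrite BE -/al -/be -/ga; move: al be ga z {x B1} => [? ?] [? ?] [? ?] [? ?] /=; ring.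
have D0 : (complex.Re be + complex.Re al) * (complex.Re be - complex.Re al) -
   (complex.Im al - complex.Im be) * (complex.Im be + complex.Im al) != 0.
  rewrite -oppr_eq0; apply: contra d0 => /eqP D0; rewrite /discr -/al -/be -[X in _ == X]D0.
  by apply/eqP; clear; move: al be => [a1 a2] [b1 b2] /=; ring.
rewrite -[RHS](fractional_null (complex.Re ga) (complex.Im ga) (complex.Re a) (complex.Im a) D0 Q0 mN N0).
congr (leb2 _); apply/funext => z; rewrite /mkset -/(Q z).
rewrite quadratic_form_radial cvec_affine_ray -/y AE.
set x := y + _ *: w.
have xx : inner x x = (Q z)%:C%C by rewrite inner_real Q1.
have QN : Q z != 0 by rewrite gt_eqF.
congr N; rewrite xx -B1 -B2 -/x; move: (inner (B *m x) x) (Q z) QN => [u v] q q0 /=.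
by move: (a) => [? ?] /=; congr (_, _); field.
Qed.

Theorem numerical_measure_null (A : 'M[C]_n) (N : set (plane R)) :
  (@to_plane R @` numerical_range A)° !=set0 -> measurable N -> leb2 N = 0%E ->
  numerical_measure A N = 0%E.
Proof.
move=> hW mN N0; have [w [y0 [w0 wy]]] := exists_nondegenerate hW.
pose E := [set t : vec | N (quadratic_form A (radial_proj t))].
have mE : measurable E.
  rewrite -[X in measurable X]setTI.
  apply: (measurableT_comp (measurable_funPT (quadratic_form A)) (measurable_funPT (@radial_proj R n))) => //.
have E0 : lebesgueC R n E = 0%E.
  apply: (@null_translate R n _ _ leb2 (fun z : plane R => ray w (complex.Complex z.1 z.2))) => //.
  - exact: measurable_ray.
  - rewrite -[X in X != _]/((leb \x leb)%E setT) -setXTT product_measure1E// mule_eq0 negb_or.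
    by rewrite !lebesgue_measureT_neq0.
  - exists [set t : vec | discr (centered A w) w (cvec t) = 0]; split.
    + have [//] := measurable_discr (centered A w) w.
    + exact: discr_null (discr_neq0 wy).
    + move=> t /=; apply: contra_notP => /eqP dt; exact: ray_null.
have -> : numerical_measure A N = uniform_ball (n := n) E by [].
have [v v0 [vE _]] := @ge0_integral_uniform_ball R n (\1_E) (measurable_indic mE) (fun t => ltac:(by [])).
have -> : uniform_ball (n := n) E = (\int[uniform_ball (n := n)]_t (\1_E t)%:E)%E.
  by rewrite integral_indic// setIT.
rewrite vE integral_indic//; last exact: measurable_unit_ball.
have EB0 : lebesgueC R n (E `&` @unit_ball R n) = 0%E.
  apply: (@subset_measure0 _ _ _ (lebesgueC R n) _ E) => //.
  by apply: measurableI => //; exact: measurable_unit_ball.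
by transitivity ((v^-1)%:E * 0)%E; [congr (_ * _)%E; exact: EB0|rewrite mule0].
Qed.

End absolute_continuity.

(** * Test functions on the plane *)

Section plane_calculus.
Context (R : realType).
Local Notation leb := (@lebesgue_measure R).
Implicit Types (f g chi phi : R * R -> R) (z : R * R).

(** An open set is a countable union of squares with rational centers, hence lies in the product
    sigma-algebra carried by [plane R]. *)
Lemma open_measurable_plane (U : set (R * R)) : open U -> measurable (U : set (plane R)).
Proof.
move=> oU.
pose B (t : rat * rat * nat) : set (plane R) :=
  ball (ratr t.1.1 : R) t.2.+1%:R^-1 `*` ball (ratr t.1.2 : R) t.2.+1%:R^-1.
pose F (j : nat) : set (plane R) :=
  if unpickle j is Some t then [set z | B t z /\ B t `<=` U] else set0.
have mF j : measurable (F j).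
  rewrite /F; case: unpickle => [t|]; last exact: measurable0.
  have [BU|nBU] := pselect (B t `<=` U).
    rewrite (_ : [set _ | _] = B t); last by apply/seteqP; split => // z [].
    by apply: measurableX; exact: measurable_ball.
  by rewrite (_ : [set _ | _] = set0)//; apply/seteqP; split => // z [].
suff -> : U = \bigcup_j F j by exact: bigcupT_measurable.
apply/seteqP; split => [[x y] Uz|z [j _]]; last first.
  by rewrite /F; case: unpickle => // t [Bz]; apply.
have /nbhs_ballP[e /= e0 He] : nbhs (x, y) U by exact: open_nbhs_nbhs.
have [i ie] : exists i : nat, i.+1%:R^-1 < e / 2.
  exists (Num.trunc (2 / e)).
  by rewrite -[e / 2]invrK invf_div ltf_pV2 ?posrE ?divr_gt0// truncnS_gt.
have i0 : 0 < i.+1%:R^-1 :> R by rewrite invr_gt0.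
have [q1 q1x] : exists q : rat, ball (ratr q : R) i.+1%:R^-1 x.
  have /rat_in_itvoo[q] : x - i.+1%:R^-1 < x + i.+1%:R^-1 by rewrite ltrD2l gtrN.
  rewrite in_itv/= => /andP[h1 h2]; exists q.
  rewrite /ball /= ltr_norml; move: (i.+1%:R^-1) (ratr q) h1 h2 => ? ? ? ?.
  by apply/andP; split; lra.
have [q2 q2y] : exists q : rat, ball (ratr q : R) i.+1%:R^-1 y.
  have /rat_in_itvoo[q] : y - i.+1%:R^-1 < y + i.+1%:R^-1 by rewrite ltrD2l gtrN.
  rewrite in_itv/= => /andP[h1 h2]; exists q.
  rewrite /ball /= ltr_norml; move: (i.+1%:R^-1) (ratr q) h1 h2 => ? ? ? ?.
  by apply/andP; split; lra.
have [j jE] : exists j : nat, unpickle j = Some (q1, q2, i).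
  by exists (pickle (q1, q2, i)); rewrite pickleK.
exists j => //; rewrite /F jE; split; first by split.
have tr (q : rat) (a b : R) : ball (ratr q : R) i.+1%:R^-1 a -> ball (ratr q : R) i.+1%:R^-1 b ->
    ball a e b.
  move=> qa qb; apply: (@le_ball _ _ a (i.+1%:R^-1 + i.+1%:R^-1)).
    by rewrite [e](splitr e) lerD// ltW.
  exact: (ball_triangle (ball_sym qa) qb).
by move=> [a b] [/= q1a q2b]; apply: He; split; [exact: tr q1x q1a|exact: tr q2y q2b].
Qed.

Lemma continuous_measurable_plane f : continuous f -> measurable_fun setT (f : plane R -> R).
Proof.
move=> cf; apply: (measurability (@RGenOpens.G R)); first exact: RGenOpens.measurableE.
move=> _ [_ [a [b ->] <-]]; rewrite setTI; apply: open_measurable_plane.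
by apply: open_comp => // z _; exact: cf.
Qed.

Lemma test_function_support phi : test_function phi -> exists2 rho : R, 0 <= rho &
  forall z, rho ^+ 2 < z.1 ^+ 2 + z.2 ^+ 2 -> phi z = 0.
Proof.
move=> [_ cK].
have /= [M [Mr HM]] := compact_bounded cK.
pose N := `|M| + 1.
have N0 : 0 <= N by rewrite addr_ge0.
have HN z : phi z != 0 -> `|z| <= N.
  move=> pz; apply: (HM N); first by rewrite /N (le_lt_trans (ler_norm M))// ltrDl.
  exact: subset_closure.
(* The norm on the product is the maximum norm; the Euclidean radius wanted here is invariant under
   rotations. *)
exists (2 * N); first by rewrite mulr_ge0.
move=> z; apply: contraTeq => /HN; rewrite prod_normE ge_max => /andP[z1 z2].
rewrite -leNgt; move: z1 z2; rewrite !ler_norml => /andP[? ?] /andP[? ?].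
by nra.
Qed.

Lemma test_function_bounded phi : test_function phi -> exists2 M : R, 0 <= M &
  forall z, `|phi z| <= M.
Proof.
move=> tp; have [_ cK] := tp; have cp := tp.1 0%N.
have [[z0 Kz0]|K0] := pselect (closure [set z | phi z != 0] !=set0); last first.
  exists 0 => // z; rewrite normr_le0; apply/eqP; apply: contrapT => /eqP pz.
  by apply: K0; exists z; exact: subset_closure.
have [|c _ hc] := @compact_EVT_max _ _ (fun z => `|phi z|) _ (ex_intro _ z0 Kz0) cK.
  by apply: continuous_subspaceT => z; apply: cvg_norm; exact: cp.
exists `|phi c| => // z; have [->|pz] := eqVneq (phi z) 0; first by rewrite normr0.
by apply: hc; rewrite inE; exact: subset_closure.
Qed.

Lemma is_derive_partial1 f x y df : derivable f (x, y) (1, 0) -> 'D_(1, 0) f (x, y) = df ->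
  is_derive x (1 : R) (fun t => f (t, y)) df.
Proof.
have E : (fun h : R => h^-1 *: (((fun t => f (t, y)) \o shift x) (h *: 1) - f (x, y))) =
    (fun h : R => h^-1 *: ((f \o shift (x, y)) (h *: (1, 0)) - f (x, y))).
  apply/funext => h /=; congr (_ *: (f _ - _)); congr (_, _).
  by rewrite -[RHS]/(h * 0 + y) mulr0 add0r.
by move=> df1 df2; split; [rewrite /derivable E|rewrite /derive E].
Qed.

Lemma is_derive_partial2 f x y df : derivable f (x, y) (0, 1) -> 'D_(0, 1) f (x, y) = df ->
  is_derive y (1 : R) (fun t => f (x, t)) df.
Proof.
have E : (fun h : R => h^-1 *: (((fun t => f (x, t)) \o shift y) (h *: 1) - f (x, y))) =
    (fun h : R => h^-1 *: ((f \o shift (x, y)) (h *: (0, 1)) - f (x, y))).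
  apply/funext => h /=; congr (_ *: (f _ - _)); congr (_, _).
  by rewrite -[RHS]/(h * 0 + x) mulr0 add0r.
by move=> df1 df2; split; [rewrite /derivable E|rewrite /derive E].
Qed.

Lemma mean_value (h dh : R -> R) a b : (forall t, is_derive t (1 : R) h (dh t)) ->
  exists c, [/\ `|c - a| <= `|b - a|, `|c - b| <= `|b - a| & h b - h a = dh c * (b - a)].
Proof.
move=> hd; wlog ab : a b / a <= b.
  move=> H; have [ab|/ltW ba] := leP a b; first exact: H.
  have [c [c1 c2 cE]] := H b a ba; exists c; split; rewrite ?[`|b - a|]distrC//.
  by rewrite -opprB cE -mulrN opprB.
have ch : {within `[a, b], continuous h}.
  by apply: derivable_within_continuous => t _; have [] := hd t.
have [c] := @MVT_segment R h dh a b ab (fun t _ => hd t) ch.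
rewrite in_itv /= => /andP[ac cb] E; exists c; split => //.
  by rewrite !ger0_norm ?subr_ge0// lerD2r.
by rewrite distrC !ger0_norm ?subr_ge0// lerB.
Qed.

(** [continuously_differentiable] mentions partial derivatives only. The mean value theorem along
    two sides of a rectangle turns their continuity into differentiability. *)
Lemma C1_differential f x y e : continuously_differentiable 1 f -> 0 < e ->
  exists2 d, 0 < d & forall a b, `|a| < d -> `|b| < d ->
   `|f (x + a, y + b) - f (x, y) - ('D_(1, 0) f (x, y) * a + 'D_(0, 1) f (x, y) * b)| <=
   e * (`|a| + `|b|).
Proof.
move=> [d1 d2 c1 c2] e0.
have N1 : \forall z \near (x, y), `|'D_(1, 0) f z - 'D_(1, 0) f (x, y)| <= e.
  have /cvgr_dist_le /(_ _ e0) := c1 (x, y).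
  by apply: filterS => z; rewrite distrC.
have N2 : \forall z \near (x, y), `|'D_(0, 1) f z - 'D_(0, 1) f (x, y)| <= e.
  have /cvgr_dist_le /(_ _ e0) := c2 (x, y).
  by apply: filterS => z; rewrite distrC.
have [d /= dp Hd] := (nbhs_ballP (x, y) _).1 (filterI N1 N2).
exists d => // a b ad bd.
have [c [ca _ cE]] := @mean_value (fun t => f (t, y + b)) (fun t => 'D_(1, 0) f (t, y + b)) x (x + a)
  (fun t => is_derive_partial1 (d1 _) erefl).
have [c' [cb _ cE']] := @mean_value (fun t => f (x, t)) (fun t => 'D_(0, 1) f (x, t)) y (y + b)
  (fun t => is_derive_partial2 (d2 _) erefl).
rewrite addrAC subrr add0r in ca cE; rewrite addrAC subrr add0r in cb cE'.
have -> : f (x + a, y + b) - f (x, y) = (f (x + a, y + b) - f (x, y + b)) + (f (x, y + b) - f (x, y)).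
  by rewrite addrA subrK.
rewrite cE cE' opprD addrACA -!mulrBl (le_trans (ler_normD _ _))// !normrM mulrDr lerD//.
  apply: ler_wpM2r => //; apply: (Hd (c, y + b) _).1; split; rewrite /ball /= distrC.
    exact: le_lt_trans ca ad.
  by rewrite addrAC subrr add0r.
apply: ler_wpM2r => //; apply: (Hd (x, c') _).2; split; rewrite /ball /= distrC.
  by rewrite subrr normr0.
exact: le_lt_trans cb bd.
Qed.

Lemma is_derive_curve f (X Y : R -> R) r dX dY : continuously_differentiable 1 f ->
  is_derive r (1 : R) X dX -> is_derive r (1 : R) Y dY ->
  is_derive r (1 : R) (fun t => f (X t, Y t))
    ('D_(1, 0) f (X r, Y r) * dX + 'D_(0, 1) f (X r, Y r) * dY).
Proof.
move=> cf [eX vX] [eY vY].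
set p := 'D_(1, 0) f (X r, Y r); set q := 'D_(0, 1) f (X r, Y r).
pose qX (h : R) := h^-1 * (X (h + r) - X r); pose qY (h : R) := h^-1 * (Y (h + r) - Y r).
have cX : qX h @[h --> 0^'] --> dX.
  rewrite -vX; move: eX; rewrite /derivable => /cvg_ex[l Hl].
  rewrite /derive (cvg_lim _ Hl)//; apply: cvg_trans Hl; apply: near_eq_cvg.
  by near=> h; rewrite /qX /= /GRing.scale /= mulr1.
have cY : qY h @[h --> 0^'] --> dY.
  rewrite -vY; move: eY; rewrite /derivable => /cvg_ex[l Hl].
  rewrite /derive (cvg_lim _ Hl)//; apply: cvg_trans Hl; apply: near_eq_cvg.
  by near=> h; rewrite /qY /= /GRing.scale /= mulr1.
have id0 : (h + r : R) @[h --> (0 : R)^'] --> r.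
  rewrite -[X in _ --> X]add0r; apply: cvgD; last exact: cvg_cst.
  exact: cvg_within.
have contX : X (h + r) @[h --> 0^'] --> X r.
  have c0 : X t @[t --> r] --> X r by apply: differentiable_continuous; exact/derivable1_diffP.
  exact: (cvg_comp (fun h : R => h + r) X id0 c0).
have contY : Y (h + r) @[h --> 0^'] --> Y r.
  have c0 : Y t @[t --> r] --> Y r by apply: differentiable_continuous; exact/derivable1_diffP.
  exact: (cvg_comp (fun h : R => h + r) Y id0 c0).
pose De (h : R) := h^-1 *: (((fun t => f (X t, Y t)) \o shift r) (h *: 1) - f (X r, Y r)).
have D0 : De h - (p * qX h + q * qY h) @[h --> (0 : R)^'] --> 0.
  apply/cvgr0Pnorm_le => e e0.
  (* An eventual bound for the sum of the difference quotients of [X] and [Y]; it fixes the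
     precision asked of [C1_differential]. *)
  have K0 : 0 < `|dX| + `|dY| + 2 by rewrite ltr_wpDl// addr_ge0.
  have e'0 : 0 < e / (`|dX| + `|dY| + 2) by rewrite divr_gt0.
  have [d d0 Hd] := C1_differential (X r) (Y r) cf e'0.
  have bX : \forall h \near (0 : R)^', `|X (h + r) - X r| < d.
    by have /cvgr_dist_lt /(_ _ d0) := contX; apply: filterS => h; rewrite distrC.
  have bY : \forall h \near (0 : R)^', `|Y (h + r) - Y r| < d.
    by have /cvgr_dist_lt /(_ _ d0) := contY; apply: filterS => h; rewrite distrC.
  have nX : \forall h \near (0 : R)^', `|qX h| <= `|dX| + 1.
    have /cvgr_dist_le /(_ _ ltr01) := cX; apply: filterS => h qh.
    rewrite -[qX h](subrK dX) (le_trans (ler_normD _ _))// addrC lerD2l distrC//.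
  have nY : \forall h \near (0 : R)^', `|qY h| <= `|dY| + 1.
    have /cvgr_dist_le /(_ _ ltr01) := cY; apply: filterS => h qh.
    rewrite -[qY h](subrK dY) (le_trans (ler_normD _ _))// addrC lerD2l distrC//.
  near=> h.
  have -> : De h - (p * qX h + q * qY h) = h^-1 * (f (X r + (X (h + r) - X r), Y r + (Y (h + r) - Y r)) -
      f (X r, Y r) - (p * (X (h + r) - X r) + q * (Y (h + r) - Y r))).
    rewrite /De /qX /qY /= /GRing.scale /= mulr1 ![_ + (_ - _)]addrC !subrK; ring.
  rewrite normrM (le_trans (ler_wpM2l _ (Hd _ _ _ _)))//; [by near: h|by near: h|].
  rewrite mulrCA mulrDr -!normrM -/(qX h) -/(qY h).
  rewrite -ler_pdivlMl// invf_div -mulrA mulVf ?gt_eqF// mulr1.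
  have -> : `|dX| + `|dY| + 2 = (`|dX| + 1) + (`|dY| + 1) by ring.
  by apply: lerD; near: h.
have L : De h @[h --> (0 : R)^'] --> p * dX + q * dY.
  have -> : De = fun h => (De h - (p * qX h + q * qY h)) + (p * qX h + q * qY h).
    by apply/funext => h; rewrite subrK.
  rewrite -[X in _ --> X]add0r; apply: cvgD D0 _.
  exact: (cvgD (cvgM (cvg_cst p) cX) (cvgM (cvg_cst q) cY)).
by apply: DeriveDef; [apply/cvg_ex; eexists; exact: L|exact: (cvg_lim _ L)].
Unshelve. all: end_near. Qed.

Lemma continuously_differentiable_comb k (a b : R) f g :
  continuously_differentiable k f -> continuously_differentiable k g ->
  continuously_differentiable k (fun z => a * f z + b * g z).
Proof.
elim: k f g => [f g cf cg z|k IH f g [f1 f2 cf1 cf2] [g1 g2 cg1 cg2]].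
  by apply: cvgD; apply: cvgM; [exact: cvg_cst|exact: cf|exact: cvg_cst|exact: cg].
have D v : (forall z, derivable f z v) -> (forall z, derivable g z v) ->
    (forall z, derivable (fun z => a * f z + b * g z) z v) /\
    (fun z => 'D_v (fun z => a * f z + b * g z) z) = (fun z => a * 'D_v f z + b * 'D_v g z).
  move=> df dg; split=> [z|].
    by apply: derivableD; apply: derivableZ.
  by apply/funext => z; rewrite deriveD; [rewrite !deriveZ|apply: derivableZ|apply: derivableZ].
have [df1 Ef1] := D _ f1 g1; have [df2 Ef2] := D _ f2 g2.
by split; [exact: df1|exact: df2|rewrite Ef1; exact: (IH _ _ cf1 cg1)|rewrite Ef2; exact: (IH _ _ cf2 cg2)].
Qed.

Let closure_support f g : (forall z, (\near z, f z = 0) -> g z = 0) ->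
  compact (closure [set z | f z != 0]) -> compact (closure [set z | g z != 0]).
Proof.
move=> fg cf; apply: (subclosed_compact _ cf); first exact: closed_closure.
rewrite [X in _ `<=` X](closure_id _).1; last exact: closed_closure.
apply: closureS => z /= gz; apply: contrapT => nz.
have /eqP[] := gz; apply: fg.
have oC : open (~` closure [set z | f z != 0]) by apply: closed_openC; exact: closed_closure.
have : \forall z' \near z, (~` closure [set z | f z != 0]) z' by exact: open_nbhs_nbhs.
apply: filterS => z' nz'; apply/eqP; apply: contra_notT nz' => fz'.
exact: subset_closure.
Qed.

Lemma test_function_partial phi : test_function phi ->
  test_function (fun z => 'D_(1, 0) phi z) /\ test_function (fun z => 'D_(0, 1) phi z).
Proof.
move=> [cd cK]; split; split.
- by move=> k; have [] := cd k.+1.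
- apply: closure_support cK => z fz; rewrite (@near_eq_derive _ _ _ phi (cst 0)) ?derive_cst//.
- by move=> k; have [] := cd k.+1.
- apply: closure_support cK => z fz; rewrite (@near_eq_derive _ _ _ phi (cst 0)) ?derive_cst//.
Qed.

Lemma test_function_comb (a b : R) f g : test_function f -> test_function g ->
  test_function (fun z => a * f z + b * g z).
Proof.
move=> [cf kf] [cg kg]; split; first by move=> k; exact: continuously_differentiable_comb.
apply: (subclosed_compact _ (compactU kf kg)); first exact: closed_closure.
rewrite -closureU; apply: closureS => z /= fgz.
have [fz|fz] := eqVneq (f z) 0; [right|by left].
by apply: contra fgz => /eqP gz; rewrite fz gz !mulr0 addr0.
Qed.

(** Chosen so that [line_integral phi theta s] integrates [phi (rotation theta (s, u))] over [u]. *)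
Definition rotation (theta : R) (w : plane R) : plane R :=
  (w.1 * cos theta - w.2 * sin theta, w.1 * sin theta + w.2 * cos theta).

Definition ddir (theta : R) phi z :=
  cos theta * 'D_(1, 0) phi z + sin theta * 'D_(0, 1) phi z.

Definition dperp (theta : R) phi z :=
  - sin theta * 'D_(1, 0) phi z + cos theta * 'D_(0, 1) phi z.

Lemma test_function_ddir theta phi : test_function phi -> test_function (ddir theta phi).
Proof.
by move=> tp; have [t1 t2] := test_function_partial tp; exact: test_function_comb.
Qed.

Lemma is_derive_rot theta phi p q : test_function phi ->
  is_derive p (1 : R) (fun t => phi (rotation theta (t, q))) (ddir theta phi (rotation theta (p, q))).
Proof.
move=> [cd _].
have DX := is_derive_add (is_derive_scale (cos theta) (is_derive_idr p)) (is_derive_const p (- (q * sin theta))).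
have DY := is_derive_add (is_derive_scale (sin theta) (is_derive_idr p)) (is_derive_const p (q * cos theta)).
have := is_derive_curve (cd 1%N) DX DY.
have E t : (cos theta * t + - (q * sin theta), sin theta * t + q * cos theta) = rotation theta (t, q).
  by rewrite /rotation /=; congr (_, _); ring.
under eq_fun do rewrite E; rewrite E => H; apply: (is_derive_eq H).
by rewrite /ddir /=; ring.
Qed.

Lemma rotation_sqr theta (w : plane R) : (rotation theta w).1 ^+ 2 + (rotation theta w).2 ^+ 2 = w.1 ^+ 2 + w.2 ^+ 2.
Proof.
have cs := cos2Dsin2 theta; transitivity ((cos theta ^+ 2 + sin theta ^+ 2) * (w.1 ^+ 2 + w.2 ^+ 2)).
  by rewrite /rotation /=; ring.
by rewrite cs mul1r.
Qed.

Lemma trig_comb_le theta (a b M : R) : `|a| <= M -> `|b| <= M ->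
  `|cos theta * a + sin theta * b| <= 2 * M /\ `|- sin theta * a + cos theta * b| <= 2 * M.
Proof.
move=> aM bM.
have c1 : `|cos theta| <= 1 by rewrite ler_norml cos_geN1 cos_le1.
have s1 : `|sin theta| <= 1 by rewrite ler_norml sin_geN1 sin_le1.
have B (x y : R) : `|x| <= 1 -> `|y| <= M -> `|x * y| <= M.
  by move=> x1 yM; rewrite normrM (le_trans _ yM)// ler_piMl.
split; rewrite (le_trans (ler_normD _ _))// mulr_natl mulr2n lerD//; apply: B => //.
by rewrite normrN.
Qed.

Lemma ddir_ddir theta phi z : test_function phi -> ddir theta (ddir theta phi) z =
  cos theta * ddir theta (fun z => 'D_(1, 0) phi z) z + sin theta * ddir theta (fun z => 'D_(0, 1) phi z) z.
Proof.
move=> tp; have [t1 t2] := test_function_partial tp.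
have [d11 d12 _ _] := t1.1 1%N; have [d21 d22 _ _] := t2.1 1%N.
have D v : derivable (fun z => 'D_(1, 0) phi z) z v -> derivable (fun z => 'D_(0, 1) phi z) z v ->
   'D_v (ddir theta phi) z = cos theta * 'D_v (fun z => 'D_(1, 0) phi z) z +
      sin theta * 'D_v (fun z => 'D_(0, 1) phi z) z.
  move=> h1 h2; have z1 := derivableZ (k := cos theta) h1; have z2 := derivableZ (k := sin theta) h2.
  by rewrite [LHS](deriveD z1 z2) (deriveZ _ h1) (deriveZ _ h2).
have E1 := D _ (d11 z) (d21 z); have E2 := D _ (d12 z) (d22 z).
have alg (c s a b a' b' : R) :
  c * (c * a + s * b) + s * (c * a' + s * b') = c * (c * a + s * a') + s * (c * b + s * b') by ring.
by rewrite [LHS]/ddir E1 E2; exact: alg.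
Qed.

(** Directional derivatives combine finitely many partial derivatives with coefficients of modulus
    at most 1, so one radius and one bound serve all angles. *)
Lemma test_function_uniform phi : test_function phi -> exists rho M : R, [/\ 0 <= rho, 0 <= M,
  forall z, rho ^+ 2 < z.1 ^+ 2 + z.2 ^+ 2 -> phi z = 0,
  forall theta z, rho ^+ 2 < z.1 ^+ 2 + z.2 ^+ 2 -> ddir theta phi z = 0 /\ dperp theta phi z = 0 &
  forall theta z, [/\ `|phi z| <= M, `|ddir theta phi z| <= M, `|dperp theta phi z| <= M &
    `|ddir theta (ddir theta phi) z| <= M]].
Proof.
move=> tp; have [t1 t2] := test_function_partial tp.
have [t11 t12] := test_function_partial t1; have [t21 t22] := test_function_partial t2.
have [r0 r00 h0] := test_function_support tp.
have [r1 r10 h1] := test_function_support t1.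
have [r2 r20 h2] := test_function_support t2.
have [M0 M00 k0] := test_function_bounded tp.
have [M1 M10 k1] := test_function_bounded t1.
have [M2 M20 k2] := test_function_bounded t2.
have [M11 M110 k11] := test_function_bounded t11.
have [M12 M120 k12] := test_function_bounded t12.
have [M21 M210 k21] := test_function_bounded t21.
have [M22 M220 k22] := test_function_bounded t22.
have rle (r : R) z : 0 <= r -> r <= r0 + r1 + r2 ->
    (r0 + r1 + r2) ^+ 2 < z.1 ^+ 2 + z.2 ^+ 2 -> r ^+ 2 < z.1 ^+ 2 + z.2 ^+ 2.
  move=> r_0 rr; apply: le_lt_trans; apply: lerXn2r; rewrite ?nnegrE ?addr_ge0//.
have [S [S0 SM S1 S2 [S11 S12 S21 S22]]] : exists S : R, [/\ 0 <= S, M0 <= S, M1 <= S, M2 <= S &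
    [/\ M11 <= S, M12 <= S, M21 <= S & M22 <= S]].
  exists (M0 + M1 + M2 + M11 + M12 + M21 + M22).
  by split; [rewrite !addr_ge0|lra|lra|lra|split; lra].
have [S4 S24 S44] : [/\ S <= 4 * S, 2 * S <= 4 * S & 2 * (2 * S) <= 4 * S].
  by clear -S0; split; lra.
exists (r0 + r1 + r2), (4 * S); split.
- by rewrite !addr_ge0.
- by rewrite mulr_ge0.
- by move=> z zr; apply/h0/(rle r0) => //; lra.
- move=> theta z zr; rewrite /ddir /dperp h1 ?h2 ?mulr0 ?addr0//; apply: rle zr => //; lra.
move=> theta z.
have [a1 a2] := @trig_comb_le theta _ _ S (le_trans (k1 z) S1) (le_trans (k2 z) S2).
have [b1 _] := @trig_comb_le theta _ _ S (le_trans (k11 z) S11) (le_trans (k12 z) S12).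
have [c1 _] := @trig_comb_le theta _ _ S (le_trans (k21 z) S21) (le_trans (k22 z) S22).
split.
- exact: le_trans (k0 z) (le_trans SM S4).
- exact: le_trans a1 S24.
- exact: le_trans a2 S24.
- rewrite ddir_ddir//; have [d1 _] := trig_comb_le theta b1 c1.
  exact: le_trans d1 S44.
Qed.

End plane_calculus.

(** * The Hilbert transform of line integrals *)

Lemma Rintegral0_eq d (T : measurableType d) (R : realType)
    (mu : {measure set T -> \bar R}) (D : set T) (f : T -> R) :
  (forall x, f x = 0) -> \int[mu]_(x in D) f x = 0.
Proof.
by move=> f0; rewrite /Rintegral integral0_eq// => x _; rewrite f0.
Qed.

Section segment_support.
Context (R : realType).
Local Notation leb := (@lebesgue_measure R).
Variables (f : R -> R) (L M : R).
Hypotheses (mf : measurable_fun setT f) (L0 : 0 <= L) (fM : forall x, `|f x| <= M)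
  (fL : forall x, L < `|x| -> f x = 0).

Lemma segment_support_integrable : leb.-integrable setT (EFin \o f).
Proof.
apply: (@le_integrable _ _ _ leb _ measurableT _ (fun x => (M * \1_`[- L, L]%classic x)%:E)).
- exact/measurable_EFinP.
- have M0 : 0 <= M by apply: le_trans (fM 0).
  move=> x _ /=; rewrite lee_fin [leRHS]ger0_norm ?mulr_ge0//.
  have [xL|xL] := ltP L `|x|; first by rewrite fL// normr0 mulr_ge0.
  by rewrite indicE mem_set ?mulr1//= in_itv /= -ler_norml.
- have la : (leb `[(- L)%R, L]%classic < +oo)%E.
    by rewrite lebesgue_measure_itv /=; case: ifP => _; rewrite -?EFinD ltry.
  under eq_fun do rewrite EFinM; apply: integrableZl => //.
  by apply: integrable_indic_lty => //; exact: la.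
Qed.

Lemma segment_support_le : `|\int[leb]_x f x| <= M * (2 * L).
Proof.
have -> : \int[leb]_x f x = \int[leb]_(x in `[(- L)%R, L]) f x.
  rewrite [RHS]Rintegral_mkcond; apply: eq_Rintegral => x _; rewrite patchE.
  case: ifPn => //; rewrite notin_setE /= in_itv /= => /negP; rewrite -ler_norml -ltNge.
  exact: fL.
have mE : leb `[(- L)%R, L]%classic = (2 * L)%:E.
  rewrite lebesgue_measure_itv /= lte_fin; case: ltP => LL.
    by rewrite -EFinD opprK; congr (_%:E); ring.
  suff -> : L = 0 by rewrite mulr0.
  have L1 : - L <= 0 by rewrite oppr_le0.
  by apply/le_anti/andP; split => //; exact: le_trans LL L1.
have ml : (leb `[(- L)%R, L]%classic < +oo)%E by rewrite mE ltry.
have mf' : `|fine (leb `[(- L)%R, L]%classic)| = 2 * L.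
  by rewrite mE /= ger0_norm// mulr_ge0.
have H := bounded_Rintegral (m := leb) (measurable_itv `[(- L)%R, L]) ml (measurable_funTS mf) (fun x _ => fM x).
apply: (le_trans H); have M0 : 0 <= M by apply: le_trans (fM 0).
by apply: ler_wpM2l => //; rewrite -mf'; exact: ler_norm.
Qed.

End segment_support.

Lemma Rfubini1 d1 d2 (T1 : measurableType d1) (T2 : measurableType d2) (R : realType)
    (m1 : {sigma_finite_measure set T1 -> \bar R}) (m2 : {sigma_finite_measure set T2 -> \bar R})
    (f : T1 * T2 -> R) :
  (m1 \x m2)%E.-integrable setT (EFin \o f) ->
  (forall x, m2.-integrable setT (fun y => (f (x, y))%:E)) ->
  \int[(m1 \x m2)%E]_z f z = \int[m1]_x \int[m2]_y f (x, y).
Proof.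
move=> intf fx; have E := integral12_prod_meas1 intf.
rewrite /Rintegral -[X in fine X = _]E; congr fine; apply: eq_integral => x _.
by rewrite fineK//; exact: (integrable_fin_num measurableT (fx x)).
Qed.

Section kernel.
Context (R : realType).
Local Notation leb := (@lebesgue_measure R).
Local Notation leb2 := (@lebesgue2 R).
Implicit Types (psi : plane R -> R).

(* Pairing [u] with [- u] makes p.v. 1 / (pi u), applied to
   [u |-> \int psi (s + u, q) dq], an absolutely convergent plane integral. *)
Definition kern psi (s : R) (z : plane R) : R :=
  if 0 < z.1 then (psi (s + z.1, z.2) - psi (s - z.1, z.2)) / (pi * z.1) else 0.

Definition hil psi (s : R) := \int[leb2]_z kern psi s z.

Definition box (a b : R) : set (plane R) := `]0%R, a]%classic `*` `[- b, b]%classic.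

Lemma measurable_box a b : measurable (box a b).
Proof. by apply: measurableX; exact: measurable_itv. Qed.

Lemma box_lty a b : (leb2 (box a b) < +oo)%E.
Proof.
rewrite -[X in (X < _)%E]/((leb \x leb)%E (box a b)) product_measure1E//.
have la : (leb `]0%R, a]%classic < +oo)%E.
  by rewrite lebesgue_measure_itv /=; case: ifP => _; rewrite -?EFinD ltry.
have lb : (leb `[(- b)%R, b]%classic < +oo)%E.
  by rewrite lebesgue_measure_itv /=; case: ifP => _; rewrite -?EFinD ltry.
by apply: lte_mul_pinfty => //; rewrite ge0_fin_numE.
Qed.

Lemma measurable_kern psi s : measurable_fun setT psi -> measurable_fun setT (kern psi s).
Proof.
move=> mp.
have m1 : measurable_fun setT (fun z : plane R => z.1) by exact: measurable_fst.
have m2 : measurable_fun setT (fun z : plane R => z.2) by exact: measurable_snd.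
apply: measurable_fun_ifT; last exact: measurable_cst.
  by apply: measurable_fun_ltr => //; exact: measurable_cst.
apply: measurable_funM.
  apply: measurable_funB; apply: (measurableT_comp mp); apply: measurable_fun_pair => //.
    exact: measurable_funD.
  exact: measurable_funB.
by apply: (measurableT_comp (@measurable_inv R)); exact: measurable_funM.
Qed.

Section bounds.
Variables (psi psi1 : plane R -> R) (rho M : R).
Hypotheses (dpsi : forall p q, is_derive p (1 : R) (fun t => psi (t, q)) (psi1 (p, q)))
  (mpsi : measurable_fun setT psi) (rho0 : 0 <= rho) (M0 : 0 <= M)
  (psiM : forall z, `|psi1 z| <= M)
  (psi_support : forall z, rho ^+ 2 < z.1 ^+ 2 + z.2 ^+ 2 -> psi z = 0).

Lemma psi_support1 p q : rho < `|p| -> psi (p, q) = 0.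
Proof.
move=> rp; apply: psi_support => /=; rewrite ltr_wpDr ?sqr_ge0// -[p ^+ 2]real_normK ?num_real//.
by rewrite ltrXn2r.
Qed.

Lemma psi_support2 p q : rho < `|q| -> psi (p, q) = 0.
Proof.
move=> rp; apply: psi_support => /=; rewrite ltr_wpDl ?sqr_ge0// -[q ^+ 2]real_normK ?num_real//.
by rewrite ltrXn2r.
Qed.

(** By the mean value theorem the quotient is [2 / pi] times a value of [psi1], and [2 <= pi]. *)
Lemma kern_le s z : `|kern psi s z| <= M.
Proof.
rewrite /kern; case: ifPn => z1; last by rewrite normr0.
have [c [_ _ ->]] := mean_value (s - z.1) (s + z.1) (fun t => dpsi t z.2).
have -> : psi1 (c, z.2) * (s + z.1 - (s - z.1)) / (pi * z.1) = psi1 (c, z.2) * (2 / pi).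
  have pn : pi != 0 :> R by rewrite gt_eqF// pi_gt0.
  have zn : z.1 != 0 by rewrite gt_eqF.
  rewrite (_ : s + z.1 - (s - z.1) = 2 * z.1); last by ring.
  by rewrite -mulrA -mulf_div divff// mulr1.
rewrite normrM (le_trans _ (psiM (c, z.2)))// ler_piMr// ger0_norm ?divr_ge0 ?pi_ge0//.
by rewrite ler_pdivrMr ?pi_gt0// mul1r pi_ge2.
Qed.

Lemma kern_support S s z : `|s| <= S -> ~ box (rho + S) rho z -> kern psi s z = 0.
Proof.
move=> sS nb; rewrite /kern; case: ifPn => // z1; move: z z1 nb => [u v] /= u0 nb.
have [vr|vr] := ltP rho `|v|; first by rewrite !psi_support2// subrr mul0r.
have ur : rho + S < u.
  rewrite ltNge; apply/negP => ur; apply: nb; split; rewrite /= in_itv /= ?u0//.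
  by rewrite -ler_norml.
move: sS; rewrite ler_norml => /andP[s1 s2].
rewrite !psi_support1 ?subrr ?mul0r// ltr_normr; apply/orP; [right|left]; lra.
Qed.

Lemma kern_le_indic S s z : `|s| <= S -> `|kern psi s z| <= M * \1_(box (rho + S) rho) z.
Proof.
move=> sS; rewrite indicE; have [b|nb] := pselect (box (rho + S) rho z).
  by rewrite mem_set// mulr1 kern_le.
by rewrite (kern_support sS nb) normr0 mulr_ge0.
Qed.

Lemma integrable_kern s : leb2.-integrable setT (EFin \o kern psi s).
Proof.
apply: (@le_integrable _ _ _ leb2 _ measurableT _ (fun z => (M * \1_(box (rho + `|s|) rho) z)%:E)).
- by apply/measurable_EFinP; exact: measurable_kern.
- move=> z _ /=; rewrite lee_fin [leRHS]ger0_norm ?mulr_ge0//.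
  exact: kern_le_indic.
- under eq_fun do rewrite EFinM; apply: integrableZl => //.
  by apply: integrable_indic_lty; [exact: measurable_box|exact: box_lty].
Qed.

End bounds.

Lemma is_derive_shift (f : R -> R) s c df : is_derive (s + c) (1 : R) f df ->
  is_derive s (1 : R) (fun t => f (t + c)) df.
Proof.
have E : (fun h : R => h^-1 *: (((fun t => f (t + c)) \o shift s) (h *: 1) - f (s + c))) =
    (fun h : R => h^-1 *: ((f \o shift (s + c)) (h *: 1) - f (s + c))).
  by apply/funext => h /=; rewrite addrA.
by move=> [df1 df2]; split; [rewrite /derivable E|rewrite /derive E].
Qed.

Lemma is_derive_kern psi psi1 s z :
  (forall p q, is_derive p (1 : R) (fun t => psi (t, q)) (psi1 (p, q))) ->
  is_derive s (1 : R) (fun s => kern psi s z) (kern psi1 s z).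
Proof.
move=> dpsi; rewrite /kern; case: ifPn => z1; last exact: is_derive_const.
have D c : is_derive s (1 : R) (fun t => psi (t + c, z.2)) (psi1 (s + c, z.2)).
  exact: (@is_derive_shift (fun t => psi (t, z.2)) s c _ (dpsi (s + c) z.2)).
have H := is_derive_scale (pi * z.1)^-1 (is_derive_add (D z.1) (is_derive_scale (-1) (D (- z.1)))).
have -> : (fun s => (psi (s + z.1, z.2) - psi (s - z.1, z.2)) / (pi * z.1)) =
  (fun s => (pi * z.1)^-1 * (psi (s + z.1, z.2) + -1 * psi (s + - z.1, z.2))).
  by apply/funext => t; rewrite mulN1r mulrC.
by apply: (is_derive_eq H); rewrite mulN1r mulrC.
Qed.

(** The kernel is linear in [psi], so its derivative in [s] is the kernel of [psi1], dominated for
    parameters near [s] by the indicator of one fixed box. *)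
Lemma is_derive_hil psi psi1 psi2 rho M s :
  (forall p q, is_derive p (1 : R) (fun t => psi (t, q)) (psi1 (p, q))) ->
  (forall p q, is_derive p (1 : R) (fun t => psi1 (t, q)) (psi2 (p, q))) ->
  measurable_fun setT psi -> measurable_fun setT psi1 -> 0 <= rho -> 0 <= M ->
  (forall z, `|psi1 z| <= M) -> (forall z, `|psi2 z| <= M) ->
  (forall z, rho ^+ 2 < z.1 ^+ 2 + z.2 ^+ 2 -> psi z = 0) ->
  (forall z, rho ^+ 2 < z.1 ^+ 2 + z.2 ^+ 2 -> psi1 z = 0) ->
  derivable (hil psi) s 1 /\ derive1 (hil psi) s = hil psi1 s.
Proof.
move=> d1 d2 m m1 rho0 M0 p1M p2M sp sp1.
have Is : `](s - 1), (s + 1)[%classic s by rewrite /= in_itv /= ltrBlDr ltrDl ltr01.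
have If t : `](s - 1), (s + 1)[%classic t -> leb2.-integrable setT (EFin \o kern psi t).
  by move=> _; exact: (integrable_kern d1 m rho0 M0 p1M sp).
have Id t z : `](s - 1), (s + 1)[%classic t -> setT z -> derivable ((kern psi) ^~ z) t 1.
  by move=> _ _; have [] := is_derive_kern t z d1.
pose G (z : plane R) : R := M * \1_(box (rho + (`|s| + 1)) rho) z.
have G0 z : 0 <= G z by rewrite mulr_ge0.
have IG : leb2.-integrable setT (EFin \o G).
  rewrite /G /comp; under eq_fun do rewrite EFinM; apply: integrableZl => //.
  by apply: integrable_indic_lty; [exact: measurable_box|exact: box_lty].
have pE t z : partial1of2 (kern psi) t z = kern psi1 t z.
  by rewrite partial1of2E; have [_ ->] := is_derive_kern t z d1.
have Gu t z : `](s - 1), (s + 1)[%classic t -> setT z -> `|partial1of2 (kern psi) t z| <= G z.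
  rewrite /= in_itv /= => /andP[t1 t2] _; rewrite pE.
  rewrite /G; apply: (kern_le_indic d2 rho0 M0 p2M sp1).
  by have := ler_norm s; have := ler_norm (- s); rewrite normrN ler_norml => ? ?; apply/andP; split; lra.
split; first exact: (@derivable_under_integral R _ (plane R) leb2 (kern psi) setT measurableT s _ _ Is If Id G G0 IG Gu).
rewrite (@differentiation_under_integral R _ (plane R) leb2 (kern psi) setT measurableT s _ _ Is If Id G G0 IG Gu).
by apply: eq_Rintegral => z _; exact: pE.
Qed.

Lemma pv_quotient_le (a c e u : R) : 0 < e -> e < `|u| -> `|a| <= c ->
  `|a / (pi * u)| <= c / e.
Proof.
move=> e0 eu ac; have up : e <= pi * `|u|.
  apply: (le_trans (ltW eu)); rewrite ler_peMl// (le_trans _ (pi_ge2 R))// ler1n.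
  by [].
have c0 : 0 <= c := le_trans (normr_ge0 a) ac.
have p0 : 0 < pi * `|u| := lt_le_trans e0 up.
rewrite normrM normfV normrM (ger0_norm (pi_ge0 R)) ler_pdivrMr//.
rewrite -mulrA [e^-1 * _]mulrC mulrA ler_pdivlMr//.
by rewrite ler_pM// ltW.
Qed.

(** Reflecting the part [u < - e] of the truncated integral onto [u > e] leaves the integral of [k]
    over [u > e]. As [k] is bounded, the missing piece is at most proportional to [e]. *)
Lemma pv_inv_hil psi psi1 rho M s :
  (forall p q, is_derive p (1 : R) (fun t => psi (t, q)) (psi1 (p, q))) ->
  measurable_fun setT psi -> 0 <= rho -> 0 <= M ->
  (forall z, `|psi1 z| <= M) -> (forall z, `|psi z| <= M) ->
  (forall z, rho ^+ 2 < z.1 ^+ 2 + z.2 ^+ 2 -> psi z = 0) ->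
  pv_inv (fun u => \int[leb]_q psi (s + u, q)) = hil psi s.
Proof.
move=> d1 m rho0 M0 p1M pM sp.
have sp1 p q : rho < `|p| -> psi (p, q) = 0 by exact: (psi_support1 rho0 sp).
have sp2 p q : rho < `|q| -> psi (p, q) = 0 by exact: (psi_support2 rho0 sp).
pose Psi p := \int[leb]_q psi (p, q).
pose k u := \int[leb]_q kern psi s (u, q).
have msec (f : plane R -> R) u : measurable_fun setT f -> measurable_fun setT (fun q : R => f (u, q)).
  by move=> mf; exact: (measurableT_comp mf (pair1_measurable u)).
have ip p : leb.-integrable setT (EFin \o (fun q => psi (p, q))).
  exact: (segment_support_integrable (msec _ p m) (fun q => pM (p, q)) (sp2 p)).
have mk := measurable_kern s m.
have kle := kern_le d1 M0 p1M s.
have ks2 u q : rho < `|q| -> kern psi s (u, q) = 0.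
  by move=> qr; rewrite /kern /= !sp2// subrr mul0r if_same.
have iker u : leb.-integrable setT (EFin \o (fun q => kern psi s (u, q))).
  exact: (segment_support_integrable (msec _ u mk) (fun q => kle (u, q)) (ks2 u)).
have kE u : k u = if 0 < u then (Psi (s + u) - Psi (s - u)) / (pi * u) else 0.
  rewrite /k /kern /=; case: ifPn => u0; last by rewrite Rintegral_cst// mul0r.
  by rewrite RintegralZr ?RintegralB//; exact: integrable_sub.
have ikern := integrable_kern d1 m rho0 M0 p1M sp s.
have hE : hil psi s = \int[leb]_u k u by rewrite -(Rfubini1 ikern iker).
have kM u : `|k u| <= M * (2 * rho).
  exact: (segment_support_le (msec _ u mk) rho0 (fun q => kle (u, q)) (ks2 u)).
have mkk : measurable_fun setT k by exact: (measurable_Rintegral_snd leb measurableT mk).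
have kL u : rho + `|s| < `|u| -> k u = 0.
  move=> ur; apply: Rintegral0_eq => q.
  apply: (kern_support rho0 sp (lexx _)) => -[/=]; rewrite in_itv /= => /andP[u0 u1] _.
  by move: ur; rewrite (gtr0_norm u0) ltNge u1.
have ik : leb.-integrable setT (EFin \o k).
  exact: (segment_support_integrable mkk kM kL).
have mPsi : measurable_fun setT Psi by exact: (measurable_Rintegral_snd leb measurableT m).
have PsiM p : `|Psi p| <= M * (2 * rho).
  exact: (segment_support_le (msec _ p m) rho0 (fun q => pM (p, q)) (sp2 p)).
have PsiL p : rho < `|p| -> Psi p = 0.
  move=> ur; apply: Rintegral0_eq => q.
  exact: sp1.
have cut e : 0 < e -> \int[leb]_(u in [set u | e < `|u|]) (Psi (s + u) / (pi * u)) =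
   \int[leb]_u (if e < u then k u else 0).
  move=> e0.
  pose gA u := if e < u then Psi (s + u) / (pi * u) else 0.
  pose gB u := if u < - e then Psi (s + u) / (pi * u) else 0.
  have mg : measurable_fun setT (fun u => Psi (s + u) / (pi * u)).
    apply: measurable_funM.
      by apply: (measurableT_comp mPsi); apply: measurable_funD.
    by apply: (measurableT_comp (@measurable_inv R)); exact: measurable_funM.
  have gM u : e < `|u| -> `|Psi (s + u) / (pi * u)| <= M * (2 * rho) / e.
    by move=> eu; exact: pv_quotient_le.
  have gL u : rho + `|s| < `|u| -> Psi (s + u) / (pi * u) = 0.
    move=> ur; rewrite PsiL ?mul0r//; have := ler_normB (s + u) s.
    by rewrite addrC addKr; lra.
  have C0 : 0 <= M * (2 * rho) / e by rewrite divr_ge0 ?mulr_ge0// ltW.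
  have mA : measurable_fun setT gA.
    apply: measurable_fun_ifT => //.
    by apply: measurable_fun_ltr => //; exact: measurable_cst.
  have mB : measurable_fun setT gB.
    apply: measurable_fun_ifT => //.
    by apply: measurable_fun_ltr => //; exact: measurable_cst.
  have AM u : `|gA u| <= M * (2 * rho) / e.
    rewrite /gA; case: ifPn => eu; last by rewrite normr0.
    by apply: gM; rewrite (lt_le_trans eu)// ler_norm.
  have BM u : `|gB u| <= M * (2 * rho) / e.
    rewrite /gB; case: ifPn => eu; last by rewrite normr0.
    by apply: gM; rewrite -normrN (lt_le_trans _ (ler_norm _))// ltrNr.
  have AL u : rho + `|s| < `|u| -> gA u = 0 by move=> /gL h; rewrite /gA h if_same.
  have BL u : rho + `|s| < `|u| -> gB u = 0 by move=> /gL h; rewrite /gB h if_same.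
  have iA : leb.-integrable setT (EFin \o gA) by exact: (segment_support_integrable mA AM AL).
  have iB : leb.-integrable setT (EFin \o gB) by exact: (segment_support_integrable mB BM BL).
  have iB' : leb.-integrable setT (EFin \o (gB \o affine (-1) 0)).
    apply: (segment_support_integrable (L := rho + `|s|) (measurableT_comp mB (measurable_affine _ _)) (fun u => BM _)).
    by move=> u ur; apply: BL; rewrite /affine mulN1r addr0 normrN.
  transitivity (\int[leb]_u (gA u + gB u)).
    rewrite Rintegral_mkcond; apply: eq_Rintegral => u _; rewrite patchE /gA /gB.
    case: ifPn; rewrite ?inE ?notin_setE /=.
      rewrite ltr_normr => /orP[eu|eu].
        by rewrite eu ifF ?addr0//; apply/negbTE; rewrite -leNgt; lra.
      by rewrite [u < - e]ltrNr eu ifF ?add0r//; apply/negbTE; rewrite -leNgt; lra.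
    move=> /negP; rewrite -leNgt ler_norml => /andP[u1 u2].
    by rewrite !ifF ?addr0//; apply/negbTE; rewrite -leNgt.
  rewrite RintegralD// (Rintegral_affine _ mB iB') ?oppr_eq0 ?oner_neq0// normrN1 mul1r.
  rewrite -RintegralD//; apply: eq_Rintegral => u _; rewrite /gA /gB /affine kE mulN1r addr0 ltrN2.
  case: ifPn => eu; last by rewrite addr0.
  by rewrite (lt_trans e0 eu) mulrN invrN mulrN -mulrBl.
rewrite /pv_inv; apply/cvg_lim => //.
apply/cvgrPdist_le => e e0.
have N0 : 0 < M * (2 * rho) * 2 + 1 by rewrite ltr_wpDl// !mulr_ge0.
near=> d; have d0 : 0 < d by near: d; exact: nbhs_right_gt.
have mc : measurable_fun setT (fun u => if d < u then k u else 0).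
  apply: measurable_fun_ifT => //.
  by apply: measurable_fun_ltr => //; exact: measurable_cst.
have ic : leb.-integrable setT (EFin \o (fun u => if d < u then k u else 0)).
  apply: (segment_support_integrable (L := rho + `|s|) (M := M * (2 * rho)) mc).
    by move=> u; case: ifPn => // _; rewrite normr0 !mulr_ge0.
  by move=> u /kL ->; rewrite if_same.
rewrite -/Psi cut// hE -RintegralB//.
apply: (@le_trans _ _ (M * (2 * rho) * (2 * d))).
  apply: segment_support_le; [exact: measurable_funB|exact: ltW| |].
  - move=> u; case: ifPn => // _; first by rewrite subrr normr0 !mulr_ge0.
    by rewrite subr0.
  - move=> u; rewrite ltr_normr => /orP[du|du]; first by rewrite du subrr.
    by rewrite kE !ifF ?subrr//; apply/negbTE; rewrite -leNgt; lra.
(* The [+ 1] keeps the denominator positive when the bound is 0. *)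
have : d <= e / (M * (2 * rho) * 2 + 1).
  by near: d; apply: nbhs_right_le; rewrite divr_gt0.
rewrite ler_pdivlMr// => /(le_trans _); apply.
by rewrite mulrDr mulr1 [d * _]mulrC mulrA lerDl ltW.
Unshelve. all: end_near. Qed.

End kernel.

(** * Radon inversion *)

Section calculus.
Context (R : realType).
Local Notation leb := (@lebesgue_measure R).

Lemma FTC2 (f F : R -> R) a b : a <= b -> (forall x, is_derive x (1 : R) F (f x)) ->
  continuous f -> \int[leb]_(x in `[a, b]) f x = F b - F a.
Proof.
rewrite le_eqVlt => /predU1P[<-|ab] dF cf.
  by rewrite set_itv1 Rintegral_set1 subrr.
have cF : continuous F.
  by move=> x; apply/differentiable_continuous/derivable1_diffP; have [] := dF x.
rewrite /Rintegral (@continuous_FTC2 _ f F)//.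
- by apply: continuous_subspaceT => x; exact: cf.
- split.
  + by move=> x _; have [] := dF x.
  + by apply: cvg_at_right_filter; exact: cF.
  + by apply: cvg_at_left_filter; exact: cF.
- by move=> x _; rewrite derive1E; have [_ ->] := dF x.
Qed.

Lemma integral_oneDsqrV : (\int[leb]_x ((oneDsqr x)^-1)%:E = pi%:E)%E.
Proof.
rewrite (@ge0_symfun_integralT _ (fun x => (oneDsqr x)^-1)).
- by rewrite -set_itvcy integral0y_oneDsqr -EFinM mulrCA divff// mulr1.
- by move=> x; rewrite invr_ge0.
- exact: continuous_oneDsqrV.
- by move=> x /=; rewrite /oneDsqr sqrrN.
Qed.

End calculus.

Section radon.
Context (R : realType).
Local Notation leb := (@lebesgue_measure R).
Local Notation leb2 := (@lebesgue2 R).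
Variable z : R * R.
Implicit Types phi : R * R -> R.

Definition addrot (theta : R) (w : plane R) : plane R :=
  (z.1 + (rotation theta w).1, z.2 + (rotation theta w).2).

Lemma is_derive_addrot_angle phi theta (w : plane R) : test_function phi ->
  is_derive theta (1 : R) (fun t => phi (addrot t w))
   (w.1 * dperp theta phi (addrot theta w) - w.2 * ddir theta phi (addrot theta w)).
Proof.
move=> tp; have Dc := is_derive_cos theta; have Ds := is_derive_sin theta.
have DX := is_derive_add (is_derive_const theta z.1)
  (is_derive_add (is_derive_scale w.1 Dc) (is_derive_scale (- w.2) Ds)).
have DY := is_derive_add (is_derive_const theta z.2)
  (is_derive_add (is_derive_scale w.1 Ds) (is_derive_scale w.2 Dc)).
have := is_derive_curve (tp.1 1%N) DX DY.
have E t : (z.1 + (w.1 * cos t + - w.2 * sin t), z.2 + (w.1 * sin t + w.2 * cos t)) = addrot t w.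
  by rewrite /addrot /rotation /=; congr (_, _); ring.
under eq_fun do rewrite E; rewrite E => H; apply: (is_derive_eq H).
by rewrite /ddir /dperp /=; ring.
Qed.

Lemma is_derive_addrot_ray phi theta a b u : test_function phi ->
  is_derive u (1 : R) (fun u => phi (addrot theta (u * a, u * b)))
   (a * ddir theta phi (addrot theta (u * a, u * b)) +
    b * dperp theta phi (addrot theta (u * a, u * b))).
Proof.
move=> tp; have DX := is_derive_add (is_derive_const u z.1)
  (is_derive_scale (a * cos theta - b * sin theta) (is_derive_idr u)).
have DY := is_derive_add (is_derive_const u z.2)
  (is_derive_scale (a * sin theta + b * cos theta) (is_derive_idr u)).
have := is_derive_curve (tp.1 1%N) DX DY.
have E v : (z.1 + (a * cos theta - b * sin theta) * v, z.2 + (a * sin theta + b * cos theta) * v) =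
   addrot theta (v * a, v * b).
  by rewrite /addrot /rotation /=; congr (_, _); ring.
under eq_fun do rewrite E; rewrite E => H; apply: (is_derive_eq H).
by rewrite /ddir /dperp /=; ring.
Qed.

Lemma is_derive_addrot1 phi theta p q : test_function phi ->
  is_derive p (1 : R) (fun t => phi (addrot theta (t, q))) (ddir theta phi (addrot theta (p, q))).
Proof.
move=> tp; have DX := is_derive_add (is_derive_const p (z.1 - q * sin theta))
  (is_derive_scale (cos theta) (is_derive_idr p)).
have DY := is_derive_add (is_derive_const p (z.2 + q * cos theta))
  (is_derive_scale (sin theta) (is_derive_idr p)).
have := is_derive_curve (tp.1 1%N) DX DY.
have E v : (z.1 - q * sin theta + cos theta * v, z.2 + q * cos theta + sin theta * v) =
   addrot theta (v, q).
  by rewrite /addrot /rotation /=; congr (_, _); ring.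
under eq_fun do rewrite E; rewrite E => H; apply: (is_derive_eq H).
by rewrite /ddir /=; ring.
Qed.

Lemma addrot_bounds phi : test_function phi -> exists L M : R, [/\ 0 < L, 0 <= M,
  forall theta (w : plane R), L ^+ 2 <= w.1 ^+ 2 + w.2 ^+ 2 -> [/\ phi (addrot theta w) = 0,
    ddir theta phi (addrot theta w) = 0 & dperp theta phi (addrot theta w) = 0] &
  forall theta (w : plane R), [/\ `|phi (addrot theta w)| <= M, `|ddir theta phi (addrot theta w)| <= M,
    `|dperp theta phi (addrot theta w)| <= M &
    `|ddir theta (ddir theta phi) (addrot theta w)| <= M]].
Proof.
move=> /test_function_uniform[rho [M [rho0 M0 ps ds bd]]].
exists (2 * (rho + `|z.1| + `|z.2| + 1)), M; split; [|exact: M0| |exact: (fun theta w => bd theta (addrot theta w))].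
  by apply: mulr_gt0; [exact: ltr0n|apply: ltr_wpDl; [apply: addr_ge0; [apply: addr_ge0|]|]].
move=> theta w Lw; suff H : rho ^+ 2 < (addrot theta w).1 ^+ 2 + (addrot theta w).2 ^+ 2.
  by split; [exact: ps|have [] := ds theta _ H|have [] := ds theta _ H].
(* From [(x + 2 * a) ^+ 2 >= 0] one gets [(a + x) ^+ 2 >= x ^+ 2 / 2 - a ^+ 2]; this accounts for
   the factor 4, and for the factor 2 in the radius. *)
have alg (x y a b K : R) : 4 * (rho ^+ 2 + a ^+ 2 + b ^+ 2) < K -> K <= x ^+ 2 + y ^+ 2 ->
    rho ^+ 2 < (a + x) ^+ 2 + (b + y) ^+ 2.
  clear; have := sqr_ge0 (x + 2 * a); have := sqr_ge0 (y + 2 * b).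
  have := sqr_ge0 rho; have := sqr_ge0 a; have := sqr_ge0 b.
  by rewrite !expr2 => *; lra.
rewrite -(rotation_sqr theta w) in Lw; apply: alg Lw.
have E t : t ^+ 2 = `|t| ^+ 2 :> R by rewrite real_normK ?num_real.
rewrite (E z.1) (E z.2); move: rho0 (normr_ge0 z.1) (normr_ge0 z.2); clear.
by move: `|z.1| `|z.2| => a b r0 a0 b0; nra.
Qed.

Lemma measurable_addrot d (T : measurableType d) (th : T -> R) (w : T -> plane R) :
  measurable_fun setT th -> measurable_fun setT w ->
  measurable_fun setT (fun x => addrot (th x) (w x)).
Proof.
move=> mth mw.
have mc : measurable_fun setT (cos \o th).
  by apply: measurableT_comp => //; apply: continuous_measurable_fun; exact: continuous_cos.
have ms : measurable_fun setT (sin \o th).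
  by apply: measurableT_comp => //; apply: continuous_measurable_fun; exact: continuous_sin.
have m1 : measurable_fun setT (fun x => (w x).1) by exact: (measurableT_comp measurable_fst mw).
have m2 : measurable_fun setT (fun x => (w x).2) by exact: (measurableT_comp measurable_snd mw).
apply: measurable_fun_pair; apply: measurable_funD; try exact: measurable_cst.
  by apply: measurable_funB; apply: measurable_funM.
by apply: measurable_funD; apply: measurable_funM.
Qed.

Lemma measurable_ddir_addrot phi d (T : measurableType d) (th : T -> R) (w : T -> plane R) :
  test_function phi -> measurable_fun setT th -> measurable_fun setT w ->
  measurable_fun setT (fun x => ddir (th x) phi (addrot (th x) (w x))) /\
  measurable_fun setT (fun x => dperp (th x) phi (addrot (th x) (w x))).
Proof.
move=> tp mth mw; have ma := measurable_addrot mth mw.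
have [t1 t2] := test_function_partial tp.
have mc : measurable_fun setT (cos \o th).
  by apply: measurableT_comp => //; apply: continuous_measurable_fun; exact: continuous_cos.
have ms : measurable_fun setT (sin \o th).
  by apply: measurableT_comp => //; apply: continuous_measurable_fun; exact: continuous_sin.
have m1 := measurableT_comp (continuous_measurable_plane (t1.1 0%N)) ma.
have m2 := measurableT_comp (continuous_measurable_plane (t2.1 0%N)) ma.
have mns : measurable_fun setT (fun x => - sin (th x)) by exact: measurable_funN.
split.
  exact: (measurable_funD (measurable_funM mc m1) (measurable_funM ms m2)).
exact: (measurable_funD (measurable_funM mns m1) (measurable_funM mc m2)).
Qed.

Lemma continuous_ddir_addrot phi (w : plane R) : test_function phi ->
  continuous (fun t : R => ddir t phi (addrot t w)) /\ continuous (fun t : R => dperp t phi (addrot t w)).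
Proof.
move=> tp; have [t1 t2] := test_function_partial tp.
have C f : test_function f -> continuous (fun t : R => f (addrot t w)).
  move=> tf r; apply/differentiable_continuous/derivable1_diffP.
  by have [] := is_derive_addrot_angle r w tf.
have cc := @continuous_cos R; have cs := @continuous_sin R.
have cns : continuous (fun r : R => - sin r) by move=> r; exact: (cvgN (cs r)).
split=> r; apply: cvgD.
- exact: (cvgM (cc r) (C _ t1 r)).
- exact: (cvgM (cs r) (C _ t2 r)).
- exact: (cvgM (cns r) (C _ t1 r)).
- exact: (cvgM (cc r) (C _ t2 r)).
Qed.

Lemma continuous_ddir_ray phi theta a b : test_function phi ->
  continuous (fun u : R => ddir theta phi (addrot theta (u * a, u * b))) /\
  continuous (fun u : R => dperp theta phi (addrot theta (u * a, u * b))).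
Proof.
move=> tp; have [t1 t2] := test_function_partial tp.
have C f : test_function f -> continuous (fun u : R => f (addrot theta (u * a, u * b))).
  move=> tf r; apply/differentiable_continuous/derivable1_diffP.
  by have [] := is_derive_addrot_ray theta a b r tf.
split=> r; apply: cvgD.
- exact: (cvgM (cvg_cst _) (C _ t1 r)).
- exact: (cvgM (cvg_cst _) (C _ t2 r)).
- exact: (cvgM (cvg_cst _) (C _ t1 r)).
- exact: (cvgM (cvg_cst _) (C _ t2 r)).
Qed.

End radon.

Section iterated.
Context (R : realType).
Local Notation leb := (@lebesgue_measure R).
Local Notation leb2 := (@lebesgue2 R).
Implicit Types (psi : plane R -> R).

Lemma section_measurable (f : plane R -> R) u : measurable_fun setT f ->
  measurable_fun setT (fun q : R => f (u, q)).
Proof. by move=> mf; exact: (measurableT_comp mf (pair1_measurable u)). Qed.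

Lemma box_integrable (f : plane R -> R) a b M : measurable_fun setT f -> 0 <= M ->
  (forall w, `|f w| <= M) -> (forall w, ~ box a b w -> f w = 0) ->
  leb2.-integrable setT (EFin \o f).
Proof.
move=> mf M0 fM fb.
apply: (@le_integrable _ _ _ leb2 _ measurableT _ (fun z => (M * \1_(box a b) z)%:E)).
- exact/measurable_EFinP.
- move=> z _ /=; rewrite lee_fin [leRHS]ger0_norm ?mulr_ge0// indicE.
  have [bz|nb] := pselect (box a b z); first by rewrite mem_set// mulr1.
  by rewrite fb// normr0 mulr_ge0.
- under eq_fun do rewrite EFinM; apply: integrableZl => //.
  by apply: integrable_indic_lty; [exact: measurable_box|exact: box_lty].
Qed.

Lemma box_iterated (f : plane R -> R) a b M : measurable_fun setT f -> 0 <= b -> 0 <= M ->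
  (forall w, `|f w| <= M) -> (forall w, ~ box a b w -> f w = 0) ->
  \int[leb2]_w f w = \int[leb]_u \int[leb]_v f (u, v).
Proof.
move=> mf b0 M0 fM fb; apply: (Rfubini1 (box_integrable mf M0 fM fb)) => u.
apply: (segment_support_integrable (L := b) (section_measurable u mf) (fun q => fM (u, q))) => q bq.
apply: fb => -[_] /=; rewrite in_itv /= -ler_norml => /(lt_le_trans bq).
by rewrite ltxx.
Qed.

Lemma Rintegral_box (f : plane R -> R) a b : (forall w, ~ box a b w -> f w = 0) ->
  \int[leb2]_w f w = \int[leb2]_(w in box a b) f w.
Proof.
move=> fb; rewrite [RHS]Rintegral_mkcond; apply: eq_Rintegral => w _; rewrite patchE.
by case: ifPn => //; rewrite notin_setE => /fb.
Qed.

(** A translation of the first coordinate is absorbed by [s], one of the second by the invariance of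
    the integral over it. *)
Lemma hil_shift psi psi' dpsi dpsi' s b rho rho' M :
  (forall p q, is_derive p (1 : R) (fun t => psi (t, q)) (dpsi (p, q))) ->
  (forall p q, is_derive p (1 : R) (fun t => psi' (t, q)) (dpsi' (p, q))) ->
  measurable_fun setT psi -> measurable_fun setT psi' -> 0 <= rho -> 0 <= rho' -> 0 <= M ->
  (forall z, `|dpsi z| <= M) -> (forall z, `|dpsi' z| <= M) ->
  (forall z, rho ^+ 2 < z.1 ^+ 2 + z.2 ^+ 2 -> psi z = 0) ->
  (forall z, rho' ^+ 2 < z.1 ^+ 2 + z.2 ^+ 2 -> psi' z = 0) ->
  (forall p q, psi' (p, q) = psi (s + p, b + q)) ->
  hil psi s = hil psi' 0.
Proof.
move=> d d' m m' r0 r0' M0 bd bd' sp sp' E.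
have kb := kern_support r0 sp (lexx `|s|).
have kb' := kern_support r0' sp' (lexx `|0 : R|).
have kle := kern_le d M0 bd s; have kle' := kern_le d' M0 bd' 0.
have mk := measurable_kern s m; have mk' := measurable_kern 0 m'.
rewrite /hil (box_iterated mk r0 M0 kle kb) (box_iterated mk' r0' M0 kle' kb').
apply: eq_Rintegral => u _.
have kE v : kern psi' 0 (u, v) = kern psi s (u, affine 1 b v).
  rewrite /kern /= !E add0r sub0r /affine mul1r [b + v]addrC.
  by [].
have mku := section_measurable u mk.
have mku' := section_measurable u mk'.
rewrite (@Rintegral_affine _ 1 b (fun v => kern psi s (u, v)))//.
- by rewrite normr1 mul1r; apply: eq_Rintegral => v _; rewrite kE.
- rewrite (_ : _ \o _ = (fun v => (kern psi' 0 (u, v))%:E)); last first.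
    by apply/funext => v /=; rewrite kE.
  apply: (segment_support_integrable (L := rho') mku' (fun q => kle' (u, q))) => q bq.
  apply: kb' => -[_] /=; rewrite in_itv /= -ler_norml => /(lt_le_trans bq).
  by rewrite ltxx.
Qed.

End iterated.

Lemma half_split (R : realDomainType) (a p L : R) : 2 * L <= a + p -> a < L -> L <= p.
Proof. by move=> h1 h2; lra. Qed.

Lemma abs_le_oneDsqr (R : realType) (t : R) : 1 + `|t| <= 2 * oneDsqr t.
Proof.
have := sqr_ge0 (`|t| - 1); rewrite /oneDsqr -[t ^+ 2]real_normK ?num_real//.
by have := normr_ge0 t; move: `|t| => x x0; rewrite !expr2 => h; nra.
Qed.

(** * The circle average around a point *)

Section radon.
Context (R : realType).
Local Notation leb := (@lebesgue_measure R).
Local Notation leb2 := (@lebesgue2 R).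
Variables (phi : R * R -> R) (z : R * R) (L M : R).
Hypotheses (tp : test_function phi) (L0 : 0 < L) (M0 : 0 <= M).
Hypothesis supp : forall theta (w : plane R), L ^+ 2 <= w.1 ^+ 2 + w.2 ^+ 2 ->
  [/\ phi (addrot z theta w) = 0, ddir theta phi (addrot z theta w) = 0 &
    dperp theta phi (addrot z theta w) = 0].
Hypothesis bound : forall theta (w : plane R),
  [/\ `|phi (addrot z theta w)| <= M, `|ddir theta phi (addrot z theta w)| <= M,
    `|dperp theta phi (addrot z theta w)| <= M &
    `|ddir theta (ddir theta phi) (addrot z theta w)| <= M].

Local Notation I := (`[0%R, (2 * pi)%R]%classic : set R).

Let mI : measurable (I : set (measurableTypeR R)).
Proof. exact: measurable_itv. Qed.

Let pi2 : 0 <= 2 * pi :> R.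
Proof. by rewrite mulr_ge0// pi_ge0. Qed.

Let Ilty : (leb I < +oo)%E.
Proof. by rewrite lebesgue_measure_itv /=; case: ifP => _; rewrite -?EFinD ltry. Qed.

Let IE : fine (leb I) = 2 * pi.
Proof.
by rewrite lebesgue_measure_itv /= lte_fin mulr_gt0 ?pi_gt0//= subr0.
Qed.

Let Q theta (w : plane R) := ddir theta phi (addrot z theta w).
Let Qp theta (w : plane R) := dperp theta phi (addrot z theta w).

Let support1 u v : L <= `|u| -> L ^+ 2 <= (u, v).1 ^+ 2 + (u, v).2 ^+ 2.
Proof.
move=> rp /=; rewrite ler_wpDr ?sqr_ge0// -[u ^+ 2]real_normK ?num_real//.
by rewrite lerXn2r// ?nnegrE ltW.
Qed.

Let support2 u v : L <= `|v| -> L ^+ 2 <= (u, v).1 ^+ 2 + (u, v).2 ^+ 2.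
Proof.
move=> rp /=; rewrite ler_wpDl ?sqr_ge0// -[v ^+ 2]real_normK ?num_real//.
by rewrite lerXn2r// ?nnegrE ltW.
Qed.

Let mcomb (a b : R) d (T : measurableType d) (th : T -> R) (w : T -> plane R) :
  measurable_fun setT th -> measurable_fun setT w ->
  measurable_fun setT (fun x => a * Q (th x) (w x) + b * Qp (th x) (w x)).
Proof.
move=> mth mw; have [m1 m2] := measurable_ddir_addrot z tp mth mw.
exact: (measurable_funD (measurable_funM (measurable_cst a) m1) (measurable_funM (measurable_cst b) m2)).
Qed.

Let intQ w : leb.-integrable I (EFin \o (fun theta => Q theta w)) /\
  leb.-integrable I (EFin \o (fun theta => Qp theta w)).
Proof.
have [m1 m2] := measurable_ddir_addrot z tp (@measurable_id _ R setT) (measurable_cst w).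
split; apply: (bounded_integrable (M := M) mI Ilty); try exact: measurable_funTS.
  by move=> theta _; have [_ ? _ _] := bound theta w.
by move=> theta _; have [_ _ ? _] := bound theta w.
Qed.

(** The derivative of [phi] along the ray [u |-> u (a, b)], integrated over the circle; [A] below is
    the same for the derivative in the direction [theta]. *)
Let J a b u := \int[leb]_(theta in I) (a * Q theta (u * a, u * b) + b * Qp theta (u * a, u * b)).
Let A w := \int[leb]_(theta in I) Q theta w.

Let JE a b u : J a b u = a * A (u * a, u * b) +
  b * \int[leb]_(theta in I) Qp theta (u * a, u * b).
Proof.
have [i1 i2] := intQ (u * a, u * b).
rewrite /J RintegralD//; [|exact: integrable_scale|exact: integrable_scale].
by rewrite !RintegralZl.
Qed.

(* [w.1 dperp - w.2 ddir] is the derivative of [phi] along the circle through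
   [addrot z theta w], so its integral over [I] vanishes. *)
Let angular w : w.1 * \int[leb]_(theta in I) Qp theta w = w.2 * A w.
Proof.
have [i1 i2] := intQ w; have [c1 c2] := continuous_ddir_addrot z w tp.
have H := @FTC2 _ (fun t => w.1 * Qp t w - w.2 * Q t w) _ 0 (2 * pi) pi2
  (fun t => is_derive_addrot_angle z t w tp).
have : w.1 * \int[leb]_(theta in I) Qp theta w - w.2 * A w = 0.
  rewrite /A -!RintegralZl// -RintegralB//; [|exact: integrable_scale|exact: integrable_scale].
  rewrite H; last first.
    by move=> r; apply: cvgB; apply: cvgM; (try exact: cvg_cst); [exact: c2|exact: c1].
  rewrite /addrot /rotation cos0 sin0 mulr_natl cos2pi sin2pi; exact: subrr.
by move=> /eqP; rewrite subr_eq0 => /eqP.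
Qed.

(** By [angular] the perpendicular part of the ray derivative is [b / a] times the direct part. For
    [a = 1] and [b = t] the factor is [1 + t ^+ 2]. *)
Let JA a b u : u != 0 -> a * J a b u = (a ^+ 2 + b ^+ 2) * A (u * a, u * b).
Proof.
move=> u0; have alg (p q : R) : a * q = b * p -> a * (a * p + b * q) = (a ^+ 2 + b ^+ 2) * p.
  by move=> E; rewrite mulrDr (mulrCA a b) E; ring.
by rewrite JE; apply: alg; apply: (mulfI u0); rewrite !mulrA; exact: (angular (u * a, u * b)).
Qed.

(** For each angle the fundamental theorem of calculus along the ray gives [- phi z], the far end
    being at distance at least [L] from [z]; the circle has length [2 * pi]. *)
Let ray a b : a ^+ 2 = 1 -> \int[leb]_(u in `[0%R, L]) J a b u = - (2 * pi) * phi z.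
Proof.
move=> a1.
have na : `|a| = 1 by apply/eqP; rewrite -sqr_norm_eq1 a1.
pose f (x : R * R) := a * Q x.2 (x.1 * a, x.1 * b) + b * Qp x.2 (x.1 * a, x.1 * b).
have mf : measurable_fun setT f.
  apply: mcomb; first exact: measurable_snd.
  by apply: measurable_fun_pair; apply: measurable_funM => //; exact: measurable_fst.
have fM u theta : `|f (u, theta)| <= `|a| * M + `|b| * M.
  have [_ h1 h2 _] := bound theta (u * a, u * b).
  by rewrite (le_trans (ler_normD _ _))// !normrM lerD// ler_wpM2l.
have lL : (leb `[0%R, L]%classic < +oo)%E.
  by rewrite lebesgue_measure_itv /=; case: ifP => _; rewrite -?EFinD ltry.
rewrite /J (@Rfubini_bounded _ _ _ _ _ leb leb `[0%R, L]%classic I f _ (measurable_itv _) mI lL Ilty mf (fun x y _ _ => fM x y)).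
transitivity (\int[leb]_(theta in I) (- phi z)); last by rewrite Rintegral_cst// IE; ring.
apply: eq_Rintegral => theta _.
have [c1 c2] := continuous_ddir_ray z theta a b tp.
rewrite (@FTC2 _ _ _ 0 L (ltW L0) (fun u => is_derive_addrot_ray z theta a b u tp)).
  have La : L <= `|L * a| by rewrite normrM na mulr1 ler_norm.
  have [-> _ _] := supp theta (support1 (L * b) La).
  by rewrite sub0r /addrot /rotation !mul0r addr0 subr0 !addr0 -surjective_pairing.
by move=> r; apply: cvgD; apply: cvgM; (try exact: cvg_cst); [exact: c1|exact: c2].
Qed.

(** The two opposite rays of slope [t], one for each term of [kern]. *)
Let H t u := J 1 t u + J (-1) (- t) u.

Let JM a b u : `|a| = 1 -> `|J a b u| <= (1 + `|b|) * M * (2 * pi).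
Proof.
move=> a1; rewrite -IE.
have m := mcomb a b (@measurable_id _ R setT) (measurable_cst ((u * a, u * b) : plane R)).
apply: (bounded_Rintegral mI Ilty (measurable_funTS m)) => theta _.
have [_ h1 h2 _] := bound theta (u * a, u * b).
by rewrite (le_trans (ler_normD _ _))// !normrM mulrDl lerD// ?a1// ler_wpM2l.
Qed.

Let J0 a b u : `|a| = 1 -> L <= `|u| \/ L <= `|u * b| -> J a b u = 0.
Proof.
move=> a1 Lu; apply: Rintegral0_eq => theta.
have S : L ^+ 2 <= (u * a, u * b).1 ^+ 2 + (u * a, u * b).2 ^+ 2.
  by case: Lu => Lu; [apply: support1; rewrite normrM a1 mulr1|exact: support2].
by have [_ h1 h2] := supp theta S; rewrite /Q /Qp h1 h2 !mulr0 addr0.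
Qed.

Let mJ d (T : measurableType d) (a : R) (b u : T -> R) : measurable_fun setT b ->
  measurable_fun setT u -> measurable_fun setT (fun x => J a (b x) (u x)).
Proof.
move=> mb mu.
pose f (x : T * R) := a * Q x.2 (u x.1 * a, u x.1 * b x.1) + b x.1 * Qp x.2 (u x.1 * a, u x.1 * b x.1).
apply: (measurable_Rintegral_snd leb mI (f := f)).
have mu1 : measurable_fun setT (fun x : T * R => u x.1) by exact: (measurableT_comp mu measurable_fst).
have mb1 : measurable_fun setT (fun x : T * R => b x.1) by exact: (measurableT_comp mb measurable_fst).
have mw : measurable_fun setT (fun x : T * R => (u x.1 * a, u x.1 * b x.1) : plane R).
  by apply: measurable_fun_pair; apply: measurable_funM.
have [m1 m2] := measurable_ddir_addrot z tp (@measurable_snd _ _ T (measurableTypeR R)) mw.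
exact: (measurable_funD (measurable_funM (measurable_cst a) m1) (measurable_funM mb1 m2)).
Qed.

Let HM t u : `|H t u| <= (1 + `|t|) * M * (4 * pi).
Proof.
rewrite /H (le_trans (ler_normD _ _))//.
have h1 := JM t u (normr1 R); have h2 := JM (- t) u (normrN1 R).
rewrite normrN in h2; apply: (le_trans (lerD h1 h2)).
by rewrite -mulrDr -mulrDl -natrD.
Qed.

(** Either [|u|] or [|u t|] reaches [L]. The support in [u] thus shrinks like [(1 + |t|)^-1], which
    makes up for the growth of the bound [HM]. *)
Let H0 t u : 2 * L <= `|u| * (1 + `|t|) -> H t u = 0.
Proof.
move=> Lu; have C : L <= `|u| \/ L <= `|u * t|.
  rewrite normrM; have [?|ul] := leP L `|u|; [by left|right].
  by rewrite mulrDr mulr1 in Lu; exact: half_split Lu ul.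
rewrite /H !J0 ?addr0 ?normr1 ?normrN1//.
by case: C; [left|right; rewrite mulrN normrN].
Qed.

(* Only after the integration over [theta], which produces the factor
   [(1 + t ^+ 2)^-1], is the integrand in the coordinates [(u, u t)] integrable. *)
Let G (x : plane R) := if 0 < x.1 then (oneDsqr x.2)^-1 * H x.2 x.1 else 0.

Let mG : measurable_fun setT G.
Proof.
apply: measurable_fun_ifT; last exact: measurable_cst.
  by apply: measurable_fun_ltr; [exact: measurable_cst|exact: measurable_fst].
have m2 : measurable_fun setT (fun x : plane R => x.2) by exact: measurable_snd.
have m1 : measurable_fun setT (fun x : plane R => x.1) by exact: measurable_fst.
apply: measurable_funM.
  by apply: (measurableT_comp (f := fun t : R => (oneDsqr t)^-1) _ m2); apply: continuous_measurable_fun; exact: continuous_oneDsqrV.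
by apply: measurable_funD; apply: mJ => //; exact: measurable_funN.
Qed.

Let oneDsqrV_ge0 t : 0 <= (oneDsqr t)^-1 :> R.
Proof. by rewrite invr_ge0. Qed.

Let GM u t : `|G (u, t)| <= (oneDsqr t)^-1 * ((1 + `|t|) * M * (4 * pi)).
Proof.
rewrite /G /=; case: ifPn => _; last first.
  by rewrite normr0 !mulr_ge0// ?pi_ge0// addr_ge0.
by rewrite normrM ger0_norm// ler_wpM2l.
Qed.

Let GM1 u t : `|G (u, t)| <= 2 * M * (4 * pi).
Proof.
apply: (le_trans (GM u t)); have oo : 0 < oneDsqr t :> R by exact: lt_le_trans ltr01 (oneDsqr_ge1 t).
have t1 := abs_le_oneDsqr t.
have mc : 0 <= M * (4 * pi) by apply: mulr_ge0 => //; rewrite mulr_ge0// pi_ge0.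
have -> : (oneDsqr t)^-1 * ((1 + `|t|) * M * (4 * pi)) = (oneDsqr t)^-1 * (1 + `|t|) * (M * (4 * pi)).
  by rewrite !mulrA.
have -> : 2 * M * (4 * pi) = 2 * (M * (4 * pi)) by rewrite !mulrA.
by apply: ler_wpM2r => //; rewrite ler_pdivrMl// mulrC.
Qed.

Let G0u u t : 2 * L / (1 + `|t|) < `|u| -> G (u, t) = 0.
Proof.
rewrite ltr_pdivrMr ?ltr_wpDr// => Lu.
by rewrite /G /= H0 ?mulr0 ?if_same// ltW.
Qed.

Let intGu t : leb.-integrable setT (fun u => (G (u, t))%:E).
Proof.
have m : measurable_fun setT (fun u => G (u, t)) by exact: (measurableT_comp mG (pair2_measurable t)).
exact: (segment_support_integrable m (fun u => GM u t) (fun u => @G0u u t)).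
Qed.

Let intGt u : leb.-integrable setT (fun t => (G (u, t))%:E).
Proof.
have [u0|u0] := leP u 0.
  have -> : (fun t => (G (u, t))%:E) = cst 0%E.
    by apply/funext => t; rewrite /G /= ltNge u0.
  exact: integrable0.
apply: (segment_support_integrable (L := 2 * L / u) (section_measurable u mG) (fun t => GM1 u t)) => t.
rewrite ltr_pdivrMr// => Lt; apply: G0u; rewrite ltr_pdivrMr ?ltr_wpDr// (gtr0_norm u0).
by rewrite (lt_trans Lt)// mulrDr mulr1 [u * _]mulrC ltrDr.
Qed.

(** The factor [1 + |t|] in [GM] cancels against the length of the support given by [G0u]; a
    multiple of [(oneDsqr t)^-1] remains, with integral a multiple of [pi]. *)
Let intG : leb2.-integrable setT (EFin \o G).
Proof.
have mE : measurable_fun setT (EFin \o G) by exact/measurable_EFinP.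
apply: (integrable21ltyP leb leb mE).2.
pose C := M * (4 * pi) * (2 * (2 * L)).
apply: (@le_lt_trans _ _ (\int[leb]_t (C%:E * ((oneDsqr t)^-1)%:E)))%E; last first.
  rewrite ge0_integralZl//.
  - by rewrite integral_oneDsqrV -EFinM ltry.
  - by apply/measurable_EFinP; apply: continuous_measurable_fun; exact: continuous_oneDsqrV.
  - by rewrite lee_fin /C !mulr_ge0// ?pi_ge0// ltW.
apply: ge0_le_integral => //.
- by move=> t _; exact: integral_ge0.
- apply: (measurable_fun_fubini_tonelli_G (m1 := leb) (fun x => (`|G x|)%:E)) => //.
  by apply/measurable_EFinP; exact: measurableT_comp.
- under eq_fun do rewrite -EFinM.
  apply/measurable_EFinP; apply: measurable_funM => //.
  by apply: continuous_measurable_fun; exact: continuous_oneDsqrV.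
move=> t _.
have m : measurable_fun setT (fun u => `|G (u, t)|).
  have m1 : measurable_fun setT (fun u => G (u, t)) by exact: (measurableT_comp mG (pair2_measurable t)).
  exact: (measurableT_comp (@normr_measurable R setT) m1).
have t1 : 0 < 1 + `|t| by rewrite ltr_wpDr.
have n0 : 0 <= 2 * L / (1 + `|t|) by rewrite divr_ge0 ?mulr_ge0// ltW.
have sL u : 2 * L / (1 + `|t|) < `|u| -> `|G (u, t)| = 0 by move=> /G0u ->; rewrite normr0.
have sM u : `| `|G (u, t)| | <= (oneDsqr t)^-1 * ((1 + `|t|) * M * (4 * pi)).
  by rewrite normr_id; exact: GM.
have int := segment_support_integrable m sM sL.
rewrite -(fineK (integrable_fin_num measurableT int)) -EFinM lee_fin.
apply: (le_trans (ler_norm _)); apply: (le_trans (segment_support_le m n0 sM sL)).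
rewrite /C; have tn : 1 + `|t| != 0 by rewrite gt_eqF.
have on : oneDsqr t != 0 by rewrite gt_eqF// (lt_le_trans ltr01)// oneDsqr_ge1.
by rewrite le_eqVlt; apply/orP; left; apply/eqP; field; rewrite on tn.
Qed.

Let mA (f : R -> plane R) : measurable_fun setT f -> measurable_fun setT (fun x => A (f x)).
Proof.
move=> mf; apply: (measurable_Rintegral_snd leb mI (f := fun x : R * R => Q x.2 (f x.1))).
have mf1 : measurable_fun setT (fun x : R * R => f x.1) by exact: (measurableT_comp mf measurable_fst).
by have [] := measurable_ddir_addrot z tp (@measurable_snd _ _ R R) mf1.
Qed.

Let AM w : `|A w| <= M * (2 * pi).
Proof.
rewrite -IE; have [m _] := measurable_ddir_addrot z tp (@measurable_id _ R setT) (measurable_cst w).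
apply: (bounded_Rintegral mI Ilty (measurable_funTS m)) => theta _.
by have [_ ? _ _] := bound theta w.
Qed.

Let A0 u v : L <= `|v| -> A (u, v) = 0.
Proof.
move=> Lu; apply: Rintegral0_eq => theta.
by have [_ ? _] := supp theta (support2 u Lu).
Qed.

Let angular_kernel u v : 0 < u -> \int[leb]_(theta in I) kern (Q theta) 0 (u, v) =
  (A (u, v) - A (- u, v)) / (pi * u).
Proof.
move=> u0; rewrite /kern /= u0 add0r sub0r.
have [i1 _] := intQ (u, v); have [i2 _] := intQ (- u, v).
by rewrite RintegralZr// ?RintegralB//; exact: integrable_sub.
Qed.

(** The substitution [v = u t] has Jacobian [u], which cancels the singularity [1 / (pi u)] of the
    kernel; [JA] then exchanges direction derivatives for ray derivatives. *)
Let inner_v u : 0 < u -> \int[leb]_v (\int[leb]_(theta in I) kern (Q theta) 0 (u, v)) =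
  \int[leb]_t (pi^-1 * G (u, t)).
Proof.
move=> u0; have un0 : u != 0 by rewrite gt_eqF.
have mc (a c : R) : measurable_fun setT (fun t : R => A (a, c * t)).
  by apply: mA; apply: measurable_fun_pair; [exact: measurable_cst|exact: measurable_funM].
have ic (a c : R) : c != 0 -> leb.-integrable setT (EFin \o (fun t => A (a, c * t))).
  move=> c0; apply: (segment_support_integrable (L := L / `|c|) (mc a c) (fun t => AM _)) => t.
  by rewrite ltr_pdivrMr ?normr_gt0// => Lt; rewrite A0// normrM mulrC ltW.
under eq_Rintegral do rewrite angular_kernel//.
have mK : measurable_fun setT (fun v => (A (u, v) - A (- u, v)) / (pi * u)).
  have m1 (a : R) : measurable_fun setT (fun v : R => A (a, v)).
    by apply: mA; apply: measurable_fun_pair; [exact: measurable_cst|exact: measurable_id].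
  by apply: measurable_funM; [exact: (measurable_funB (m1 u) (m1 (- u)))|exact: measurable_cst].
have aE t : affine u 0 t = u * t by rewrite /affine addr0.
have iK : leb.-integrable setT (EFin \o ((fun v => (A (u, v) - A (- u, v)) / (pi * u)) \o affine u 0)).
  rewrite (_ : _ \o _ = (fun t => ((pi * u)^-1 * (A (u, u * t) - A (- u, u * t)))%:E)); last first.
    by apply/funext => t /=; rewrite aE mulrC.
  exact: (integrable_scale _ measurableT (integrable_sub measurableT (ic u u un0) (ic (- u) u un0))).
rewrite (Rintegral_affine un0 mK iK) (gtr0_norm u0).
transitivity (u * ((\int[leb]_t A (u, u * t) - \int[leb]_t A (- u, u * t)) / (pi * u))).
  congr (_ * _); under eq_Rintegral do rewrite aE.
  have i1 := ic u u un0; have i2 := ic (- u) u un0.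
  by rewrite (RintegralZr _ measurableT (integrable_sub measurableT i1 i2)) (RintegralB measurableT i1 i2).
have n1 : -1 != 0 :> R by rewrite oppr_eq0 oner_neq0.
have iN : leb.-integrable setT (EFin \o ((fun t => A (- u, u * t)) \o affine (-1) 0)).
  rewrite (_ : _ \o _ = EFin \o (fun t => A (- u, - u * t))); first by apply: ic; rewrite oppr_eq0.
  by apply/funext => t /=; rewrite /affine addr0 mulN1r mulrN mulNr.
(* Reflecting [t] in the second term replaces [(- u, u t)] by [(- u, - u t)], which lies on the ray
   opposite to [(u, u t)]. *)
have EN : \int[leb]_t A (- u, u * t) = \int[leb]_t A (- u, - u * t).
  apply: (etrans (Rintegral_affine n1 (mc (- u) u) iN)); rewrite normrN1 mul1r.
  by apply: eq_Rintegral => t _; rewrite /affine addr0 mulN1r mulrN mulNr.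
rewrite [X in (_ - X)]EN.
have un1 : - u != 0 by rewrite oppr_eq0.
rewrite -(RintegralB measurableT (ic u u un0) (ic (- u) (- u) un1)).
rewrite (RintegralZl _ measurableT (intGt u)).
have cancel_u (x p : R) : p != 0 -> u * (x / (p * u)) = p^-1 * x.
  by move=> p0; field; rewrite p0 un0.
have alg (D j1 j2 p q : R) : D != 0 -> j1 = D * p -> - j2 = D * q -> p - q = D^-1 * (j1 + j2).
  by move=> D0 E1 E2; rewrite -[j2]opprK E1 E2 -mulrBr mulKf.
have -> : \int[leb]_t (A (u, u * t) - A (- u, - u * t)) = \int[leb]_t G (u, t).
  apply: eq_Rintegral => t _; rewrite /G /= u0 /H.
  have o0 : oneDsqr t != 0 by rewrite gt_eqF// (lt_le_trans ltr01)// oneDsqr_ge1.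
  have h1 := @JA 1 t u un0; have h2 := @JA (-1) (- t) u un0.
  rewrite mul1r expr1n mulr1 -/(oneDsqr t) in h1.
  rewrite mulN1r !sqrrN expr1n mulrN1 mulrN -mulNr -/(oneDsqr t) in h2.
  exact: (alg (oneDsqr t) (J 1 t u) (J (-1) (- t) u) (A (u, u * t)) (A (- u, - u * t)) o0 h1 h2).
exact: cancel_u (lt0r_neq0 (pi_gt0 R)).
Qed.

(** Each of the two rays contributes [- (2 * pi) * phi z]. *)
Let outer_u t : \int[leb]_u G (u, t) = (oneDsqr t)^-1 * (- (4 * pi) * phi z).
Proof.
have mg a b : measurable_fun setT (J a b) by exact: mJ.
have ij a b : `|a| = 1 -> leb.-integrable `[0%R, L]%classic (EFin \o J a b).
  have lL : (leb `[0%R, L]%classic < +oo)%E.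
    by rewrite lebesgue_measure_itv /=; case: ifP => _; rewrite -?EFinD ltry.
  have mL : measurable (`[0%R, L]%classic : set (measurableTypeR R)) by exact: measurable_itv.
  move=> a1; apply: (bounded_integrable (M := (1 + `|b|) * M * (2 * pi)) mL lL).
    exact: (measurable_funTS (mg a b)).
  by move=> u _; exact: JM.
have mL : measurable (`[0%R, L]%classic : set (measurableTypeR R)) by exact: measurable_itv.
have i1 := ij 1 t (normr1 R); have i2 := ij (-1) (- t) (normrN1 R).
have iH := integrable_add mL i1 i2.
transitivity (\int[leb]_(u in `]0%R, L]) ((oneDsqr t)^-1 * H t u)).
  rewrite [RHS]Rintegral_mkcond; apply: eq_Rintegral => u _; rewrite patchE /G /=.
  case: ifPn => u0; case: ifPn => //.
  - rewrite notin_setE /= in_itv /= u0 /= => /negP; rewrite -ltNge => /ltW Lu.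
    rewrite -(gtr0_norm u0) in Lu.
    by rewrite /H (@J0 1 t u (normr1 R) (or_introl Lu)) (@J0 (-1) (- t) u (normrN1 R) (or_introl Lu)) addr0 mulr0.
  - by rewrite inE /= in_itv /= (negbTE u0).
have mLo : measurable (`]0%R, L]%classic : set (measurableTypeR R)) by exact: measurable_itv.
have iHo := integrableS mL mLo (@subset_itv_oc_cc _ _ 0 L) (integrable_scale (oneDsqr t)^-1 mL iH).
apply: (etrans (Rintegral_itv_obnd_cbnd iHo)).
rewrite (RintegralZl _ mL iH); congr (_ * _).
have r1 := @ray 1 t (expr1n R 2); have r2 := @ray (-1) (- t) (etrans (sqrrN 1) (expr1n R 2)).
apply: (etrans (RintegralD mL i1 i2)); rewrite [X in X + _]r1 [X in _ + X]r2.
by move: (phi z) pi => f p; ring.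
Qed.

(** The kernel is bounded on a box, so the angle can be integrated first; [intG] then permits
    integrating over [u] before [t]. The factor [pi^-1] of the kernel cancels the integral of
    [(oneDsqr t)^-1]. *)
Lemma radon_identity_aux : \int[leb]_(theta in I) hil (Q theta) 0 = - (4 * pi) * phi z.
Proof.
have dQ theta p q : is_derive p (1 : R) (fun t => Q theta (t, q))
    (ddir theta (ddir theta phi) (addrot z theta (p, q))).
  exact: (is_derive_addrot1 z theta p q (test_function_ddir theta tp)).
have sQ theta w : L ^+ 2 < w.1 ^+ 2 + w.2 ^+ 2 -> Q theta w = 0.
  by move=> /ltW Lw; have [_ ? _] := supp theta Lw.
have bQ theta w : `|ddir theta (ddir theta phi) (addrot z theta w)| <= M.
  by have [_ _ _ ?] := bound theta w.
pose dd theta w := ddir theta (ddir theta phi) (addrot z theta w).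
have kle theta w : `|kern (Q theta) 0 w| <= M := kern_le (psi1 := dd theta) (dQ theta) M0 (bQ theta) 0 w.
pose b := box (L + `|0 : R|) L.
have ksup theta w : ~ b w -> kern (Q theta) 0 w = 0.
  exact: (kern_support (ltW L0) (sQ theta) (lexx `|0 : R|)).
pose K (x : R * plane R) := kern (Q x.1) 0 x.2.
have mK : measurable_fun setT K.
  have mt : measurable_fun setT (fun x : R * plane R => x.1) by exact: measurable_fst.
  have m1 : measurable_fun setT (fun x : R * plane R => x.2.1).
    by exact: (measurableT_comp measurable_fst measurable_snd).
  have m2 : measurable_fun setT (fun x : R * plane R => x.2.2).
    by exact: (measurableT_comp measurable_snd measurable_snd).
  apply: measurable_fun_ifT; last exact: measurable_cst.
    by apply: measurable_fun_ltr => //; exact: measurable_cst.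
  have mp (f : R * plane R -> R) : measurable_fun setT f ->
      measurable_fun setT (fun x : R * plane R => Q x.1 (f x, x.2.2)).
    move=> mf; have mw : measurable_fun setT (fun x : R * plane R => (f x, x.2.2) : plane R).
      exact: measurable_fun_pair.
    by have [] := measurable_ddir_addrot z tp mt mw.
  apply: measurable_funM.
    by apply: measurable_funB; apply: mp; [apply: measurable_funD|apply: measurable_funB].
  by apply: (measurableT_comp (@measurable_inv R)); exact: measurable_funM.
have mb := measurable_box (L + `|0 : R|) L; have blty := box_lty (L + `|0 : R|) L.
transitivity (\int[leb]_(theta in I) \int[leb2]_(w in b) K (theta, w)).
  by apply: eq_Rintegral => theta _; rewrite /hil (Rintegral_box (ksup theta)).
rewrite (@Rfubini_bounded _ _ _ _ _ leb leb2 I b K M mI mb Ilty blty mK (fun x y _ _ => kle x y)).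
pose Kb w := \int[leb]_(theta in I) K (theta, w).
have Kb0 w : ~ b w -> Kb w = 0.
  by move=> nb; apply: Rintegral0_eq => theta; exact: ksup.
have mKb : measurable_fun setT Kb.
  apply: (measurable_Rintegral_snd leb mI (f := fun x : plane R * R => K (x.2, x.1))).
  by apply: (measurableT_comp mK); exact: measurable_fun_pair.
have KbM w : `|Kb w| <= M * (2 * pi).
  rewrite -IE; have m : measurable_fun setT (fun theta => K (theta, w)).
    exact: (measurableT_comp mK (pair2_measurable w)).
  by apply: (bounded_Rintegral mI Ilty (measurable_funTS m)) => theta _; exact: kle.
have M2 : 0 <= M * (2 * pi) by exact: mulr_ge0.
rewrite -/Kb -(Rintegral_box Kb0) (box_iterated mKb (ltW L0) M2 KbM Kb0).
transitivity (\int[leb]_u \int[leb]_t (pi^-1 * G (u, t))).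
  apply: eq_Rintegral => u _; have [u0|u0] := ltP 0 u; first exact: inner_v.
  rewrite [LHS]Rintegral0_eq; first rewrite [RHS]Rintegral0_eq//.
    by move=> t; rewrite /G /= ltNge u0 mulr0.
  by move=> v; apply: Rintegral0_eq => theta; rewrite /K /kern /= ltNge u0.
have mGp : measurable_fun setT (fun x => pi^-1 * G x) by exact: measurable_funM.
rewrite (@Rfubini _ _ _ _ _ leb leb (fun x => pi^-1 * G x) mGp (fun u => integrable_scale _ measurableT (intGt u)) (fun t => integrable_scale _ measurableT (intGu t)) (integrable_scale _ measurableT intG)).
transitivity (\int[leb]_t ((oneDsqr t)^-1 * (pi^-1 * (- (4 * pi) * phi z)))).
  by apply: eq_Rintegral => t _; rewrite (RintegralZl _ measurableT (intGu t)) outer_u mulrCA.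
have io : leb.-integrable setT (EFin \o (fun t => (oneDsqr t)^-1)).
  apply/integrableP; split.
    by apply/measurable_EFinP; apply: continuous_measurable_fun; exact: continuous_oneDsqrV.
  under eq_integral do rewrite gee0_abs ?lee_fin//.
  by rewrite integral_oneDsqrV ltry.
rewrite (RintegralZr _ measurableT io) /Rintegral integral_oneDsqrV /= mulrA divff ?mul1r//.
by rewrite gt_eqF// pi_gt0.
Qed.

End radon.

(** In the rotated frame the first coordinate of [z] is the evaluation point and the second is the
    shift [b] of [hil_shift]; moving the origin to [z] leaves the centered identity. *)
Lemma radon_identity (R : realType) (phi : R * R -> R) (z : R * R) : test_function phi ->
  \int[@lebesgue_measure R]_(theta in `[0%R, (2 * pi)%R])
     hil (fun w => ddir theta phi (rotation theta w)) (z.1 * cos theta + z.2 * sin theta) =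
  - (4 * pi) * phi z.
Proof.
move=> tp; have [L [M [L0 M0 supp bound]]] := addrot_bounds z tp.
have [rho [M' [rho0 M0' ps ds bd]]] := test_function_uniform tp.
rewrite -(radon_identity_aux tp L0 M0 supp bound); apply: eq_Rintegral => theta _.
have tpd := test_function_ddir theta tp.
have mid : measurable_fun setT (fun _ : plane R => theta) by exact: measurable_cst.
apply: (@hil_shift R _ _ (fun w => ddir theta (ddir theta phi) (rotation theta w))
  (fun w => ddir theta (ddir theta phi) (addrot z theta w)) _
  (z.2 * cos theta - z.1 * sin theta) rho L (M' + M)).
- by move=> p q; exact: is_derive_rot.
- by move=> p q; exact: is_derive_addrot1.
- have [m _] := measurable_ddir_addrot (0, 0) tp mid (@measurable_id _ (plane R) setT).
  move: m; congr measurable_fun; apply/funext => w.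
  by congr (ddir theta phi _); rewrite /addrot /rotation /= !add0r.
- by have [] := measurable_ddir_addrot z tp mid (@measurable_id _ (plane R) setT).
- by [].
- exact: ltW.
- exact: addr_ge0.
- move=> w; have [_ _ _ h] := bd theta (rotation theta w).
  by rewrite (le_trans h)// lerDl.
- move=> w; have [_ _ _ h] := bound theta w.
  by rewrite (le_trans h)// lerDr.
- move=> w; rewrite -(rotation_sqr theta w) => h.
  by have [] := ds theta _ h.
- by move=> w /ltW h; have [] := supp theta w h.
- move=> p q; congr (ddir theta phi _).
  have cs := cos2Dsin2 theta; rewrite /addrot /rotation /=; congr (_, _).
    rewrite -{1}[z.1]mulr1 -cs; ring.
  by rewrite -{1}[z.2]mulr1 -cs; ring.
Qed.

(** * The density *)

Section hil_rotation.
Context (R : realType).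
Local Notation leb := (@lebesgue_measure R).
Local Notation leb2 := (@lebesgue2 R).

Lemma measurable_ddir_rotation (phi : R * R -> R) d (T : measurableType d) (th : T -> R) (w : T -> plane R) :
  test_function phi -> measurable_fun setT th -> measurable_fun setT w ->
  measurable_fun setT (fun x => ddir (th x) phi (rotation (th x) (w x))).
Proof.
move=> tp mth mw; have [m _] := measurable_ddir_addrot (0, 0) tp mth mw.
move: m; congr measurable_fun; apply/funext => x.
by congr (ddir (th x) phi _); rewrite /addrot /rotation /= !add0r.
Qed.

Lemma measurable_test_rotation (phi : R * R -> R) theta : test_function phi ->
  measurable_fun setT (fun w : plane R => phi (rotation theta w)).
Proof.
move=> tp; have m := measurable_addrot (0, 0) (measurable_cst theta) (@measurable_id _ (plane R) setT).
have := measurableT_comp (continuous_measurable_plane (tp.1 0%N)) m.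
congr measurable_fun; apply/funext => w /=.
by congr phi; rewrite /addrot /rotation /= !add0r.
Qed.

Lemma hil_rotation (phi : R * R -> R) theta s : test_function phi ->
  [/\ pv_inv (fun u => line_integral phi theta (s + u)) = hil (fun w => phi (rotation theta w)) s,
    derivable (hil (fun w => phi (rotation theta w))) s 1 &
    derive1 (hil (fun w => phi (rotation theta w))) s = hil (fun w => ddir theta phi (rotation theta w)) s].
Proof.
move=> tp; have tpd := test_function_ddir theta tp.
have [rho [M [rho0 M0 ps ds bd]]] := test_function_uniform tp.
have d1 p q := is_derive_rot theta p q tp.
have d2 p q := is_derive_rot theta p q tpd.
have m1 := measurable_test_rotation theta tp.
have m2 := measurable_test_rotation theta tpd.
have b0 w : `|phi (rotation theta w)| <= M by have [] := bd theta (rotation theta w).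
have b1 w : `|ddir theta phi (rotation theta w)| <= M by have [] := bd theta (rotation theta w).
have b2 w : `|ddir theta (ddir theta phi) (rotation theta w)| <= M.
  by have [] := bd theta (rotation theta w).
have s0 w : rho ^+ 2 < w.1 ^+ 2 + w.2 ^+ 2 -> phi (rotation theta w) = 0.
  by rewrite -(rotation_sqr theta w); exact: ps.
have s1 w : rho ^+ 2 < w.1 ^+ 2 + w.2 ^+ 2 -> ddir theta phi (rotation theta w) = 0.
  by rewrite -(rotation_sqr theta w) => h; have [] := ds theta _ h.
split.
- exact: (pv_inv_hil (psi := fun w => phi (rotation theta w)) (psi1 := fun w => ddir theta phi (rotation theta w)) s d1 m1 rho0 M0 b1 b0 s0).
- by have [] := is_derive_hil (psi := fun w => phi (rotation theta w)) s d1 d2 m1 m2 rho0 M0 b1 b2 s0 s1.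
- by have [] := is_derive_hil (psi := fun w => phi (rotation theta w)) s d1 d2 m1 m2 rho0 M0 b1 b2 s0 s1.
Qed.

Lemma continuous_hil_rotation (phi : R * R -> R) theta : test_function phi ->
  continuous (hil (fun w => phi (rotation theta w))).
Proof.
move=> tp s; apply/differentiable_continuous/derivable1_diffP.
by have [_ ? _] := hil_rotation theta s tp.
Qed.

(** The function [K(theta, s)] of the overview, with the derivative already carried inside the
    Hilbert transform. *)
Definition radon_kernel (phi : R * R -> R) (theta s : R) :=
  hil (fun w => ddir theta phi (rotation theta w)) s.

Lemma density_integrandE n (lambda : R -> 'rV[R]_n) (phi : R * R -> R) theta : test_function phi ->
  density_integrand lambda phi theta =
  - \int[leb]_s (bspline (lambda theta) s * radon_kernel phi theta s).
Proof.
move=> tp; rewrite /density_integrand /hilbert /distr_conv /distr_deriv /regular; congr (- _).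
apply: eq_Rintegral => s _; congr (_ * _).
have -> : (fun s => pv_inv (fun u => line_integral phi theta (s + u))) =
    hil (fun w => phi (rotation theta w)).
  by apply/funext => r; have [] := hil_rotation theta r tp.
by have [] := hil_rotation theta s tp.
Qed.

Lemma measurable_radon_kernel (phi : R * R -> R) d (T : measurableType d) (th s : T -> R) :
  test_function phi -> measurable_fun setT th -> measurable_fun setT s ->
  measurable_fun setT (fun x => radon_kernel phi (th x) (s x)).
Proof.
move=> tp mth ms.
pose K (x : T * plane R) := kern (fun w => ddir (th x.1) phi (rotation (th x.1) w)) (s x.1) x.2.
apply: (measurable_Rintegral_snd leb2 measurableT (f := K)).
have mt : measurable_fun setT (fun x : T * plane R => th x.1) by exact: (measurableT_comp mth measurable_fst).
have ms1 : measurable_fun setT (fun x : T * plane R => s x.1) by exact: (measurableT_comp ms measurable_fst).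
have m1 : measurable_fun setT (fun x : T * plane R => x.2.1).
  by exact: (measurableT_comp measurable_fst measurable_snd).
have m2 : measurable_fun setT (fun x : T * plane R => x.2.2).
  by exact: (measurableT_comp measurable_snd measurable_snd).
apply: measurable_fun_ifT; last exact: measurable_cst.
  by apply: measurable_fun_ltr => //; exact: measurable_cst.
have mp (f : T * plane R -> R) : measurable_fun setT f ->
    measurable_fun setT (fun x : T * plane R => ddir (th x.1) phi (rotation (th x.1) (f x, x.2.2))).
  move=> mf; have mw : measurable_fun setT (fun x : T * plane R => (f x, x.2.2) : plane R).
    exact: measurable_fun_pair.
  exact: (measurable_ddir_rotation tp mt mw).
apply: measurable_funM.
  exact: (measurable_funB (mp _ (measurable_funD ms1 m1)) (mp _ (measurable_funB ms1 m1))).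
by apply: (measurableT_comp (@measurable_inv R)); exact: measurable_funM.
Qed.

Lemma radon_kernel_bounded (phi : R * R -> R) S : test_function phi ->
  exists C, forall theta s, `|s| <= S -> `|radon_kernel phi theta s| <= C.
Proof.
move=> tp; have [rho [M [rho0 M0 ps ds bd]]] := test_function_uniform tp.
exists (M * fine (leb2 (box (rho + S) rho))) => theta s sS.
have tpd := test_function_ddir theta tp.
have s1 w : rho ^+ 2 < w.1 ^+ 2 + w.2 ^+ 2 -> ddir theta phi (rotation theta w) = 0.
  by rewrite -(rotation_sqr theta w) => h; have [] := ds theta _ h.
have b2 w : `|ddir theta (ddir theta phi) (rotation theta w)| <= M.
  by have [] := bd theta (rotation theta w).
have d2 p q := is_derive_rot theta p q tpd.
have kle := kern_le (psi := fun w => ddir theta phi (rotation theta w)) d2 M0 b2 s.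
have ksup w := kern_support (psi := fun w => ddir theta phi (rotation theta w)) rho0 s1 sS (z := w).
rewrite /radon_kernel /hil (Rintegral_box ksup).
have mk := measurable_kern s (measurable_test_rotation theta tpd).
by apply: (bounded_Rintegral (measurable_box _ _) (box_lty _ _) (measurable_funTS mk)) => w _; exact: kle.
Qed.

End hil_rotation.

(** * From the pairing to the numerical measure *)

Section assembly.
Context (R : realType).
Local Notation leb := (@lebesgue_measure R).
Local Notation leb2 := (@lebesgue2 R).
Variable n : nat.
Local Notation vec := (n.-tuple (plane R)).
Local Notation ub := (@uniform_ball R n).
Local Notation I := (`[0%R, (2 * pi)%R]%classic : set R).
Implicit Types (A : 'M[R[i]]_n).

Lemma hform_hermitian_part A theta (t : vec) : hform (hermitian_part A theta) t =
  (quadratic_form A t).1 * cos theta + (quadratic_form A t).2 * sin theta.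
Proof.
rewrite /hform /quadratic_form /to_plane /hermitian_part -scalemxAl mulmxDl -!scalemxAl.
rewrite innerZl innerDl !innerZl (inner_adj (A ^t*)%sesqui) trmxCK -inner_conjC conjCE.
have -> : 2^-1 = (2^-1 : R)%:C%C :> R[i] by rewrite fmorphV rmorph_nat.
by case: (inner _ _) => a b /=; field.
Qed.

(** The right-hand side no longer mentions the knots, so its dependence on [theta] is governed by
    the matrix, whatever the choice of eigenvalues. *)
Lemma density_integrand_ball A (lambda : R -> 'rV[R]_n) (phi : R * R -> R) theta :
  (@to_plane R @` numerical_range A)° !=set0 ->
  char_poly (hermitian_part A theta) = \prod_(j < n) ('X - ((lambda theta 0 j)%:C)%C%:P) ->
  test_function phi ->
  density_integrand lambda phi theta = - \int[ub]_t radon_kernel phi theta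
    (hform (hermitian_part A theta) (radial_proj t)).
Proof.
move=> hW hl tp; have tpd := test_function_ddir theta tp.
have ns := hermitian_part_nonscalar hW hl.
have n0 : (0 < n)%N by have [i _] := ns; rewrite (leq_ltn_trans _ (ltn_ord i)).
rewrite density_integrandE//; congr (- _).
by have [_ ->] := bspline_law n0 (hermitian_hermitian_part A theta) hl ns
  (@continuous_hil_rotation _ _ theta tpd).
Qed.

Lemma density_integral A (lambda : R -> 'rV[R]_n) (phi : R * R -> R) :
  (@to_plane R @` numerical_range A)° !=set0 ->
  (forall theta, char_poly (hermitian_part A theta) =
     \prod_(j < n) ('X - ((lambda theta 0 j)%:C)%C%:P)) ->
  test_function phi ->
  leb.-integrable I (EFin \o density_integrand lambda phi) /\
  \int[leb]_(theta in I) density_integrand lambda phi theta =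
    4 * pi * \int[numerical_measure A]_z phi z.
Proof.
move=> hW hl tp.
pose q (t : vec) := quadratic_form A (radial_proj t).
pose f (x : R * vec) := radon_kernel phi x.1 ((q x.2).1 * cos x.1 + (q x.2).2 * sin x.1).
have mq : measurable_fun setT q.
  exact: (measurableT_comp (measurable_funPT (quadratic_form A)) (measurable_funPT (@radial_proj R n))).
have fE theta : density_integrand lambda phi theta = - \int[ub]_t f (theta, t).
  have E t : radon_kernel phi theta (hform (hermitian_part A theta) (radial_proj t)) = f (theta, t).
    by rewrite hform_hermitian_part.
  rewrite (density_integrand_ball hW (hl theta) tp); apply: (congr1 (fun x => - x)).
  by apply: eq_Rintegral => t _; exact: E.
have [K1 K10 K1P] := hform_radial_le A.
(* At angle [pi / 2] the Hermitian part gives the imaginary part of the form of [A]; with [K1] this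
   confines the argument of the kernel to a bounded interval. *)
have [K2 K20 K2P] := hform_radial_le (hermitian_part A (pi / 2)).
have [C CP] := radon_kernel_bounded (K1 + K2) tp.
have q1 t : `|(q t).1| <= K1 := K1P t.
have q2 t : `|(q t).2| <= K2.
  have := K2P t; rewrite hform_hermitian_part cos_pihalf sin_pihalf mulr0 add0r mulr1.
  exact.
have fC theta t : `|f (theta, t)| <= C.
  apply: CP; rewrite (le_trans (ler_normD _ _))// !normrM lerD//.
    rewrite (le_trans _ (q1 t))// ler_piMr// ler_norml cos_geN1 cos_le1//.
  rewrite (le_trans _ (q2 t))// ler_piMr// ler_norml sin_geN1 sin_le1//.
have mf : measurable_fun setT f.
  have mt : measurable_fun setT (fun x : R * vec => x.1) by exact: measurable_fst.
  have mq2 : measurable_fun setT (fun x : R * vec => q x.2) by exact: (measurableT_comp mq measurable_snd).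
  have mc : measurable_fun setT (fun x : R * vec => cos x.1).
    by apply: (measurableT_comp _ mt); apply: continuous_measurable_fun; exact: continuous_cos.
  have ms : measurable_fun setT (fun x : R * vec => sin x.1).
    by apply: (measurableT_comp _ mt); apply: continuous_measurable_fun; exact: continuous_sin.
  apply: (measurable_radon_kernel tp mt).
  apply: measurable_funD; apply: measurable_funM => //.
    exact: (measurableT_comp measurable_fst mq2).
  exact: (measurableT_comp measurable_snd mq2).
have mI : measurable (I : set (measurableTypeR R)) by exact: measurable_itv.
have Ilty : (leb I < +oo)%E.
  by rewrite lebesgue_measure_itv /=; case: ifP => _; rewrite -?EFinD ltry.
have ublty : (ub setT < +oo)%E by rewrite probability_setT ltry.
have mF : measurable_fun setT (fun theta => \int[ub]_t f (theta, t)).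
  exact: (measurable_Rintegral_snd ub measurableT mf).
have iF : leb.-integrable I (EFin \o (fun theta => \int[ub]_t f (theta, t))).
  apply: (bounded_integrable (M := C * fine (ub setT)) mI Ilty (measurable_funTS mF)) => theta _.
  apply: (bounded_Rintegral measurableT ublty) => [|t _]; last exact: fC.
  exact: (measurableT_comp mf (pair1_measurable theta)).
have dE : density_integrand lambda phi = (fun theta => -1 * \int[ub]_t f (theta, t)).
  by apply/funext => theta; rewrite fE mulN1r.
have mp : measurable_fun setT (phi : plane R -> R) := continuous_measurable_plane (tp.1 0%N).
have [Mp Mp0 pM] := test_function_bounded tp.
have iphi : ub.-integrable setT (EFin \o (fun t => phi (q t))).
  by apply: (bounded_integrable (M := Mp) measurableT ublty (measurableT_comp mp mq)) => t _; exact: pM.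
split; first by rewrite dE; exact: integrable_scale.
rewrite dE (RintegralZl _ mI iF).
rewrite (@Rfubini_bounded _ _ _ _ _ leb ub I setT f C mI measurableT Ilty ublty mf (fun x y _ _ => fC x y)).
have -> : \int[ub]_t \int[leb]_(theta in I) f (theta, t) = \int[ub]_t (- (4 * pi) * phi (q t)).
  by apply: eq_Rintegral => t _; exact: (radon_identity (q t) tp).
rewrite (RintegralZl _ measurableT iphi) mulN1r mulNr opprK; congr (_ * _).
rewrite /Rintegral; congr fine.
have mpe : measurable_fun setT (EFin \o phi : plane R -> \bar R) by exact/measurable_EFinP.
have mpe2 : measurable_fun setT (EFin \o phi \o quadratic_form A).
  by apply: (measurableT_comp mpe); exact: measurable_funPT.
have inu : (@sphere_measure R n).-integrable setT (EFin \o phi \o quadratic_form A).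
  by apply: integrable_pushforward => //.
rewrite (integral_distribution mpe inu).
exact/esym/(integral_distribution mpe2 iphi).
Qed.

Lemma numerical_measure_dominated A : (@to_plane R @` numerical_range A)° !=set0 ->
  charge_of_finite_measure (numerical_measure A) `<< leb2.
Proof.
move=> hW; apply/null_content_dominatesP => N mN N0.
exact: numerical_measure_null hW mN N0.
Qed.

End assembly.

Local Open Scope complex_scope.

Theorem proposition4p2 (R : realType) (n : nat) (A : 'M[R[i]]_n)
  (hW : (@to_plane R @` numerical_range A)° !=set0)
  (lambda : R -> 'rV[R]_n)
  (hlambda : forall theta,
     char_poly (hermitian_part A theta) =
     \prod_(j < n) ('X - ((lambda theta 0 j)%:C)%:P)) :
  (@lebesgue2 R).-integrable setT (numerical_density A) /\
  exists g : R * R -> R,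
    [/\ (@lebesgue2 R).-integrable setT (fun z => (g z)%:E),
        forall phi : R * R -> R, test_function phi ->
          (@lebesgue_measure R).-integrable `[0, 2 * pi]
            (fun theta => (density_integrand lambda phi theta)%:E) /\
          (4 * pi)^-1 * \int[@lebesgue_measure R]_(theta in `[0, 2 * pi])
                           density_integrand lambda phi theta =
          \int[@lebesgue2 R]_(z in setT) (g z * phi z) &
        {ae @lebesgue2 R, forall z, numerical_density A z = (g z)%:E}].
Proof.
have dom := numerical_measure_dominated hW.
have dfin z : numerical_density A z \is a fin_num by exact: Radon_Nikodym_fin_num.
have dint : (@lebesgue2 R).-integrable setT (numerical_density A).
  exact: Radon_Nikodym_integrable.
split; first exact: dint.
(* By domination the derivative is finite everywhere, so that [fine] loses nothing and the equality
   holds at every point. *)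
exists (fun z => fine (numerical_density A z)).
have dE : (fun z => (fine (numerical_density A z))%:E) = numerical_density A.
  by apply/funext => z; rewrite fineK.
split; [by rewrite dE| |by apply: aeW => z; rewrite fineK].
move=> phi tp; have [di ->] := density_integral hW hlambda tp.
split; first exact: di.
rewrite mulKf; last by rewrite mulf_neq0// lt0r_neq0// pi_gt0.
have [M M0 pM] := test_function_bounded tp.
have mp := continuous_measurable_plane (tp.1 0%N).
have nlty : (numerical_measure A setT < +oo)%E by rewrite probability_setT ltry.
have ip : (numerical_measure A).-integrable setT (EFin \o phi).
  by apply: (bounded_integrable (M := M) measurableT nlty mp) => z _; exact: pM.
have := Radon_Nikodym_change_of_variables dom measurableT ip.
rewrite /Rintegral => <-; congr fine; apply: eq_integral => z _ /=.
by rewrite -[X in (_ * X)%E](fineK (dfin z)) -EFinM mulrC.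
Qed.
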